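(* Let $\mathcal{M}=(M,<,\ldots)$ be an o-minimal structure. Let $\varphi(x,y)$ be a formula and $B\subseteq M^{|y|}$ be a (not necessarily definable) set such that the family $\{\varphi(x,b):b\in B\}$ is consistent and downward directed. Then there exist a type $p(x)\in S(M)$ with $\{\varphi(x,b):b\in B\}\subseteq p(x)$ and a formula $\psi(x,z)$ such that $p|^1_\psi$ defines a family of cells, is downward directed, and $p|^1_\psi\vdash p$. Furthermore, if $B$ is definable, then $p(x)$ can be chosen definable too. In particular, for every definable downward directed family of nonempty sets $\mathcal{S}$, there exists a definable downward directed family of cells $\mathcal{F}$ which refines $\mathcal{S}$ and furthermore $\mathcal{F}$ generates a definable type in $S(M)$.
   Context: $\mathcal{M}$ expands a dense linear order without endpoints. Formulas may have parameters from $M$ and ''definable'' means definable with parameters; variables are finite tuples. A definable family of sets is one of the form $\{\varphi(M,b): b\in B\}$ with $B$ definable, where $\varphi(M,b)=\{a\in M^{|x|}:\mathcal{M}\models\varphi(a,b)\}$. ''Cell'' means o-minimal cell in the usual sense. $S(M)$ is the set of complete types over $M$; types are identified with the families of definable sets given by their formulas. A type $p(x)$ is definable if for every formula $\theta(x,y)$ the set $\{b\in M^{|y|}:\theta(x,b)\in p(x)\}$ is definable. For a formula $\psi(x,z)$, $p|^1_\psi=\{\psi(x,c)\in p(x):c\in M^{|z|}\}$. For formulas, $\varphi(x)\vdash\psi(x)$ means $\mathcal{M}\models\forall x(\varphi\to\psi)$; for sets of formulas, $p\vdash q$ means that for every $\varphi\in q$ there is a finite $p'\subseteq p$ with $\bigwedge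 p'\vdash\varphi$. A family of sets (or of formulas, via the sets they define) is downward directed if for any two members $F_0,F_1$ there is a member $F_2\subseteq F_0\cap F_1$; it is consistent if every finite subfamily has nonempty intersection. $\mathcal{F}$ refines $\mathcal{S}$ if every $S\in\mathcal{S}$ contains some $F\in\mathcal{F}$. $\mathcal{F}$ generates a type $p$ if $\mathcal{F}\subseteq p$ and, viewing sets as formulas, $\mathcal{F}\vdash p$. *)

(* Defs.v *)
From HB Require Import structures.
From mathcomp Require Import all_boot all_order all_algebra.
From mathcomp Require Import all_classical.
From mathcomp Require Import topology.

Set Implicit Arguments.
Unset Strict Implicit.
Unset Printing Implicit Defensive.

Import Order.TTheory.
Local Open Scope order_scope.
Local Open Scope classical_set_scope.

Record dense_without_endpoints d (M : orderType d) : Prop := {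
  dlo_inhabited : inhabited M;
  dlo_dense : forall x y : M, x < y -> exists z, x < z /\ z < y;
  dlo_no_min : forall x : M, exists y, y < x;
  dlo_no_max : forall x : M, exists y, x < y }.

(* The symbols of the language other than [<] (and equality), which are
   built into formulas. *)
Record signature := {
  fsym : Type;
  farity : fsym -> nat;
  rsym : Type;
  rarity : rsym -> nat }.

(* An expansion of [(M, <)].  Points of [M^n] are row vectors.  The type [M]
   is an [orderTopologicalType], i.e., a total order with its order topology
   (which is determined by the order), and [M^n] has the product topology. *)
Record expansion d (M : orderTopologicalType d) (L : signature) := {
  fint : forall f : fsym L, 'rV[M]_(farity f) -> M;
  rint : forall r : rsym L, 'rV[M]_(rarity r) -> Prop }.

Section Syntax.
Variables (L : signature) (T : Type).

(* Terms and formulas have parameters from [T] and free variables indexed by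
   ['I_n].  The variable bound by a quantifier is the last one, [ord_max]. *)
Inductive term (n : nat) : Type :=
| Var of 'I_n
| Par of T
| Fun (f : fsym L) of ('I_(farity f) -> term n).

Inductive formula : nat -> Type :=
| Eq n of term n & term n : formula n
| Lt n of term n & term n : formula n
| Rel n (r : rsym L) of ('I_(rarity r) -> term n) : formula n
| Not n of formula n : formula n
| And n of formula n & formula n : formula n
| Ex n of formula n.+1 : formula n.

Fixpoint tsubst n k (s : 'I_n -> term k) (t : term n) : term k :=
  match t with
  | Var i => s i
  | Par c => Par k c
  | Fun f u => Fun (fun i => tsubst s (u i))
  end.

Definition tweaken n (t : term n) : term n.+1 :=
  tsubst (fun i => Var (lift ord_max i)) t.

Definition subst_up n k (s : 'I_n -> term k) (i : 'I_n.+1) : term k.+1 :=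
  if unlift ord_max i is Some j then tweaken (s j) else Var ord_max.

Fixpoint fsubst n k (s : 'I_n -> term k) (phi : formula n) : formula k :=
  match phi in formula n return ('I_n -> term k) -> formula k with
  | Eq _ t u => fun s => Eq (tsubst s t) (tsubst s u)
  | Lt _ t u => fun s => Lt (tsubst s t) (tsubst s u)
  | Rel _ r u => fun s => Rel (fun i => tsubst s (u i))
  | Not _ f => fun s => Not (fsubst s f)
  | And _ f g => fun s => And (fsubst s f) (fsubst s g)
  | Ex _ f => fun s => Ex (fsubst (subst_up s) f)
  end s.

(* For [phi(x, y)] with [|x| = n] and [|y| = m], the formula [phi(x, b)]. *)
Definition inst n m (phi : formula (n + m)) (b : 'rV[T]_m) : formula n :=
  fsubst (fun i : 'I_(n + m) =>
            match fintype.split i with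
            | inl j => Var j
            | inr j => Par n (b ord0 j)
            end) phi.

End Syntax.

Definition snoc T n (a : 'rV[T]_n) (t : T) : 'rV[T]_n.+1 :=
  (\row_i (if unlift ord_max i is Some j then a ord0 j else t))%R.

Section Families.
Variable X : Type.
Implicit Types F S : set (set X).

Definition downward_directed F :=
  forall A B, F A -> F B -> exists C, F C /\ C `<=` A `&` B.

Definition consistent F :=
  forall G, G `<=` F -> finite_set G -> \bigcap_(A in G) A !=set0.

Definition refines F S := forall A, S A -> exists B, F B /\ B `<=` A.

End Families.

Section Structure.
Variables (d : Order.disp_t) (M : orderTopologicalType d) (L : signature).
Variable (str : expansion M L).
Local Notation form := (formula L M).

Fixpoint teval n (a : 'rV[M]_n) (t : term L M n) : M :=
  match t with
  | Var i => a ord0 i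
  | Par c => c
  | Fun f u => fint str (\row_i teval a (u i))%R
  end.

Fixpoint sat n (phi : form n) : 'rV[M]_n -> Prop :=
  match phi in formula _ _ n return 'rV[M]_n -> Prop with
  | Eq _ t u => fun a => teval a t = teval a u
  | Lt _ t u => fun a => teval a t < teval a u
  | Rel _ r u => fun a => rint str (\row_i teval a (u i))%R
  | Not _ f => fun a => ~ sat f a
  | And _ f g => fun a => sat f a /\ sat g a
  | Ex _ f => fun a => exists t, sat f (snoc a t)
  end.

Definition defset n (phi : form n) : set 'rV[M]_n := [set a | sat phi a].

Definition definable n (A : set 'rV[M]_n) := exists phi : form n, A = defset phi.

Definition definable_family n (F : set (set 'rV[M]_n)) :=
  exists m (phi : form (n + m)) (B : set 'rV[M]_m),
    definable B /\ F = [set [set a | sat phi (row_mx a b)] | b in B].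

Definition o_minimal :=
  forall phi : form 1,
    exists (P : seq M) (I : seq (interval M)),
      [set t | sat phi (const_mx t)] =
      [set` P] `|` \bigcup_(i in [set` I]) [set` i].

Section Cells.
Variable n : nat.
Implicit Types (D : set 'rV[M]_n) (f : 'rV[M]_n -> M).

(* A function on [D] is represented by a total function, used on [D] only. *)
Definition graph D f : set 'rV[M]_n.+1 :=
  [set x | D (col' ord_max x) /\ x ord0 ord_max = f (col' ord_max x)].

Definition definable_continuous D f :=
  definable (graph D f) /\ {within D, continuous f}.

(* As a lower (resp. upper) bound, [None] stands for the constant [-oo]
   (resp. [+oo]). *)
Definition band D (l u : option ('rV[M]_n -> M)) : set 'rV[M]_n.+1 :=
  [set x | [/\ D (col' ord_max x),
     if l is Some f then f (col' ord_max x) < x ord0 ord_max else True &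
     if u is Some g then x ord0 ord_max < g (col' ord_max x) else True]].

Definition band_bounds D (l u : option ('rV[M]_n -> M)) :=
  [/\ if l is Some f then definable_continuous D f else True,
      if u is Some g then definable_continuous D g else True &
      match l, u with
      | Some f, Some g => forall a, D a -> f a < g a
      | _, _ => True
      end].

End Cells.

Fixpoint cell n : set 'rV[M]_n -> Prop :=
  match n with
  | 0 => fun C => C = setT
  | n'.+1 => fun C : set 'rV[M]_n'.+1 =>
      exists D : set 'rV[M]_n', cell D /\
        ((exists f, definable_continuous D f /\ C = graph D f) \/
         (exists l u, band_bounds D l u /\ C = band D l u))
  end.

Section Types.
Variable n : nat.
Implicit Types p q : set (form n).

Definition sets_of p : set (set 'rV[M]_n) := [set defset phi | phi in p].

Definition formulas_of (F : set (set 'rV[M]_n)) : set (form n) :=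
  [set phi | F (defset phi)].

Definition entails p q :=
  forall phi, q phi -> exists p', [/\ p' `<=` p, finite_set p' &
    \bigcap_(chi in p') defset chi `<=` defset phi].

(* The elements of [S(M)], for a fixed tuple of [n] variables. *)
Definition complete_type p :=
  consistent (sets_of p) /\ forall phi, p phi \/ p (Not phi).

Definition definable_type p :=
  forall m (theta : form (n + m)), definable [set b | p (inst theta b)].

(* Usually written [p|^1_psi]. *)
Definition restr1 p k (psi : form (n + k)) : set (form n) :=
  p `&` range (inst psi).

Definition generates (F : set (set 'rV[M]_n)) p :=
  F `<=` sets_of p /\ entails (formulas_of F) p.

End Types.

Lemma teval_tsubst n k (s : 'I_n -> term L M k) (a : 'rV[M]_k) t :
  teval a (tsubst s t) = teval (\row_i teval a (s i))%R t.
Proof.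
elim: t => [i|c|f u IH] //=; first by rewrite mxE.
by congr fint; apply/rowP => i; rewrite !mxE IH.
Qed.

Lemma teval_tweaken n (a : 'rV[M]_n) x t : teval (snoc a x) (tweaken t) = teval a t.
Proof.
rewrite /tweaken teval_tsubst; congr teval.
by apply/rowP => i; rewrite !mxE /= mxE liftK.
Qed.

Lemma sat_fsubst n k (s : 'I_n -> term L M k) (phi : form n) (a : 'rV[M]_k) :
  sat (fsubst s phi) a <-> sat phi (\row_i teval a (s i))%R.
Proof.
elim: phi k s a => {n} [n t u|n t u|n r u|n f IH|n f IHf g IHg|n f IH] k s a /=.
- by rewrite !teval_tsubst.
- by rewrite !teval_tsubst.
- suff -> : (\row_i teval a (tsubst s (u i)) =
             \row_i teval (\row_i teval a (s i)) (u i))%R by [].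
  by apply/rowP => i; rewrite !mxE teval_tsubst.
- by rewrite IH.
- by rewrite IHf IHg.
- have E t : (\row_i teval (snoc a t) (subst_up s i) =
              snoc (\row_i teval a (s i)) t)%R.
    apply/rowP => i; rewrite !mxE /subst_up; case: unliftP => [j _|_].
      by rewrite teval_tweaken mxE.
    by rewrite /= mxE unlift_none.
  by split=> -[t] H; exists t; move: H; rewrite IH E.
Qed.

Lemma defset_inst n m (phi : form (n + m)) (b : 'rV[M]_m) :
  defset (inst phi b) = [set a | sat phi (row_mx a b)].
Proof.
apply/seteqP; split=> a /=; rewrite /defset /= /inst sat_fsubst.
all: set r := (\row__ _)%R; suff -> : r = row_mx a b by [].
all: by apply/rowP => i; rewrite !mxE; case: (fintype.split i).
Qed.

End Structure.

(* Main.v *)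
(* Types are handled as ultrafilters on [M^n].  The cell decomposition theorem
   takes the form: every definable set in an ultrafilter [U] contains a cell of
   [U] on which a given definable function is continuous, where the cell has the
   signature of [U], i.e., it is a graph in exactly those coordinates in which
   [U] contains a graph.  Nested cells with the same signature are relatively
   open in one another, which replaces dimension theory.

   For a directed family [S_b] in [M^(n+1)], choose by induction a type
   [q] for the projections.  If some definable [g] satisfies [g(x) in S_b(x)]
   for all [b] and [q]-almost all [x], then take the type of [(x, g(x))].
   Otherwise let [t] be just above the infima of all [S_b(x)]: this is a cut
   over [q], and since the [S_b] omit every definable function, the components
   of the [S_b(x)] around this cut generate the type of [(x, t)]. *)

Require Import Defs.
From HB Require Import structures.
From mathcomp Require Import all_boot all_order all_algebra.
From mathcomp Require Import all_classical.
From mathcomp Require Import topology.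

Set Implicit Arguments.
Unset Strict Implicit.
Unset Printing Implicit Defensive.

Import Order.TTheory.
Local Open Scope order_scope.
Local Open Scope classical_set_scope.

(** * Definable predicates *)

Section Definability.
Variables (d : Order.disp_t) (M : orderTopologicalType d) (L : signature).
Variable str : expansion M L.
Implicit Types (e : nat -> M) (P Q : (nat -> M) -> Prop) (F G : (nat -> M) -> M).

(** The requirement that every instance of [psi] in the type be a cell shapes the construction.
    Continuity of the boundary functions and nonemptiness of the fibres are written into the formula
    itself, so that an instance violating them is empty and cannot lie in the type. This is why
    continuity is expressed by boxes, in a first-order way that is uniform in the parameters.

    The absence of a definable section serves three times. It makes the conditions on the cut
    consistent. It provides, for each upper bound [u] of a cell around the cut, some [S_b] that
    omits [u], so that the component of [S_b(x)] at the cut stops before [u(x)]. And it prevents a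
    definable set and its complement from both passing a membership test that mentions only [B] and
    [q]; this test is the source of the definability of the type.

    Cell decomposition is proved for all ultrafilters at once, because continuity in several
    variables needs the induction hypothesis for auxiliary ultrafilters on the base. Every case
    distinction is settled by the ultrafilter, so no partition into cells is ever formed. *)

Definition erow n e : 'rV[M]_n := (\row_(i < n) e i)%R.

Definition scons (t : M) e : nat -> M := fun i => if i is j.+1 then e j else t.

(* Predicates on environments [nat -> M]: in the rules below, the variable
   introduced by a quantifier becomes variable 0 and the others are shifted. *)
Definition dpred P :=
  exists n (phi : formula L M n), forall e, P e <-> sat str phi (erow n e).

Definition dfun F := dpred (fun e => F (fun i => e i.+1) = e 0%N).

Definition dvec n (V : (nat -> M) -> 'rV[M]_n) :=
  forall i, dfun (fun e => V e ord0 i).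

Lemma dpred_ext P Q : (forall e, P e <-> Q e) -> dpred P -> dpred Q.
Proof. by move=> PQ [n [phi H]]; exists n, phi => e; rewrite -PQ H. Qed.

Lemma dpred_rename P (s : nat -> nat) : dpred P -> dpred (fun e => P (fun i => e (s i))).
Proof.
move=> [n [phi H]]; pose N := (\max_(i < n) s i).+1.
exists N, (fsubst (fun i : 'I_n => Var _ _ (inord (s i))) phi) => e.
rewrite H sat_fsubst; suff -> : erow n (fun i => e (s i)) =
  (\row_i teval str (erow N e) (Var L M (inord (s i))))%R by [].
by apply/rowP => i; rewrite !mxE /= mxE inordK // ltnS (leq_bigmax i).
Qed.

Lemma dpred_widen P : dpred P -> exists n0, forall n, (n0 <= n)%N ->
  exists phi : formula L M n, forall e, P e <-> sat str phi (erow n e).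
Proof.
move=> [n0 [phi H]]; exists n0 => n le_n.
exists (fsubst (fun i => Var _ _ (widen_ord le_n i)) phi) => e.
rewrite H sat_fsubst; suff -> : erow n0 e =
  (\row_i teval str (erow n e) (Var L M (widen_ord le_n i)))%R by [].
by apply/rowP => i; rewrite !mxE /= mxE.
Qed.

Lemma dpred_not P : dpred P -> dpred (fun e => ~ P e).
Proof. by move=> [n [phi H]]; exists n, (Not phi) => e; rewrite H. Qed.

Lemma dpred_and P Q : dpred P -> dpred Q -> dpred (fun e => P e /\ Q e).
Proof.
move=> /dpred_widen[n Hn] /dpred_widen[m Hm].
have [phi Hp] := Hn (maxn n m) (leq_maxl _ _).
have [psi Hq] := Hm (maxn n m) (leq_maxr _ _).
by exists (maxn n m), (And phi psi) => e; rewrite Hp Hq.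
Qed.

Lemma dpred_or P Q : dpred P -> dpred Q -> dpred (fun e => P e \/ Q e).
Proof.
move=> dP dQ; have := dpred_not (dpred_and (dpred_not dP) (dpred_not dQ)).
apply: dpred_ext => e; split; last by move=> [pe|qe] [nP nQ].
by move=> H; apply: contrapT => /not_orP.
Qed.

Lemma dpred_imp P Q : dpred P -> dpred Q -> dpred (fun e => P e -> Q e).
Proof.
move=> dP dQ; have := dpred_or (dpred_not dP) dQ.
by apply: dpred_ext => e; split; [case|case: (pselect (P e)) => ? H; [right; apply: H|left]].
Qed.

Lemma dpred_iff P Q : dpred P -> dpred Q -> dpred (fun e => P e <-> Q e).
Proof. by move=> dP dQ; apply: dpred_and; apply: dpred_imp. Qed.

Lemma dpred_ex (P : (nat -> M) -> M -> Prop) :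
  dpred (fun e => P (fun i => e i.+1) (e 0%N)) -> dpred (fun e => exists t, P e t).
Proof.
move=> [n [phi H]].
(* [Ex] binds the last variable, whereas the rule binds variable 0; [s] rotates the indices to
   match. *)
pose s (i : 'I_n) : term L M n.+1 :=
  if nat_of_ord i is j.+1 then Var _ _ (inord j) else Var _ _ ord_max.
exists n, (Ex (fsubst s phi)) => e /=.
have E t : P e t <-> sat str (fsubst s phi) (snoc (erow n e) t).
  rewrite sat_fsubst; suff <- : erow n (scons t e) =
    (\row_i teval str (snoc (erow n e) t) (s i))%R by exact: (H (scons t e)).
  apply/rowP => -[[|j] lt_j]; rewrite !mxE /s /= mxE ?unlift_none //.
  case: unliftP => [k|] /(congr1 val) /=; rewrite inordK /= ?ltnS ?(ltnW (ltnW lt_j)) //.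
    by rewrite /bump leqNgt ltn_ord /= => ->; rewrite mxE.
  by move=> jn; move: lt_j; rewrite jn ltnNge leqnSn.
by split=> -[t] /E ?; exists t.
Qed.

Lemma dpred_all (P : (nat -> M) -> M -> Prop) :
  dpred (fun e => P (fun i => e i.+1) (e 0%N)) -> dpred (fun e => forall t, P e t).
Proof.
move=> dP; have := dpred_not (dpred_ex (P := fun e t => ~ P e t) (dpred_not dP)).
by apply: dpred_ext => e; split=> [nE t|Pe [t]]; [apply: contrapT => ?; apply: nE; exists t|].
Qed.

Lemma dpred_const (p : Prop) : dpred (fun=> p).
Proof.
exists 1%N; case: (pselect p) => pp.
  by exists (Eq (Var _ _ ord0) (Var _ _ ord0)) => e.
by exists (Not (Eq (Var _ _ ord0) (Var _ _ ord0))) => e; split=> // /(_ erefl).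
Qed.

Lemma dpred_eq_var i j : dpred (fun e => e i = e j).
Proof.
exists (maxn i j).+1, (Eq (Var _ _ (inord i)) (Var _ _ (inord j))) => e /=.
by rewrite !mxE !inordK ?ltnS ?leq_maxl ?leq_maxr.
Qed.

Lemma dpred_lt_var i j : dpred (fun e => e i < e j).
Proof.
exists (maxn i j).+1, (Lt (Var _ _ (inord i)) (Var _ _ (inord j))) => e /=.
by rewrite !mxE !inordK ?ltnS ?leq_maxl ?leq_maxr.
Qed.

Lemma dfun_var i : dfun (fun e => e i).
Proof. exact: dpred_eq_var. Qed.

Lemma dfun_const (c : M) : dfun (fun=> c).
Proof. by exists 1%N, (Eq (Par _ _ c) (Var _ _ ord0)) => e /=; rewrite mxE. Qed.

Lemma dpred_subst1 (P : (nat -> M) -> M -> Prop) F :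
  dpred (fun e => P (fun i => e i.+1) (e 0%N)) -> dfun F -> dpred (fun e => P e (F e)).
Proof.
move=> dP dF; have := dpred_ex (P := fun e t => F e = t /\ P e t) (dpred_and dF dP).
by apply: dpred_ext => e; split=> [[t [<-]]|?] //; exists (F e).
Qed.

Lemma dfun_shift F : dfun F -> dfun (fun e => F (fun i => e i.+1)).
Proof.
exact: (@dpred_rename _ (fun i => if i is j.+1 then j.+2 else 0%N)).
Qed.

Lemma dvec_shift n (V : (nat -> M) -> 'rV[M]_n) : dvec V -> dvec (fun e => V (fun i => e i.+1)).
Proof. by move=> dV i; apply: (dfun_shift (F := fun e => V e ord0 i)). Qed.

Lemma dpred_eq F G : dfun F -> dfun G -> dpred (fun e => F e = G e).
Proof.
move=> dF dG; apply: (dpred_subst1 (P := fun e t => F e = t)) => //.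
Qed.

Lemma dpred_lt F G : dfun F -> dfun G -> dpred (fun e => F e < G e).
Proof.
move=> dF dG; apply: (dpred_subst1 (P := fun e t => F e < t)) => //.
apply: (dpred_subst1 (P := fun e t => t < e 0%N)); first exact: dpred_lt_var.
exact: dfun_shift.
Qed.

Lemma dpred_le F G : dfun F -> dfun G -> dpred (fun e => F e <= G e).
Proof.
move=> dF dG; have := dpred_not (dpred_lt dG dF).
by apply: dpred_ext => e; rewrite leNgt; split=> /negP.
Qed.

Lemma erow_snoc n e : erow n.+1 e = snoc (erow n e) (e n).
Proof.
apply/rowP => i; rewrite !mxE; case: unliftP => [j|] -> //.
by rewrite mxE /= /bump leqNgt ltn_ord.
Qed.

Lemma dpred_exv n (P : (nat -> M) -> 'rV[M]_n -> Prop) :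
  dpred (fun e => P (fun i => e (n + i)%N) (erow n e)) ->
  dpred (fun e => exists v, P e v).
Proof.
elim: n P => [|n IH] P dP.
  move: dP; apply: dpred_ext => e; split=> [Pe|[v]].
    by exists (erow 0 e).
  rewrite (_ : (fun i => e i) = e) // => Pe.
  by rewrite (_ : erow 0 e = v) //; apply/rowP => -[].
have {}dP : dpred (fun e => exists t v, P e (snoc v t)).
  apply: dpred_ex; apply: IH; move: dP; apply: dpred_ext => e.
  rewrite erow_snoc addn0.
  by rewrite (_ : (fun i => _) = (fun i => e (n + i.+1)%N)) //; apply/funext => i; rewrite addnS.
move: dP; apply: dpred_ext => e; split=> [[t [v H]]|[v H]]; first by eexists; exact: H.
exists (v ord0 ord_max), (\row_i v ord0 (lift ord_max i))%R.
rewrite (_ : snoc _ _ = v) //; apply/rowP => i; rewrite !mxE.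
by case: unliftP => [j|] ->; rewrite ?mxE.
Qed.

Lemma dpred_allv n (P : (nat -> M) -> 'rV[M]_n -> Prop) :
  dpred (fun e => P (fun i => e (n + i)%N) (erow n e)) ->
  dpred (fun e => forall v, P e v).
Proof.
move=> dP; have := dpred_not (dpred_exv (P := fun e t => ~ P e t) (dpred_not dP)).
by apply: dpred_ext => e; split=> [nE t|Pe [t]]; [apply: contrapT => ?; apply: nE; exists t|].
Qed.

Lemma dpred_alls (T : eqType) (s : seq T) (P : (nat -> M) -> T -> Prop) :
  (forall i, dpred (fun e => P e i)) -> dpred (fun e => forall i, i \in s -> P e i).
Proof.
move=> dP; elim: s => [|i s IH].
  by apply: dpred_ext (dpred_const True) => e; split.
apply: dpred_ext (dpred_and (dP i) IH) => e; split=> [[Pi Ps] j|H].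
  by rewrite inE => /predU1P[->|/Ps].
by split=> [|j js]; apply: H; rewrite inE ?eqxx ?js ?orbT.
Qed.

Lemma dpred_alli n (P : (nat -> M) -> 'I_n -> Prop) :
  (forall i, dpred (fun e => P e i)) -> dpred (fun e => forall i, P e i).
Proof.
move=> dP; apply: dpred_ext (dpred_alls (enum 'I_n) dP) => e.
by split=> [H i|//]; apply: H; rewrite mem_enum.
Qed.

Lemma dvec_erow n (s : nat -> nat) : dvec (fun e => erow n (fun i => e (s i))).
Proof. by move=> i; apply: dpred_ext (dfun_var (s i)) => e; rewrite mxE. Qed.

Lemma dvec_const n (v : 'rV[M]_n) : dvec (fun=> v).
Proof. by move=> i; apply: dfun_const. Qed.

Lemma dfun_coord n (V : (nat -> M) -> 'rV[M]_n) i j : dvec V -> dfun (fun e => V e j i).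
Proof. by move=> dV; rewrite (ord1 j). Qed.

Lemma dvec_snoc n (V : (nat -> M) -> 'rV[M]_n) F :
  dvec V -> dfun F -> dvec (fun e => snoc (V e) (F e)).
Proof.
move=> dV dF i; case: (unliftP ord_max i) => [j|] ->.
  by apply: dpred_ext (dV j) => e; rewrite mxE liftK.
by apply: dpred_ext dF => e; rewrite mxE unlift_none.
Qed.

Lemma dvec_col' n (V : (nat -> M) -> 'rV[M]_n.+1) i :
  dvec V -> dvec (fun e => col' i (V e)).
Proof. by move=> dV j; apply: dpred_ext (dV (lift i j)) => e; rewrite mxE. Qed.

Lemma dvec_row_mx n m (V : (nat -> M) -> 'rV[M]_n) (W : (nat -> M) -> 'rV[M]_m) :
  dvec V -> dvec W -> dvec (fun e => row_mx (V e) (W e)).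
Proof.
move=> dV dW i; case: (fintype.splitP i) => j ij.
  rewrite (_ : i = lshift m j); last exact: val_inj.
  by apply: dpred_ext (dV j) => e; rewrite row_mxEl.
rewrite (_ : i = rshift n j); last exact: val_inj.
by apply: dpred_ext (dW j) => e; rewrite row_mxEr.
Qed.

Lemma dvec_lsubmx n m (V : (nat -> M) -> 'rV[M]_(n + m)) :
  dvec V -> dvec (fun e => lsubmx (V e)).
Proof. by move=> dV i; apply: dpred_ext (dV (lshift m i)) => e; rewrite mxE. Qed.

Lemma dvec_rsubmx n m (V : (nat -> M) -> 'rV[M]_(n + m)) :
  dvec V -> dvec (fun e => rsubmx (V e)).
Proof. by move=> dV i; apply: dpred_ext (dV (rshift n i)) => e; rewrite mxE. Qed.

Lemma dfun_rename F (s : nat -> nat) : dfun F -> dfun (fun e => F (fun i => e (s i))).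
Proof. exact: (@dpred_rename _ (fun i => if i is j.+1 then (s j).+1 else 0%N)). Qed.

Lemma dpred_substv n (P : (nat -> M) -> 'rV[M]_n -> Prop) V :
  dpred (fun e => P (fun i => e (n + i)%N) (erow n e)) -> dvec V ->
  dpred (fun e => P e (V e)).
Proof.
move=> dP dV.
have dQ : dpred (fun e => exists v, (forall i, V e ord0 i = (v : 'rV[M]_n) ord0 i) /\ P e v).
  apply: dpred_exv; apply: dpred_and => //; apply: dpred_alli => i.
  apply: dpred_eq; last exact: (@dvec_erow n (fun i => i) i).
  exact: (dfun_rename (F := fun e => V e ord0 i)).
move: dQ; apply: dpred_ext => e; split=> [[v [/rowP <-]]|PV] //; by exists (V e).
Qed.

Lemma definableP (x0 : M) n (A : set 'rV[M]_n) :
  definable str A <-> dpred (fun e => A (erow n e)).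
Proof.
split=> [[phi ->]|]; first by exists n, phi.
move=> /dpred_widen[N HN]; have [phi H] := HN (maxn N n) (leq_maxl _ _).
(* Variables from [n] on do not affect the truth of [A (erow n e)]; they are filled with [x0]. *)
pose s (i : 'I_(maxn N n)) : term L M n :=
  if insub (nat_of_ord i) is Some j then Var _ _ j else Par L n x0.
exists (fsubst s phi); apply/predeqP => a; rewrite /defset /= sat_fsubst.
pose e i := if insub i is Some j then a ord0 j else x0.
have -> : (\row_i teval str a (s i))%R = erow (maxn N n) e.
  by apply/rowP => i; rewrite !mxE /s /e; case: insub.
rewrite -H (_ : erow n e = a) //.
by apply/rowP => i; rewrite mxE /e valK.
Qed.

End Definability.

(** * Neighbourhoods and infima *)

Section Near.
Variables (d : Order.disp_t) (M : orderTopologicalType d).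

Definition box n (a b x : 'rV[M]_n) := forall i, a ord0 i < x ord0 i /\ x ord0 i < b ord0 i.

(** Neighbourhoods are given by the corners of boxes, so that quantifying over them is first-order.
    Continuity of a definable family of functions thereby becomes a definable condition on its
    parameter, as [cut_cell] requires. *)
Definition near n (x : 'rV[M]_n) (P : 'rV[M]_n -> Prop) :=
  exists a b, box a b x /\ forall y, box a b y -> P y.

(* Continuity on [D] of a total function, of which only the values on [D]
   matter. *)
Definition contin n (D : set 'rV[M]_n) (f : 'rV[M]_n -> M) :=
  forall x, D x -> forall c,
    (c < f x -> near x (fun y => D y -> c < f y)) /\
    (f x < c -> near x (fun y => D y -> f y < c)).

Definition is_glb (S : M -> Prop) (a : M) :=
  (forall t, S t -> a <= t) /\ forall b, a < b -> exists t, S t /\ t < b.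

(* [x0] if [S] has no infimum in [M]. *)
Definition inf_ (x0 : M) (S : M -> Prop) : M := xget x0 (is_glb S).

Definition sup_ (x0 : M) (S : M -> Prop) : M := inf_ x0 (fun a => forall t, S t -> t <= a).

Lemma is_glb_uniq S a b : is_glb S a -> is_glb S b -> a = b.
Proof.
move=> [la ga] [lb gb]; apply/eqP; rewrite eq_le !leNgt.
apply/andP; split; apply/negP.
  by move=> /gb[t [/la at_ /(le_lt_trans at_)]]; rewrite ltxx.
by move=> /ga[t [/lb bt /(le_lt_trans bt)]]; rewrite ltxx.
Qed.

Lemma inf_E x0 S a : is_glb S a -> inf_ x0 S = a.
Proof. by move=> Sa; apply: (is_glb_uniq (S := S)) => //; apply: (xgetI x0 Sa). Qed.

End Near.

(** * Closure rules for definability *)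

Section Rules.
Variables (d : Order.disp_t) (M : orderTopologicalType d) (L : signature).
Variable str : expansion M L.
Local Notation dpred := (dpred str).
Local Notation dfun := (dfun str).
Local Notation dvec := (dvec str).

Definition dmap n (f : 'rV[M]_n -> M) := dfun (fun e => f (erow n e)).

Definition dfam m n (S : 'rV[M]_m -> 'rV[M]_n -> Prop) :=
  dpred (fun e => S (erow m (fun i => e (n + i)%N)) (erow n e)).

Lemma dpred_and3 (P Q R : (nat -> M) -> Prop) : dpred P -> dpred Q -> dpred R ->
  dpred (fun e => [/\ P e, Q e & R e]).
Proof.
move=> dP dQ dR; apply: dpred_ext (dpred_and dP (dpred_and dQ dR)) => e.
by split=> [[? []]|[]].
Qed.

Lemma dpred_and4 (P Q R S : (nat -> M) -> Prop) :
  dpred P -> dpred Q -> dpred R -> dpred S -> dpred (fun e => [/\ P e, Q e, R e & S e]).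
Proof.
move=> dP dQ dR dS; apply: dpred_ext (dpred_and (dpred_and dP dQ) (dpred_and dR dS)) => e.
by split=> [[[? ?] []]|[]].
Qed.

Definition drel n (Y : 'rV[M]_n -> M -> Prop) :=
  dpred (fun e => Y (erow n (fun i => e i.+1)) (e 0%N)).

Lemma dpred_mem n (A : set 'rV[M]_n) V : definable str A -> dvec V -> dpred (fun e => A (V e)).
Proof. by move=> [phi ->] dV; apply: (dpred_substv (P := fun=> _)) dV; exists n, phi. Qed.

Lemma dfun_map n (f : 'rV[M]_n -> M) V : dmap f -> dvec V -> dfun (fun e => f (V e)).
Proof.
move=> df dV; apply: (dpred_substv (P := fun e v => f v = e 0%N)); last exact: dvec_shift.
apply: dpred_ext (dpred_rename (fun i => if i is j.+1 then j else n) df) => e.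
by rewrite addn0.
Qed.

Lemma dpred_fam m n (S : 'rV[M]_m -> 'rV[M]_n -> Prop) V W :
  dfam S -> dvec V -> dvec W -> dpred (fun e => S (V e) (W e)).
Proof.
move=> dS dV dW; apply: (dpred_substv (P := fun e w => S (V e) w)) dW.
apply: (dpred_substv (P := fun e v => S v (erow n e))).
  apply: dpred_ext (dpred_rename (fun i => if (i < n)%N then (m + i)%N else (i - n)%N) dS) => e.
  rewrite (_ : erow m _ = erow m e); last by apply/rowP => i; rewrite !mxE ltnNge leq_addr /= addKn.
  by rewrite (_ : erow n (fun i => e (if _ then _ else _)) = erow n (fun i => e (m + i)%N)) //;
    apply/rowP => i; rewrite !mxE ltn_ord.
by move=> i; apply: (dfun_rename (F := fun e => V e ord0 i)).
Qed.

Lemma dpred_rel n (Y : 'rV[M]_n -> M -> Prop) V F :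
  drel Y -> dvec V -> dfun F -> dpred (fun e => Y (V e) (F e)).
Proof.
move=> dY dV dF; apply: (dpred_subst1 (P := fun e t => Y (V e) t)) dF.
apply: (dpred_substv (P := fun e v => Y v (e 0%N))); last exact: dvec_shift.
apply: dpred_ext (dpred_rename (fun i => if i is j.+1 then j else n) dY) => e.
by rewrite addn0.
Qed.

Definition dset (S : M -> Prop) := dpred (fun e => S (e 0%N)).

Definition drel2 (R : M -> M -> Prop) := dpred (fun e => R (e 0%N) (e 1%N)).

Lemma dpred_dset (S : M -> Prop) F : dset S -> dfun F -> dpred (fun e => S (F e)).
Proof.
move=> dS; apply: (dpred_subst1 (P := fun=> S)); exact: dS.
Qed.

Lemma dpred_rel2 (R : M -> M -> Prop) F G :
  drel2 R -> dfun F -> dfun G -> dpred (fun e => R (F e) (G e)).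
Proof.
move=> dR dF dG; apply: (dpred_subst1 (P := fun e t => R t (G e))) dF.
apply: (dpred_subst1 (P := fun e t => R (e 0%N) t)); last exact: dfun_shift.
exact: (dpred_rename (fun i => if i is 0 then 1 else 0)%N dR).
Qed.

Definition dfun1 (h : M -> M) := dfun (fun e => h (e 0%N)).

Lemma dfun_fun1 (h : M -> M) F : dfun1 h -> dfun F -> dfun (fun e => h (F e)).
Proof.
move=> dh dF; apply: (dpred_subst1 (P := fun e t => h t = e 0%N)); last exact: dfun_shift.
apply: dpred_ext (dpred_rename (fun i => if i is 0 then 1 else 0)%N dh) => e //.
Qed.

Lemma dvec_erow0 n : dvec (fun e => erow n e).
Proof. exact: (@dvec_erow _ _ _ str n (fun i => i)). Qed.

Lemma dpred_is_glb (S : (nat -> M) -> M -> Prop) F :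
  dpred (fun e => S (fun i => e i.+1) (e 0%N)) -> dfun F ->
  dpred (fun e => is_glb (S e) (F e)).
Proof.
move=> dS dF; apply: (dpred_subst1 (P := fun e => is_glb (S e))) dF.
apply: dpred_and.
  apply: dpred_all; apply: dpred_imp; last by apply: dpred_le; apply: dfun_var.
  exact: (dpred_rename (fun i => if i is j.+1 then j.+2 else 0%N) dS).
apply: dpred_all; apply: dpred_imp; first by apply: dpred_lt; apply: dfun_var.
apply: dpred_ex; apply: dpred_and; last by apply: dpred_lt; apply: dfun_var.
exact: (dpred_rename (fun i => if i is j.+1 then j.+3 else 0%N) dS).
Qed.

Lemma dfun_inf x0 (S : (nat -> M) -> M -> Prop) :
  dpred (fun e => S (fun i => e i.+1) (e 0%N)) -> dfun (fun e => inf_ x0 (S e)).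
Proof.
move=> dS; pose T e := S (fun i : nat => e i.+1) : M -> Prop.
have dT : dpred (fun e => T (fun i => e i.+1) (e 0%N)).
  exact: (dpred_rename (fun i => if i is j.+1 then j.+2 else 0%N) dS).
(* The value is held by variable 0, and [T] is [S] read past it. The second disjunct covers the
   default value [x0], without which [inf_] would not be definable everywhere. *)
have : dpred (fun e => is_glb (T e) (e 0%N) \/
                   ((forall a, ~ is_glb (T e) a) /\ x0 = e 0%N)).
  apply: dpred_or; first by apply: dpred_is_glb => //; apply: dfun_var.
  apply: dpred_and; last by apply: dpred_eq; [apply: dfun_const|apply: dfun_var].
  apply: dpred_all; apply: dpred_not; apply: dpred_is_glb; last exact: dfun_var.
  exact: (dpred_rename (fun i => if i is j.+1 then j.+2 else 0%N) dT).
apply: dpred_ext => e; rewrite -[inf_ _ _]/(inf_ x0 (T e)).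
split=> [[Sa|[nS]]|<-].
- exact: inf_E.
- by rewrite /inf_; case: xgetP => // y _ /nS.
- by rewrite /inf_; case: xgetP => [y _ Sy|nS]; [left|right].
Qed.

End Rules.

(** * Tactics for definability and for chains of inequalities *)

Ltac dstep :=
  cbv beta;
  match goal with
  | |- dpred _ (fun _ => ?p) => exact: dpred_const
  | |- dpred _ (fun e => (@?P e) /\ (@?Q e)) => apply: dpred_and
  | |- dpred _ (fun e => and3 (@?P e) (@?Q e) (@?R e)) => apply: dpred_and3
  | |- dpred _ (fun e => and4 (@?P e) (@?Q e) (@?R e) (@?S e)) => apply: dpred_and4
  | |- dpred _ (fun e => (@?P e) \/ (@?Q e)) => apply: dpred_or
  | |- dpred _ (fun e => (@?P e) <-> (@?Q e)) => apply: dpred_iff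
  | |- dpred _ (fun e => ~ (@?P e)) => apply: dpred_not
  | |- dpred _ (fun e => ex (@?P e)) => first [apply: dpred_ex | apply: dpred_exv]
  | |- dpred _ (fun e => near (@?V e) (@?P e)) => rewrite /near /box
  | |- dpred _ (fun e => is_glb (@?S e) (@?F e)) => apply: dpred_is_glb
  | |- dpred _ (fun e => is_true (@?F e)) => first [apply: dpred_lt | apply: dpred_le]
  | |- dpred _ (fun e => @?F e = @?G e) => apply: dpred_eq
  | |- dpred _ (fun e => forall x, @?P e x) =>
      first [apply: dpred_imp | apply: dpred_all | apply: dpred_allv | apply: dpred_alli => ?]
  | H : definable _ ?A |- dpred _ (fun e => ?A (@?V e)) => apply: (dpred_mem H)
  | H : dfam _ ?A |- dpred _ (fun e => ?A (@?V e) (@?W e)) => apply: (dpred_fam H)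
  | H : drel _ ?A |- dpred _ (fun e => ?A (@?V e) (@?W e)) => apply: (dpred_rel H)
  | H : dset _ ?S |- dpred _ (fun e => ?S (@?F e)) => apply: (dpred_dset H)
  | H : drel2 _ ?S |- dpred _ (fun e => ?S (@?F e) (@?G e)) => apply: (dpred_rel2 H)
  | H : dfun1 _ ?f |- dfun _ (fun e => ?f (@?V e)) => apply: (dfun_fun1 H)
  | |- dfun _ (fun _ => ?c) => exact: dfun_const
  | |- dfun _ (fun e => e ?i) => exact: dfun_var
  | |- dfun _ (fun e => inf_ ?x (@?S e)) => apply: dfun_inf
  | |- dfun _ (fun e => sup_ ?x (@?S e)) => apply: dfun_inf
  | H : dmap _ ?f |- dfun _ (fun e => ?f (@?V e)) => apply: (dfun_map H)
  | |- dfun _ (fun e => fun_of_matrix (@?V e) _ _) => apply: dfun_coord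
  | |- dvec _ (fun _ => ?v) => exact: dvec_const
  | |- dvec _ (fun e => snoc (@?V e) (@?F e)) => apply: dvec_snoc
  | |- dvec _ (fun e => col' ?i (@?V e)) => apply: dvec_col'
  | |- dvec _ (fun e => row_mx (@?V e) (@?F e)) => apply: dvec_row_mx
  | |- dvec _ (fun e => lsubmx (@?V e)) => apply: dvec_lsubmx
  | |- dvec _ (fun e => rsubmx (@?V e)) => apply: dvec_rsubmx
  | |- dvec _ _ => first [exact: dvec_erow0 | exact: dvec_erow]
  end.

Ltac dsolve := repeat dstep.

Ltac le_path :=
  match goal with
  | |- is_true (@Order.le _ _ ?a ?a) => exact: lexx
  | H : is_true (@Order.le _ _ ?a ?b) |- is_true (@Order.le _ _ ?a ?b) => exact: H
  | H : is_true (@Order.lt _ _ ?a ?b) |- is_true (@Order.le _ _ ?a ?b) => exact: (ltW H)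
  | H : is_true (@Order.le _ _ ?a _) |- is_true (@Order.le _ _ ?a _) =>
      apply: (le_trans H); clear H; le_path
  | H : is_true (@Order.lt _ _ ?a _) |- is_true (@Order.le _ _ ?a _) =>
      apply: (le_trans (ltW H)); clear H; le_path
  end.

Ltac lt_path :=
  match goal with
  | H : is_true (@Order.lt _ _ ?a ?b) |- is_true (@Order.lt _ _ ?a ?b) => exact: H
  | H : is_true (@Order.lt _ _ ?a _) |- is_true (@Order.lt _ _ ?a _) =>
      apply: (lt_le_trans H); clear H; le_path
  | H : is_true (@Order.le _ _ ?a _) |- is_true (@Order.lt _ _ ?a _) =>
      apply: (le_lt_trans H); clear H; lt_path
  end.

(** Each step of a path discards the inequality that it uses, so the search terminates. If no path
    yields the goal, a strict inequality refuted by a path is looked for. *)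
Ltac ord :=
  repeat match goal with
  | H : _ /\ _ |- _ => destruct H
  | H : is_true (_ && _) |- _ => move/andP: H => [? ?]
  | H : ~ is_true (@Order.lt _ _ ?a ?b) |- _ => move/negP: H; rewrite -leNgt => H
  | H : ~ is_true (@Order.le _ _ ?a ?b) |- _ => move/negP: H; rewrite -ltNge => H
  end;
  first [ lt_path | le_path | exfalso;
    match goal with H : is_true (@Order.lt _ _ ?a ?b) |- _ =>
      have: is_true (Order.le b a) by [clear H; le_path]; rewrite leNgt H; done end ].

(** * Definable subsets of the line *)

Section OneDim.
Variables (d : Order.disp_t) (M : orderTopologicalType d) (L : signature).
Variables (str : expansion M L) (dlo : dense_without_endpoints M) (omin : o_minimal str).
Implicit Types (S : M -> Prop) (a b c t : M).

Let mid a b : a < b -> exists c, a < c /\ c < b. Proof. exact: dlo_dense. Qed.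

Lemma midmm a1 a2 b1 b2 : a1 < b1 -> a1 < b2 -> a2 < b1 -> a2 < b2 ->
  exists c, [/\ a1 < c, a2 < c, c < b1 & c < b2].
Proof.
move=> h11 h12 h21 h22; wlog le12 : a1 a2 h11 h12 h21 h22 / a1 <= a2 => [W|].
  have [/W|/ltW /W] := leP a1 a2; first exact.
  by case=> // c [? ? ? ?]; exists c.
wlog le12' : b1 b2 h11 h12 h21 h22 / b1 <= b2 => [W|].
  have [/W|/ltW /W] := leP b1 b2; first exact.
  by case=> // c [? ? ? ?]; exists c.
have [c [ac cb]] := mid h21; exists c; split=> //; ord.
Qed.

Lemma above2 a b : exists c, a < c /\ b < c.
Proof.
have [a' aa'] := dlo_no_max dlo a; have [b' bb'] := dlo_no_max dlo b.
by have [le|lt] := leP a' b'; [exists b'|exists a']; split=> //; ord.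
Qed.

Lemma below2 a b : exists c, c < a /\ c < b.
Proof.
have [a' aa'] := dlo_no_min dlo a; have [b' bb'] := dlo_no_min dlo b.
by have [le|lt] := leP a' b'; [exists a'|exists b']; split=> //; ord.
Qed.

Lemma above_lt a b1 b2 : a < b1 -> a < b2 -> exists c, [/\ a < c, c < b1 & c < b2].
Proof. by move=> h1 h2; have [c []] := midmm h1 h2 h1 h2; exists c. Qed.

Lemma below_gt b a1 a2 : a1 < b -> a2 < b -> exists c, [/\ c < b, a1 < c & a2 < c].
Proof. by move=> h1 h2; have [c []] := midmm h1 h1 h2 h2; exists c. Qed.

Local Notation dset := (dset str).

Definition set_union_ind (Phi : (M -> Prop) -> Prop) :=
  [/\ forall S S', (forall t, S t <-> S' t) -> Phi S -> Phi S',
      Phi (fun=> False),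
      forall i : interval M, Phi (fun t => t \in i) &
      forall S S', Phi S -> Phi S' -> Phi (fun t => S t \/ S' t)].

(** The o-minimality axiom enters the proof here; all later facts about definable subsets of the
    line come from this induction over finite unions of intervals. *)
Lemma dset_ind Phi : set_union_ind Phi -> forall S, dset S -> Phi S.
Proof.
move=> [Pext P0 Pi PU] S [n [phi H]].
(* [phi] may have many variables, but its truth depends on [e 0] only, so all of them may be
   identified with a single one. Points are then treated as intervals [[p, p]]. *)
have [P [I /predeqP E]] := omin (fsubst (fun=> Var _ _ ord0) phi).
have {}E t : S t <-> (exists2 i, i \in [seq `[p, p]%O | p <- P] ++ I & t \in i).
  have := E t; rewrite /mkset sat_fsubst; set r := (\row__ _)%R.
  have -> : r = erow n (fun=> t) by apply/rowP => i; rewrite !mxE /= mxE.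
  rewrite (H (fun=> t)) => ->; split=> [[tP|[i Ii ti]]|[i]].
  - by exists `[t, t]%O; rewrite ?mem_cat ?map_f // in_itv /= lexx.
  - by exists i; rewrite ?mem_cat ?Ii ?orbT.
  - rewrite mem_cat => /orP[/mapP[p pP ->]|iI ti]; last by right; exists i.
    by rewrite in_itv /= => /andP[? ?]; left; rewrite (_ : t = p) //; apply/le_anti/andP.
apply: (Pext _ _ (fun t => iff_sym (E t))).
elim: (_ ++ I) => [|i s IH]; first by apply: (Pext _ _ _ P0) => t; split=> // -[].
apply: (Pext _ _ _ (PU _ _ (Pi i) IH)) => t; split=> [[ti|[j js tj]]|[j]].
- by exists i; rewrite ?inE ?eqxx.
- by exists j; rewrite ?inE ?js ?orbT.
- by rewrite inE => /predU1P[->|js tj]; [left|right; exists j].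
Qed.

Lemma itv_convex (i : interval M) a b c : a \in i -> c \in i -> a <= b -> b <= c -> b \in i.
Proof.
case: i => [[[] l|[]] [[] r|[]]]; rewrite !in_itv /= ?andbT ?andbF // => *.
all: try (by ord); try (apply/andP; split); ord.
Qed.

(** If no interval to the right of [a] avoids [C], then points of [C] occur arbitrarily close to
    [a], and convexity fills in everything between two of them. *)
Lemma convex_germ (C : M -> Prop) a :
  (forall x y z, C x -> C z -> x <= y -> y <= z -> C y) ->
  exists e, a < e /\ ((forall t, a < t -> t < e -> C t) \/ (forall t, a < t -> t < e -> ~ C t)).
Proof.
move=> cvx; apply: contrapT => H.
have far e : a < e -> exists t, [/\ a < t, t < e & C t].
  move=> ae; apply: contrapT => N; apply: H; exists e; split=> //; right=> t at_ te Ct.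
  by apply: N; exists t.
have [e ae] := dlo_no_max dlo a; have [t [at_ te Ct]] := far e ae.
apply: H; exists t; split=> //; left=> u au ut.
by have [v [av vu Cv]] := far u au; apply: (cvx v u t) => //; exact: ltW.
Qed.

Lemma convex_germ_left (C : M -> Prop) a :
  (forall x y z, C x -> C z -> x <= y -> y <= z -> C y) ->
  exists e, e < a /\ ((forall t, e < t -> t < a -> C t) \/ (forall t, e < t -> t < a -> ~ C t)).
Proof.
move=> cvx; apply: contrapT => H.
have far e : e < a -> exists t, [/\ e < t, t < a & C t].
  move=> ae; apply: contrapT => N; apply: H; exists e; split=> //; right=> t at_ te Ct.
  by apply: N; exists t.
have [e ae] := dlo_no_min dlo a; have [t [et ta Ct]] := far e ae.
apply: H; exists t; split=> //; left=> u tu ua.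
by have [v [av vu Cv]] := far u ua; apply: (cvx t u v) => //; exact: ltW.
Qed.

Lemma dset_germ S a : dset S ->
  exists e, a < e /\ ((forall t, a < t -> t < e -> S t) \/ (forall t, a < t -> t < e -> ~ S t)).
Proof.
move: S; apply: dset_ind; split.
- move=> S S' E [e [ae H]]; exists e; split=> //.
  by case: H => H; [left|right] => t ? ?; rewrite -E; exact: H.
- by have [e ae] := dlo_no_max dlo a; exists e; split=> //; right=> ? _ _ [].
- by move=> i; apply: convex_germ => x y z; apply: itv_convex.
- move=> S S' [e [ae H]] [e' [ae' H']]; have [c [ac ce ce']] := above_lt ae ae'.
  exists c; split=> //; have lt_c t : t < c -> t < e /\ t < e' by split; ord.
  case: H => [H|H]; first by left=> t at_ /lt_c[? ?]; left; exact: H.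
  case: H' => [H'|H']; first by left=> t at_ /lt_c[? ?]; right; exact: H'.
  by right=> t at_ /lt_c[? ?] [/H|/H']; exact.
Qed.

Lemma dset_germ_left S a : dset S ->
  exists e, e < a /\ ((forall t, e < t -> t < a -> S t) \/ (forall t, e < t -> t < a -> ~ S t)).
Proof.
move: S; apply: dset_ind; split.
- move=> S S' E [e [ae H]]; exists e; split=> //.
  by case: H => H; [left|right] => t ? ?; rewrite -E; exact: H.
- by have [e ae] := dlo_no_min dlo a; exists e; split=> //; right=> ? _ _ [].
- by move=> i; apply: convex_germ_left => x y z; apply: itv_convex.
- move=> S S' [e [ae H]] [e' [ae' H']]; have [c [ca ec ec']] := below_gt ae ae'.
  exists c; split=> //; have lt_c t : c < t -> e < t /\ e' < t by split; ord.
  case: H => [H|H]; first by left=> t /lt_c[? ?] ?; left; exact: H.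
  case: H' => [H'|H']; first by left=> t /lt_c[? ?] ?; right; exact: H'.
  by right=> t /lt_c[? ?] ? [/H|/H']; exact.
Qed.

(** An interval with two points contains an open interval; a finite union of intervals with at most
    one point each is finite. *)
Lemma dset_finite S : dset S ->
  (exists a b, a < b /\ forall t, a < t -> t < b -> S t) \/ exists s : seq M, forall t, S t <-> t \in s.
Proof.
move: S; apply: dset_ind; split.
- move=> S S' E [[a [b [ab H]]]|[s H]]; last by right; exists s => t; rewrite -E.
  by left; exists a, b; split=> // t ? ?; rewrite -E; exact: H.
- by right; exists [::].
- move=> i; have [[t ti]|no] := pselect (exists t, t \in i); last first.
    by right; exists [::] => t; split=> // ti; case: no; exists t.
  have [[u ui tu]|only] := pselect (exists2 u, u \in i & u != t).
    left; have [lt|lt|eq] := ltgtP t u; last by rewrite eq eqxx in tu.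
      by exists t, u; split=> // v ? ?; apply: (itv_convex ti ui); exact: ltW.
    by exists u, t; split=> // v ? ?; apply: (itv_convex ui ti); exact: ltW.
  right; exists [:: t] => u; rewrite mem_seq1; split=> [ui|/eqP->//].
  by apply/negPn/negP => ut; apply: only; exists u.
- move=> S S' [[a [b [ab H]]]|[s H]].
    by left; exists a, b; split=> // *; left; exact: H.
  case=> [[a [b [ab H']]]|[s' H']]; first by left; exists a, b; split=> // *; right; exact: H'.
  right; exists (s ++ s') => t; rewrite H H' mem_cat.
  by split=> /orP.
Qed.

Lemma dset_glb S : dset S ->
  [\/ forall t, ~ S t, forall t, exists s, S s /\ s < t | exists a, is_glb S a].
Proof.
move: S; apply: dset_ind; split.
- move=> S S' E [H|H|[a [H1 H2]]]; [apply: Or31|apply: Or32|apply: Or33].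
  + by move=> t; rewrite -E.
  + by move=> t; have [s] := H t; exists s; rewrite -E.
  + exists a; split=> [t|b /H2[s]]; first by rewrite -E; exact: H1.
    by exists s; rewrite -E.
- by apply: Or31 => ? [].
- move=> i; have [[t ti]|no] := pselect (exists t, t \in i); last first.
    by apply: Or31 => t ti; apply: no; exists t.
  case: i ti => [[b l|[]] r] ti; last by move: ti; rewrite itv_boundlr /=.
    apply: Or33; exists l; split=> [u|u lu]; first by case: b {ti}; rewrite itv_boundlr bnd_simp => /andP[? _]; ord.
    have lt : l <= t by case: b ti; rewrite itv_boundlr bnd_simp => /andP[? _]; ord.
    have [tu|ut] := ltP t u; first by exists t.
    have [v [lv vu]] := mid lu; exists v; split=> //.
    move: ti; rewrite !itv_boundlr /= => /andP[_ tr]; apply/andP; split.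
      by case: b; rewrite bnd_simp //; ord.
    by apply: le_trans tr; rewrite bnd_simp; ord.
  apply: Or32 => u; have [v [vu vt]] := below2 u t; exists v; split=> //.
  move: ti; rewrite !itv_boundlr /= => tr; apply: le_trans tr; rewrite bnd_simp; ord.
- move=> S S' [H|H|[a [Ha Ga]]].
  + move=> [H'|H'|[b [Hb Gb]]]; [apply: Or31|apply: Or32|apply: Or33].
    * by move=> t [/H|/H'].
    * by move=> t; have [s [Ss st]] := H' t; exists s; split=> //; right.
    * exists b; split=> [t [/H|/Hb]|c /Gb[t [St ?]]] //.
      by exists t; split=> //; right.
  + by move=> _; apply: Or32 => t; have [s [Ss st]] := H t; exists s; split=> //; left.
  move=> [H'|H'|[b [Hb Gb]]]; [apply: Or33|apply: Or32|apply: Or33].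
  + exists a; split=> [t [/Ha|/H']|c /Ga[t [St ?]]] //.
    by exists t; split=> //; left.
  + by move=> t; have [s [Ss st]] := H' t; exists s; split=> //; right.
  + have [ab|ba] := leP a b.
      exists a; split=> [t [/Ha|/Hb ?]|c /Ga[t [St ?]]] //; first ord.
      by exists t; split=> //; left.
    exists b; split=> [t [/Ha ?|/Hb]|c /Gb[t [St ?]]] //; first ord.
    by exists t; split=> //; right.
Qed.

Lemma glb_ex S a t : dset S -> (forall u, S u -> a <= u) -> S t -> exists b, is_glb S b.
Proof.
move=> dS lb St; have [/(_ t)//|/(_ a)[u [/lb ? ?]]|//] := dset_glb dS; ord.
Qed.

End OneDim.

(** * Monotonicity *)

Section Monotonicity.
Variables (d : Order.disp_t) (M : orderTopologicalType d) (L : signature).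
Variables (str : expansion M L) (dlo : dense_without_endpoints M) (omin : o_minimal str).
Implicit Types (S : M -> Prop) (a b c t : M).
Local Notation dset := (dset str).
Local Notation drel2 := (drel2 str).
Local Notation dfun1 := (dfun1 str).

Let mid a b : a < b -> exists c, a < c /\ c < b. Proof. exact: dlo_dense. Qed.

Lemma itv_induction S a b : dset S -> S a ->
  (forall c, a <= c -> c < b -> S c -> exists e, c < e /\ forall t, c < t -> t < e -> S t) ->
  (forall c, a < c -> c <= b -> (forall t, a <= t -> t < c -> S t) -> S c) ->
  forall t, a <= t -> t <= b -> S t.
Proof.
move=> dS Sa Hr Hl t at_ tb; apply: contrapT => nSt.
pose N t := a <= t /\ t <= b /\ ~ S t.
have dN : dset N by rewrite /dset /N; dsolve.
have [||g [lbg gg]] := @glb_ex _ _ _ _ dlo omin N a t dN; first by move=> u [].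
  by split.
have ag : a <= g.
  by rewrite leNgt; apply/negP => /gg[u [[? ?] ?]]; ord.
have gt : g <= t by apply: lbg; split.
have below u : a <= u -> u < g -> S u.
  move=> au ug; apply: contrapT => nSu; have : g <= u by apply: lbg; split=> //; split=> //; ord.
  by move=> ?; ord.
have Sg : S g.
  have [<-//|ga] := eqVneq a g; apply: Hl => //; last ord.
  by rewrite lt_neqAle ga.
have [gb|bg] := ltP g b; last first.
  by apply: nSt; rewrite (_ : t = g) //; apply/le_anti/andP; split=> //; ord.
have [e [ge He]] := Hr g ag gb Sg.
have [u [[au [ub nSu]] ue]] := gg e ge; apply: nSu.
by have [ug|gu|->] := ltgtP u g; [exact: below|exact: He|].
Qed.

Definition convex S := forall a b c, S a -> S c -> a <= b -> b <= c -> S b.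

(** Definable connectedness of convex sets: [itv_induction] carries the truth value of [S] from one
    point to the other. *)
Lemma loc_const_convex S I : dset S -> convex I ->
  (forall t, I t -> exists c e, [/\ c < t, t < e &
     forall u, c < u -> u < e -> I u -> (S u <-> S t)]) ->
  forall t u, I t -> I u -> S t -> S u.
Proof.
move=> dS cI loc.
have W t u : t <= u -> I t -> I u -> (S t <-> S u).
  move=> tu It Iu; pose P v := S t <-> S v.
  have Ib v : t <= v -> v <= u -> I v by apply: cI.
  have dP : dset P by rewrite /dset /P; dsolve.
  apply: (@itv_induction P t u) => //.
    move=> c tc cu Pc; have [|c' [e [c'c ce He]]] := loc c; first by apply: Ib => //; exact: ltW.
    have [f [cf fe fu]] := above_lt dlo ce cu.
    exists f; split=> // v cv vf; rewrite /P; apply: iff_trans Pc _; apply: iff_sym.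
    by apply: He; [ord|ord|apply: Ib; ord].
  move=> c tc cu Pc; have [|c' [e [c'c ce He]]] := loc c; first by apply: Ib => //; exact: ltW.
  have [v [vc c'v tv]] := below_gt dlo c'c tc.
  by apply: iff_trans (Pc v _ vc) _; [exact: ltW|apply: He; [ord|ord|apply: Ib; ord]].
by move=> t u It Iu; have [/W|/ltW/W] := leP t u; move=> /(_ It Iu) || move=> /(_ Iu It); case.
Qed.

Lemma seq_min (s : seq M) S t : (forall u, S u <-> u \in s) -> S t ->
  exists m, S m /\ forall u, S u -> m <= u.
Proof.
move=> E /E; suff: t \in s -> exists m, m \in s /\ forall u, u \in s -> m <= u.
  by move=> /[apply] -[m [/E Sm Hm]]; exists m; split=> // u /E; exact: Hm.
elim: s {E} t => // v s IH t _.
case: s IH => [_|w s /(_ w (mem_head _ _))[m [ms Hm]]].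
  by exists v; rewrite mem_head; split=> // u; rewrite inE => /eqP->.
have [vm|mv] := leP v m.
  exists v; rewrite mem_head; split=> // u; rewrite inE => /predU1P[->//|/Hm ?]; ord.
exists m; rewrite inE ms orbT; split=> // u; rewrite inE => /predU1P[->|/Hm //]; ord.
Qed.

Lemma seq_max (s : seq M) S t : (forall u, S u <-> u \in s) -> S t ->
  exists m, S m /\ forall u, S u -> u <= m.
Proof.
move=> E /E; suff: t \in s -> exists m, m \in s /\ forall u, u \in s -> u <= m.
  by move=> /[apply] -[m [/E Sm Hm]]; exists m; split=> // u /E; exact: Hm.
elim: s {E} t => // v s IH t _.
case: s IH => [_|w s /(_ w (mem_head _ _))[m [ms Hm]]].
  by exists v; rewrite mem_head; split=> // u; rewrite inE => /eqP->.
have [vm|mv] := leP m v.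
  exists v; rewrite mem_head; split=> // u; rewrite inE => /predU1P[->//|/Hm ?]; ord.
exists m; rewrite inE ms orbT; split=> // u; rewrite inE => /predU1P[->|/Hm //]; ord.
Qed.

(* If there is no such interval, then the sets [F c := {u in (x0, c) | Q u c}]
   are finite, and nonempty for [c] close to [x0].  Both [min (F c)] and
   [max (F c)] take all values close to [x0], and these two facts contradict
   each other. *)
Lemma diag_bound (Q : M -> M -> Prop) a b : drel2 Q -> a < b ->
  (forall x c c', x < c' -> c' <= c -> Q x c -> Q x c') ->
  (forall x, a < x -> x < b -> exists c, x < c /\ Q x c) ->
  exists c e, [/\ a <= c, c < e, e <= b & forall x, c < x -> x < e -> Q x e].
Proof.
move=> dQ ab mono Qex; apply: contrapT => none.
have neg e : a < e -> e < b -> exists e', e' < e /\ forall x, e' < x -> x < e -> ~ Q x e.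
  move=> ae eb; have [|e' [e'e [H|]]] := @dset_germ_left _ _ _ _ dlo omin (Q^~ e) e.
  - by rewrite /dset; dsolve.
  - have [c [ce ac e'c]] := below_gt dlo ae e'e.
    by case: none; exists c, e; split; rewrite ?(ltW ac) ?(ltW eb) // => x *; apply: H; ord.
  - by exists e'.
have [x0 [ax0 x0b]] := mid ab.
pose F c u := [/\ x0 < u, u < c & Q u c].
have dF : drel2 F by rewrite /drel2 /F; dsolve.
have [x1 [x01 x1b F0]] : exists x1, [/\ x0 < x1, x1 <= b & forall c, x0 < c -> c < x1 -> exists u, F c u].
  have [|x1 [x01 HF]] := @dset_germ _ _ _ _ dlo omin (fun c => exists u, F c u) x0.
    by rewrite /dset; dsolve.
  have [x2 [x02 x21 x2b]] := above_lt dlo x01 x0b.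
  exists x2; split=> //; first exact: ltW.
  move=> c x0c cx2; case: HF => [|HF]; first by apply; ord.
  have [c1 [xc1 Qc1]] := Qex c ltac:(ord) ltac:(ord).
  have [c2 [cc2 c21 c2x]] := above_lt dlo xc1 cx2.
  case: (HF c2); [ord|ord|exists c; split=> //].
  by apply: mono Qc1 => //; exact: ltW.
have Ffin c : x0 < c -> c < x1 -> exists s : seq M, forall u, F c u <-> u \in s.
  move=> x0c cx1; have [|[v [w [vw H]]]|//] := @dset_finite _ _ _ _ omin (F c).
    by rewrite /dset; dsolve.
  have [e [ve ew]] := mid vw; have [x0e ec Qe] := H e ve ew.
  have [e' [e'e He']] := neg e ltac:(ord) ltac:(ord).
  have [x [xe e'x vx]] := below_gt dlo e'e ve.
  case: (He' x) => //; have [_ _] := H x vx ltac:(ord).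
  by apply: mono => //; exact: ltW.
pose lo u := exists c, [/\ x0 < c, c < x1, F c u & forall v, F c v -> u <= v].
pose hi u := exists c, [/\ x0 < c, c < x1, F c u & forall v, F c v -> v <= u].
(* Members of [F c] lie between [x0] and [c], so a definable [P] that meets all [F c] cannot fail on
   an entire interval to the right of [x0]. *)
have all_values P : dset P -> (forall c, x0 < c -> c < x1 -> exists u, F c u /\ P u) ->
    exists e, x0 < e /\ forall u, x0 < u -> u < e -> P u.
  move=> dP HP; have [e [x0e [H|H]]] := @dset_germ _ _ _ _ dlo omin P x0 dP; first by exists e.
  have [c [x0c ce cx1]] := above_lt dlo x0e x01.
  by have [u [[? ? _] Pu]] := HP c x0c cx1; case: (H u) => //; ord.
have [e1 [x0e1 He1]] : exists e, x0 < e /\ forall u, x0 < u -> u < e -> lo u.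
  apply: all_values.
    by rewrite /dset /lo /hi; dsolve.
  move=> c x0c cx1; have [u Fu] := F0 c x0c cx1; have [s Es] := Ffin c x0c cx1.
  by have [m [Fm Hm]] := seq_min Es Fu; exists m; split=> //; exists c.
have [e2 [x0e2 He2]] : exists e, x0 < e /\ forall u, x0 < u -> u < e -> hi u.
  apply: all_values.
    by rewrite /dset /lo /hi; dsolve.
  move=> c x0c cx1; have [u Fu] := F0 c x0c cx1; have [s Es] := Ffin c x0c cx1.
  by have [m [Fm Hm]] := seq_max Es Fu; exists m; split=> //; exists c.
(* Take [u = max (F c)], then [x = min (F c')] with [u < x < c]. Thus [Q x c] and [Q u c'] fail
   while [Q u c] and [Q x c'] hold; monotonicity in the second argument refutes both [c' <= c] and
   [c < c']. *)
have [u [x0u ue1 ue2]] := above_lt dlo x0e1 x0e2.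
have [c [x0c cx1 [_ uc Quc] cmax]] := He2 u x0u ue2.
have [x [ux xe1 xc]] := above_lt dlo ue1 uc.
have nQxc : ~ Q x c by move=> Qxc; have : x <= u by [apply: cmax; split=> //; ord]; move=> ?; ord.
have [c' [_ _ [_ xc' Qxc'] cmin]] := He1 x ltac:(ord) xe1.
have nQuc' : ~ Q u c'.
  by move=> Quc'; have : x <= u by [apply: cmin; split=> //; ord]; move=> ?; ord.
have [cc'|c'c] := leP c' c.
  by apply: nQuc'; apply: mono Quc => //; ord.
by apply: nQxc; apply: mono Qxc' => //; exact: ltW.
Qed.

(** Turns a property of the germ to the right of each point into one of all pairs in a subinterval.
    With [h x < h y] for [R] this is the passage from local to uniform monotonicity. *)
Lemma diag_rel (R : M -> M -> Prop) a b : drel2 R -> a < b ->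
  (forall x, a < x -> x < b -> exists c, x < c /\ forall y, x < y -> y < c -> R x y) ->
  exists c e, [/\ a <= c, c < e, e <= b & forall x y, c < x -> x < y -> y < e -> R x y].
Proof.
move=> dR ab HR; pose Q x c := forall y, x < y -> y < c -> R x y.
have dQ : drel2 Q by rewrite /drel2 /Q; dsolve.
have [|//|c [e [ac ce eb H]]] := diag_bound dQ ab.
  by move=> x c c' xc' c'c Qxc y xy yc'; apply: Qxc => //; ord.
by exists c, e; split=> // x y cx xy ye; apply: H => //; ord.
Qed.

Definition cont_at (h : M -> M) t := forall y,
  (y < h t -> exists c e, [/\ c < t, t < e & forall u, c < u -> u < e -> y < h u]) /\
  (h t < y -> exists c e, [/\ c < t, t < e & forall u, c < u -> u < e -> h u < y]).

Definition incr_at (h : M -> M) t := exists c e, [/\ c < t, t < e &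
  forall u v, c < u -> u <= v -> v < e -> h u <= h v].

Definition decr_at (h : M -> M) t := exists c e, [/\ c < t, t < e &
  forall u v, c < u -> u <= v -> v < e -> h v <= h u].

(** An injective image is infinite, hence contains an interval. At a preimage of an inner point of
    it, all nearby values are attained, which together with monotonicity gives continuity. *)
Lemma incr_cont h a b : dfun1 h -> a < b ->
  (forall x y, a < x -> x < y -> y < b -> h x < h y) ->
  exists t, [/\ a < t, t < b, incr_at h t & cont_at h t].
Proof.
move=> dh ab inc.
have winc x y : a < x -> x <= y -> y < b -> h x <= h y.
  by move=> ax; rewrite le_eqVlt => /predU1P[->//|xy] yb; apply/ltW/inc.
have [|[r [s [rs H]]]|[s Hs]] :=
    @dset_finite _ _ _ _ omin (fun y => exists t, a < t /\ t < b /\ h t = y).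
- by rewrite /dset; dsolve.
- have [y [ry ys]] := mid rs; have [t [at_ [tb ht]]] := H y ry ys.
  exists t; split=> //; first by exists a, b; split.
  move=> z; rewrite ht; split=> [zy|yz].
    have [w [wy zw rw]] := below_gt dlo zy ry.
    have [u [au [ub hu]]] := H w rw ltac:(ord).
    have ut : u < t by rewrite ltNge; apply/negP => tu; have := winc t u at_ tu ub; move=> ?; subst; ord.
    by exists u, b; split=> // v uv vb; have := inc u v au uv vb; move=> ?; subst; ord.
  have [w [yw wz ws]] := above_lt dlo yz ys.
  have [u [au [ub hu]]] := H w ltac:(ord) ws.
  have ut : t < u by rewrite ltNge; apply/negP => tu; have := winc u t au tu tb; move=> ?; subst; ord.
  by exists a, u; split=> // v av vu; have := inc v u av vu ub; move=> ?; subst; ord.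
- have [t [at_ tb]] := mid ab.
  have [|m [[u [au [ub hu]]] Hm]] := seq_max Hs (t := h t); first by exists t.
  have [v [uv vb]] := mid ub; have := inc u v au uv vb.
  have : h v <= m by apply: Hm; exists v; split=> //; ord.
  by move=> ? ?; subst; ord.
Qed.

Lemma decr_cont h a b : dfun1 h -> a < b ->
  (forall x y, a < x -> x < y -> y < b -> h y < h x) ->
  exists t, [/\ a < t, t < b, decr_at h t & cont_at h t].
Proof.
move=> dh ab dec.
have wdec x y : a < x -> x <= y -> y < b -> h y <= h x.
  by move=> ax; rewrite le_eqVlt => /predU1P[->//|xy] yb; apply/ltW/dec.
have [|[r [s [rs H]]]|[s Hs]] :=
    @dset_finite _ _ _ _ omin (fun y => exists t, a < t /\ t < b /\ h t = y).
- by rewrite /dset; dsolve.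
- have [y [ry ys]] := mid rs; have [t [at_ [tb ht]]] := H y ry ys.
  exists t; split=> //; first by exists a, b; split.
  move=> z; rewrite ht; split=> [zy|yz].
    have [w [wy zw rw]] := below_gt dlo zy ry.
    have [u [au [ub hu]]] := H w rw ltac:(ord).
    have ut : t < u by rewrite ltNge; apply/negP => tu; have := wdec u t au tu tb; move=> ?; subst; ord.
    by exists a, u; split=> // v av vu; have := dec v u av vu ub; move=> ?; subst; ord.
  have [w [yw wz ws]] := above_lt dlo yz ys.
  have [u [au [ub hu]]] := H w ltac:(ord) ws.
  have ut : u < t by rewrite ltNge; apply/negP => tu; have := wdec t u at_ tu ub; move=> ?; subst; ord.
  by exists u, b; split=> // v uv vb; have := dec u v au uv vb; move=> ?; subst; ord.
- have [t [at_ tb]] := mid ab.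
  have [|m [[u [au [ub hu]]] Hm]] := seq_min Hs (t := h t); first by exists t.
  have [v [uv vb]] := mid ub; have := dec u v au uv vb.
  have : m <= h v by apply: Hm; exists v; split=> //; ord.
  by move=> ? ?; subst; ord.
Qed.

(** To the right of each [x] the values are eventually all above, all below or all equal to [h x].
    If neither strict alternative holds uniformly on a subinterval, then by [diag_rel] both fail at
    every point just after [a], and [h] is constant on a subinterval. One good point per interval
    suffices: [cell_monotone] uses it to refute a cell that has none. *)
Lemma monotone_point h a b : dfun1 h -> a < b ->
  exists t, [/\ a < t, t < b, incr_at h t \/ decr_at h t & cont_at h t].
Proof.
move=> dh ab.
have germ3 x : exists c, x < c /\ [\/ forall y, x < y -> y < c -> h x < h y,
    forall y, x < y -> y < c -> h y < h x | forall y, x < y -> y < c -> h y = h x].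
  have [|c1 [xc1 [H|H1]]] := @dset_germ _ _ _ _ dlo omin (fun y => h x < h y) x.
  - by rewrite /dset; dsolve.
  - by exists c1; split=> //; apply: Or31.
  have [|c2 [xc2 [H|H2]]] := @dset_germ _ _ _ _ dlo omin (fun y => h y < h x) x.
  - by rewrite /dset; dsolve.
  - by exists c2; split=> //; apply: Or32.
  have [c [xc cc1 cc2]] := above_lt dlo xc1 xc2.
  exists c; split=> //; apply: Or33 => y xy yc.
  by have [/H2|/H1|//] := ltgtP (h y) (h x); case; ord.
have step (R : M -> M -> Prop) a' b' : drel2 R -> a <= a' -> a' < b' -> b' <= b ->
    (forall x, a' < x -> x < b' -> exists c, x < c /\ forall y, x < y -> y < c -> R x y) ->
    exists c e, [/\ a <= c, c < e, e <= b & forall x y, c < x -> x < y -> y < e -> R x y].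
  move=> dR aa a'b' bb HR; have [c [e [ac ce eb H]]] := diag_rel dR a'b' HR.
  by exists c, e; split=> //; ord.
have [[c [e [ac ce eb H]]]|none1] := pselect (exists c e,
    [/\ a <= c, c < e, e <= b & forall x y, c < x -> x < y -> y < e -> h x < h y]).
  by have [t [ct te it ht]] := incr_cont dh ce H; exists t; split=> //; [ord|ord|left].
have [[c [e [ac ce eb H]]]|none2] := pselect (exists c e,
    [/\ a <= c, c < e, e <= b & forall x y, c < x -> x < y -> y < e -> h y < h x]).
  by have [t [ct te it ht]] := decr_cont dh ce H; exists t; split=> //; [ord|ord|right].
have [|c1 [ac1 [H|H1]]] := @dset_germ _ _ _ _ dlo omin
    (fun x => exists c, x < c /\ forall y, x < y -> y < c -> h x < h y) a.
- by rewrite /dset; dsolve.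
- have [b' [ab' b'c1 b'b]] := above_lt dlo ac1 ab.
  case: none1; apply: (step _ a b') => //; first by rewrite /drel2; dsolve.
    exact: ltW.
  by move=> x ax xb; apply: H => //; ord.
have [|c2 [ac2 [H|H2]]] := @dset_germ _ _ _ _ dlo omin
    (fun x => exists c, x < c /\ forall y, x < y -> y < c -> h y < h x) a.
- by rewrite /dset; dsolve.
- have [b' [ab' b'c1 b'b]] := above_lt dlo ac2 ab.
  case: none2; apply: (step (fun x y => h y < h x) a b') => //; first by rewrite /drel2; dsolve.
    exact: ltW.
  by move=> x ax xb; apply: H => //; ord.
have [c [ac cc1 cc2]] := above_lt dlo ac1 ac2.
have [b' [ab' b'c b'b]] := above_lt dlo ac ab.
have [||||x ax xb'|c' [e [ac' ce eb H]]] := step (fun x y => h y = h x) a b' => //.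
- by rewrite /drel2; dsolve.
- exact: ltW.
- have [y [xy [H|H|H]]] := germ3 x; last by exists y.
    by case: (H1 x) => //; [ord|exists y].
  by case: (H2 x) => //; [ord|exists y].
have [t [ct te]] := mid ce; exists t; split; [ord|ord|left|].
  exists c', e; split=> // u v cu; rewrite le_eqVlt => /predU1P[->//|uv ve].
  by rewrite (H u v).
have eq u : c' < u -> u < e -> h u = h t.
  by move=> cu ue; have [ut|tu|->//] := ltgtP u t; [rewrite (H u t)|rewrite (H t u)].
by move=> y; split=> hy; exists c', e; split=> // u cu ue; rewrite eq.
Qed.

Lemma incr_convex h I : dfun1 h -> convex I -> (forall t, I t -> incr_at h t) ->
  forall t u, I t -> I u -> t <= u -> h t <= h u.
Proof.
move=> dh cI inc t u It Iu tu.
have Ib v : t <= v -> v <= u -> I v by apply: cI.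
apply: (@itv_induction (fun v => h t <= h v) t u) => //; first by rewrite /dset; dsolve.
  move=> c tc cu htc; have [|c' [e [c'c ce He]]] := inc c; first by apply: Ib => //; exact: ltW.
  exists e; split=> // v cv ve; have := He c v c'c (ltW cv) ve; move=> ?; ord.
move=> c tc cu Hc; have [|c' [e [c'c ce He]]] := inc c; first by apply: Ib => //; exact: ltW.
have [v [vc c'v tv]] := below_gt dlo c'c tc.
have := He v c c'v (ltW vc) ce; have := Hc v (ltW tv) vc; move=> ? ?; ord.
Qed.

Lemma decr_convex h I : dfun1 h -> convex I -> (forall t, I t -> decr_at h t) ->
  forall t u, I t -> I u -> t <= u -> h u <= h t.
Proof.
move=> dh cI dec t u It Iu tu.
have Ib v : t <= v -> v <= u -> I v by apply: cI.
apply: (@itv_induction (fun v => h v <= h t) t u) => //; first by rewrite /dset; dsolve.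
  move=> c tc cu htc; have [|c' [e [c'c ce He]]] := dec c; first by apply: Ib => //; exact: ltW.
  exists e; split=> // v cv ve; have := He c v c'c (ltW cv) ve; move=> ?; ord.
move=> c tc cu Hc; have [|c' [e [c'c ce He]]] := dec c; first by apply: Ib => //; exact: ltW.
have [v [vc c'v tv]] := below_gt dlo c'c tc.
have := He v c c'v (ltW vc) ce; have := Hc v (ltW tv) vc; move=> ? ?; ord.
Qed.

End Monotonicity.

(** * Boxes and cells *)

Section Boxes.
Variables (d : Order.disp_t) (M : orderTopologicalType d) (dlo : dense_without_endpoints M).

Lemma col'_snoc n (w : 'rV[M]_n) t : col' ord_max (snoc w t) = w.
Proof. by apply/rowP => i; rewrite !mxE liftK. Qed.

Lemma snoc_max n (w : 'rV[M]_n) t : snoc w t ord0 ord_max = t.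
Proof. by rewrite mxE unlift_none. Qed.

Lemma snoc_lift n (w : 'rV[M]_n) t i : snoc w t ord0 (lift ord_max i) = w ord0 i.
Proof. by rewrite mxE liftK. Qed.

Lemma snocP n (x : 'rV[M]_n.+1) : exists w t, x = snoc w t.
Proof.
exists (col' ord_max x), (x ord0 ord_max); apply/rowP => i.
by rewrite !mxE; case: unliftP => [j|] ->; rewrite ?mxE.
Qed.

Lemma near_self n (x : 'rV[M]_n) P : near x P -> P x.
Proof. by move=> [a [b [abx]]]; apply. Qed.

Lemma near_mono n (x : 'rV[M]_n) P Q : (forall y, P y -> Q y) -> near x P -> near x Q.
Proof. by move=> PQ [a [b [abx H]]]; exists a, b; split=> // y /H /PQ. Qed.

Lemma near_and n (x : 'rV[M]_n) P Q : near x P -> near x Q -> near x (fun y => P y /\ Q y).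
Proof.
move=> [a [b [abx H]]] [a' [b' [abx' H']]].
exists (\row_i Order.max (a ord0 i) (a' ord0 i))%R, (\row_i Order.min (b ord0 i) (b' ord0 i))%R.
split=> [i|y Hy].
  by rewrite !mxE gt_max lt_min; have [-> ->] := abx i; have [-> ->] := abx' i.
split; [apply: H => i|apply: H' => i]; have := Hy i; rewrite !mxE gt_max lt_min;
  by move=> [/andP[? ?] /andP[? ?]].
Qed.

Lemma near_all n (x : 'rV[M]_n) P : (forall y, P y) -> near x P.
Proof.
move=> HP; have [a Ha] := choice (fun i => dlo_no_min dlo (x ord0 i)).
have [b Hb] := choice (fun i => dlo_no_max dlo (x ord0 i)).
by exists (\row_i a i)%R, (\row_i b i)%R; split=> // i; rewrite !mxE.
Qed.

Lemma near_snoc n (w : 'rV[M]_n) t c e P : near w P -> c < t -> t < e ->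
  near (snoc w t) (fun y => [/\ P (col' ord_max y), c < y ord0 ord_max & y ord0 ord_max < e]).
Proof.
move=> [a [b [abw H]]] ct te; exists (snoc a c), (snoc b e); split=> [i|y Hy].
  by case: (unliftP ord_max i) => [j|] ->; rewrite ?snoc_lift ?snoc_max.
have := Hy ord_max; rewrite !snoc_max => -[? ?]; split=> //; apply: H => i.
by have := Hy (lift ord_max i); rewrite !snoc_lift mxE.
Qed.

Lemma near_snocE n (w : 'rV[M]_n) t P : near (snoc w t) P ->
  exists c e, [/\ c < t, t < e & near w (fun w' => forall t', c < t' -> t' < e -> P (snoc w' t'))].
Proof.
move=> [a [b [abx H]]]; exists (a ord0 ord_max), (b ord0 ord_max).
have := abx ord_max; rewrite snoc_max => -[? ?]; split=> //.
exists (col' ord_max a), (col' ord_max b); split=> [i|y Hy t' ? ?].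
  by have := abx (lift ord_max i); rewrite snoc_lift !mxE.
apply: H => i; case: (unliftP ord_max i) => [j|] ->; rewrite ?snoc_lift ?snoc_max //.
by have := Hy j; rewrite !mxE.
Qed.

Lemma contin_sub n (C D : set 'rV[M]_n) f : C `<=` D -> contin D f -> contin C f.
Proof.
move=> CD cf x /CD Dx c; have [H1 H2] := cf x Dx c.
by split=> [/H1|/H2]; apply: near_mono => y H /CD.
Qed.

Lemma near_nbhs n (x : 'rV[M]_n) P : near x P -> nbhs x P.
Proof.
move=> [a [b [abx H]]]; exists (fun _ i => [set` `]a ord0 i, b ord0 i[%O]) => [i j|y Hy].
  rewrite (ord1 i) itv_nbhsE; exists (`]a ord0 j, b ord0 j[)%O => //; split=> //=.
  by rewrite in_itv /=; apply/andP; apply: abx.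
by apply: H => i; have := Hy ord0 i; rewrite /= in_itv /= => /andP.
Qed.

(** Links the first-order notion of continuity, used throughout, to the topological one in the
    definition of cells. *)
Lemma contin_continuous n (D : set 'rV[M]_n) f : contin D f -> {within D, continuous f}.
Proof.
move=> cf; apply/subspace_continuousP => x Dx U.
rewrite itv_nbhsE => -[i [iopen fxi] iU].
suff: near x (fun y => D y -> f y \in i).
  by move=> /near_nbhs; apply: filterS => y H Dy; apply: iU; exact: H.
move: i iopen fxi {iU} => [l r] iopen.
rewrite itv_boundlr => /andP[lx xr].
have N1 : near x (fun y => D y -> (l <= BLeft (f y))%O).
  case: l lx iopen => [b l|b] lx iopen; last first.
    by move: lx; rewrite (itv_open_ends_linfty iopen) => _; apply: near_all.
  move: lx; rewrite (itv_open_ends_lside iopen) => lx.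
  by have [H _] := cf x Dx l; apply: near_mono (H lx) => y; exact.
have N2 : near x (fun y => D y -> (BRight (f y) <= r)%O).
  case: r xr iopen => [b r|b] xr iopen; last first.
    by move: xr; rewrite (itv_open_ends_rinfty iopen) => _; apply: near_all.
  move: xr; rewrite (itv_open_ends_rside iopen) => xr.
  by have [_ H] := cf x Dx r; apply: near_mono (H xr) => y; exact.
apply: near_mono (near_and N1 N2) => y [H1 H2] Dy.
by rewrite itv_boundlr H1 ?H2.
Qed.

End Boxes.

(** * Topology of cells with signature *)

Section Cells.
Variables (d : Order.disp_t) (M : orderTopologicalType d) (L : signature).
Variables (str : expansion M L) (dlo : dense_without_endpoints M) (omin : o_minimal str).
Local Notation dmap := (dmap str).
Local Notation definable := (definable str).

Definition lo n (l : option ('rV[M]_n -> M)) w t : Prop := if l is Some f then f w < t else True.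
Definition hi n (u : option ('rV[M]_n -> M)) w t : Prop := if u is Some f then t < f w else True.

Definition cbound n (D : set 'rV[M]_n) l :=
  if l is Some f then dmap f /\ contin D f else True.

Lemma graph_snoc n (D : set 'rV[M]_n) f w t : graph D f (snoc w t) <-> D w /\ t = f w.
Proof. by rewrite /graph /= col'_snoc snoc_max. Qed.

Lemma band_snoc n (D : set 'rV[M]_n) l u w t :
  band D l u (snoc w t) <-> [/\ D w, lo l w t & hi u w t].
Proof. by rewrite /band /= col'_snoc snoc_max. Qed.

(* Cells with their signature, in which [true] stands for a band and [false]
   for a graph; the last coordinate comes first. *)
Fixpoint scell n (s : seq bool) : set 'rV[M]_n -> Prop :=
  match n with
  | 0 => fun C => s = [::] /\ C = setT
  | n'.+1 => fun C => exists b s' (D : set 'rV[M]_n'), [/\ s = b :: s', scell s' D &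
      if b then exists l u, [/\ cbound D l, cbound D u,
        forall w, D w -> exists t, lo l w t /\ hi u w t & C = band D l u]
      else exists f, [/\ dmap f, contin D f & C = graph D f]]
  end.

Variable x0 : M.

Lemma definable_graph n (D : set 'rV[M]_n) f : definable D -> dmap f -> definable (graph D f).
Proof. by move=> dD df; apply/(definableP _ x0); rewrite /graph /=; dsolve. Qed.

Lemma definable_band n (D : set 'rV[M]_n) l u : definable D ->
  cbound D l -> cbound D u -> definable (band D l u).
Proof.
move=> dD; case: l => [l [dl _]|_]; case: u => [u [du _]|_];
  by apply/(definableP _ x0); rewrite /band /=; dsolve.
Qed.

Lemma scell_definable n s (C : set 'rV[M]_n) : scell s C -> definable C.
Proof.
elim: n s C => [|n IH] s C; first by move=> [_ ->]; apply/(definableP _ x0); apply: dpred_const.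
move=> [b [s' [D [_ /IH dD]]]]; case: b => [[l [u [? ? _ ->]]]|[f [? _ ->]]].
  exact: definable_band.
exact: definable_graph.
Qed.

Lemma scell_nonempty n s (C : set 'rV[M]_n) : scell s C -> exists x, C x.
Proof.
elim: n s C => [|n IH] s C; first by move=> [_ ->]; exists (\row_i x0)%R.
move=> [b [s' [D [_ /IH[w Dw]]]]]; case: b => [[l [u [? ? H ->]]]|[f [? _ ->]]].
  by have [t [? ?]] := H w Dw; exists (snoc w t); apply/band_snoc.
by exists (snoc w (f w)); apply/graph_snoc.
Qed.

Lemma near_lo n (D : set 'rV[M]_n) l w t : cbound D l -> D w -> lo l w t ->
  exists c, c < t /\ near w (fun w' => D w' -> forall t', c < t' -> lo l w' t').
Proof.
case: l => [l [_ cl] Dw /= lt|_ _ _].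
  have [c [lc ct]] := dlo_dense dlo lt; exists c; split=> //.
  have [_ /(_ lc)] := cl w Dw c; apply: near_mono => w' H Dw' t' ct'.
  by have := H Dw' => ?; ord.
by have [c ct] := dlo_no_min dlo t; exists c; split=> //; apply: near_all.
Qed.

Lemma near_hi n (D : set 'rV[M]_n) u w t : cbound D u -> D w -> hi u w t ->
  exists c, t < c /\ near w (fun w' => D w' -> forall t', t' < c -> hi u w' t').
Proof.
case: u => [u [_ cu] Dw /= ut|_ _ _].
  have [c [tc cu']] := dlo_dense dlo ut; exists c; split=> //.
  have [/(_ cu') + _] := cu w Dw c; apply: near_mono => w' H Dw' t' ct'.
  by have := H Dw' => ?; ord.
by have [c ct] := dlo_no_max dlo t; exists c; split=> //; apply: near_all.
Qed.

Lemma near_lohi n (D : set 'rV[M]_n) l u w t : cbound D l -> cbound D u -> D w ->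
  lo l w t -> hi u w t ->
  near w (fun w' => D w' -> lo l w' t /\ hi u w' t).
Proof.
move=> bl bu Dw lt ut; have [c [ct Nc]] := near_lo bl Dw lt.
have [e [te Ne]] := near_hi bu Dw ut.
by apply: near_mono (near_and Nc Ne) => w' [H1 H2] Dw'; split; [apply: H1|apply: H2].
Qed.

Lemma convex_lohi n (l u : option ('rV[M]_n -> M)) w :
  convex (fun t => lo l w t /\ hi u w t).
Proof.
move=> a b c [la _] [_ uc] ab bc; split.
  by case: l la => //= l ?; ord.
by case: u uc => //= u ?; ord.
Qed.

(** By induction the smaller base is relatively open. For bands the strict bounds persist nearby by
    continuity; for graphs the two functions agree on the smaller base. A graph inside a band would
    not be relatively open, hence the common signature. *)
Lemma scell_open n s (C1 C : set 'rV[M]_n) x : scell s C1 -> scell s C -> C1 `<=` C ->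
  C1 x -> near x (fun y => C y -> C1 y).
Proof.
elim: n s C1 C x => [|n IH] s C1 C x.
  by move=> [_ ->] _ _ _; apply: near_all.
move=> [b [s' [D1 [-> sD1 H1]]]] [_ [_ [D [[<- <-] sD H]]]].
have [w [t ->]] := snocP x; move=> C1C C1x.
case: b H1 H => [[l1 [u1 [bl1 bu1 ne1 EC1]]] [l [u [bl bu ne EC]]]|[f1 [df1 cf1 EC1]] [f [df cf EC]]].
  have D1D : D1 `<=` D.
    move=> w' D1w'; have [t' [? ?]] := ne1 w' D1w'.
    have : C1 (snoc w' t') by rewrite EC1; apply/band_snoc.
    by move=> /C1C; rewrite EC => /band_snoc[].
  move: C1x; rewrite EC1 => /band_snoc[D1w lt ut].
  have [c [ct Nc]] := near_lo bl1 D1w lt; have [e [te Ne]] := near_hi bu1 D1w ut.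
  have := near_snoc (near_and (near_and Nc Ne) (IH _ _ _ _ sD1 sD D1D D1w)) ct te.
  apply: near_mono => y; have [w' [t' ->]] := snocP y.
  rewrite col'_snoc snoc_max => -[[[Hl Hu] HD] ct' te'].
  rewrite EC => /band_snoc[/HD D1w' _ _]; apply/band_snoc; split=> //; [exact: Hl|exact: Hu].
have D1D w' : D1 w' -> D w' /\ f1 w' = f w'.
  move=> D1w'; have : C1 (snoc w' (f1 w')) by rewrite EC1; apply/graph_snoc.
  by move=> /C1C; rewrite EC => /graph_snoc[].
move: C1x; rewrite EC1 => /graph_snoc[D1w _].
have [c ct] := dlo_no_min dlo t; have [e te] := dlo_no_max dlo t.
have D1D' : D1 `<=` D by move=> w' /D1D[].
have := near_snoc (IH _ _ _ _ sD1 sD D1D' D1w) ct te.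
apply: near_mono => y; have [w' [t' ->]] := snocP y.
rewrite col'_snoc snoc_max => -[HD ct' te'].
rewrite EC => /graph_snoc[/HD D1w' ->]; apply/graph_snoc; split=> //.
by have [] := D1D w' D1w'.
Qed.

(** A locally constant property is constant on the fibres of a band, which are convex, and so
    descends to the base. *)
Lemma scell_connected n s (C P : set 'rV[M]_n) : scell s C -> definable P ->
  (forall x, C x -> near x (fun y => C y -> (P y <-> P x))) ->
  forall x y, C x -> C y -> P x -> P y.
Proof.
elim: n s C P => [|n IH] s C P.
  by move=> _ _ _ x y _ _; rewrite (_ : x = y) //; apply/rowP => -[].
move=> [b [s' [D [_ sD H]]]] dP loc x y.
have dD := scell_definable sD.
have [w [t ->]] := snocP x; have [w' [t' ->]] := snocP y.
case: b H => [[l [u [bl bu ne EC]]]|[f [df cf EC]]]; last first.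
  rewrite !EC => /graph_snoc[Dw ->] /graph_snoc[Dw' ->].
  pose Q w := P (snoc w (f w)).
  have dQ : definable Q by apply/(definableP _ x0); rewrite /Q; dsolve.
  apply: (IH s' D Q) => // v Dv.
  have /near_snocE[c [e [cf' fe]]] : near (snoc v (f v)) (fun y => C y -> (P y <-> P (snoc v (f v)))).
    by apply: loc; rewrite EC; apply/graph_snoc.
  have [/(_ cf') N1 _] := cf v Dv c; have [_ /(_ fe) N2] := cf v Dv e.
  move=> N3; apply: near_mono (near_and (near_and N1 N2) N3) => v' [[H1 H2] H3] Dv'.
  apply: H3; [exact: H1|exact: H2|].
  by rewrite EC; apply/graph_snoc.
pose I v t := lo l v t /\ hi u v t.
have inC v a : D v -> I v a -> C (snoc v a) by move=> Dv [? ?]; rewrite EC; apply/band_snoc.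
have fib v a a' : D v -> I v a -> I v a' -> P (snoc v a) -> P (snoc v a').
  move=> Dv; apply: (@loc_const_convex _ _ _ str dlo omin (fun a => P (snoc v a)) (I v)).
  - by rewrite /dset; dsolve.
  - exact: convex_lohi.
  move=> a1 Ia1; have /near_snocE[c [e [ca ae /near_self N]]] := loc _ (inC v a1 Dv Ia1).
  by exists c, e; split=> // b cb be Ib; apply: N => //; exact: inC.
(* By [fib] the choice of [a] in the fibre is immaterial. Keeping [a] fixed while the base point
   moves shows that [Q] is locally constant. *)
pose Q v := exists a, I v a /\ P (snoc v a).
have dQ : definable Q.
  apply/(definableP _ x0); rewrite /Q /I.
  case: l bl {EC ne I inC fib Q} => [l [dl _]|_]; case: u bu => [u [du _]|_] /=; dsolve.
rewrite !EC => /band_snoc[Dw lt ut] /band_snoc[Dw' lt' ut'] Pwt.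
have : Q w' .
  apply: (IH s' D Q sD dQ _ w) => //; last by exists t.
  move=> v Dv; have [a Ia] := ne v Dv; have [la ua] := Ia.
  have /near_snocE[c [e [ca ae N]]] := loc _ (inC v a Dv Ia).
  apply: near_mono (near_and N (near_lohi bl bu Dv la ua)) => v' [H1 H2] Dv'.
  have Ia' : I v' a := H2 Dv'.
  have E := H1 a ca ae (inC v' a Dv' Ia').
  split=> -[a' [Ia1 Pa1]]; exists a; split=> //.
    by apply/E; apply: fib Pa1.
  by apply/E; apply: fib Pa1.
by move=> [a [Ia Pa]]; apply: fib Pa.
Qed.

End Cells.

(** * Ultrafilters *)

Section Ultrafilters.
Variable X : Type.
Implicit Types (U : set (set X)) (A B : set X).

Lemma ultra_mono U A B : UltraFilter U -> (forall x, A x -> B x) -> U A -> U B.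
Proof. by move=> FU AB; apply: filterS. Qed.

Lemma ultra_and U A B : UltraFilter U -> U A -> U B -> U (fun x => A x /\ B x).
Proof. by move=> FU; apply: filterI. Qed.

Lemma ultra_T U : UltraFilter U -> U setT.
Proof. by move=> FU; apply: filterT. Qed.

Lemma ultra_ex U A : UltraFilter U -> U A -> exists x, A x.
Proof. by move=> FU UA; have [x] := filter_ex UA; exists x. Qed.

Lemma ultra_not U A : UltraFilter U -> U (fun x => ~ A x) <-> ~ U A.
Proof.
move=> FU; split=> [UN UA|]; first by have [x []] := ultra_ex FU (ultra_and FU UA UN).
by have [//|] := in_ultra_setVsetC A FU.
Qed.

Lemma ultra_or U A B : UltraFilter U -> U (fun x => A x \/ B x) -> U A \/ U B.
Proof.
move=> FU UAB; apply: contrapT => /not_orP[/(ultra_not A FU) nA /(ultra_not B FU) nB].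
by have [x [[? ?] []]] := ultra_ex FU (ultra_and FU (ultra_and FU nA nB) UAB).
Qed.

Lemma ultra_base (I : Type) (D : I -> set X) : inhabited I -> (forall i, exists x, D i x) ->
  (forall i j, exists k, forall x, D k x -> D i x /\ D j x) ->
  exists U, UltraFilter U /\ forall i, U (D i).
Proof.
move=> [i0] ne dir.
have FF : ProperFilter (filter_from setT D).
  apply: filter_from_proper => [|i _]; last exact: ne.
  by apply: filter_from_filter => [|i j _ _]; [exists i0|have [k] := dir i j; exists k].
have [U [FU sU]] := ultraFilterLemma FF.
by exists U; split=> // i; apply: sU; exists i.
Qed.

Lemma ultra_push Y U (f : X -> Y) : UltraFilter U -> UltraFilter (fun A : set Y => U (fun x => A (f x))).
Proof.
move=> FU; split.
  split; first by move=> /(ultra_ex FU)[].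
  split; first by apply: (ultra_mono FU _ (filterT : U setT)).
    by move=> A B UA UB; apply: ultra_and.
  by move=> A B AB; apply: ultra_mono => x; apply: AB.
move=> G FG sG; apply/seteqP; split=> // A GA /=; apply: contrapT => /(ultra_not _ FU) nA.
have : G (A `&` ~` A) by apply: filterI => //; apply: sG.
by rewrite setICr => /filter_ex[].
Qed.

End Ultrafilters.

(** * Signatures and generic ultrafilters *)

Section Signatures.
Variables (d : Order.disp_t) (M : orderTopologicalType d) (L : signature).
Variables (str : expansion M L) (dlo : dense_without_endpoints M) (omin : o_minimal str).
Variable x0 : M.
Local Notation dmap := (dmap str).
Local Notation drel := (drel str).
Local Notation dset := (dset str).
Local Notation dpred := (dpred str).
Local Notation definable := (definable str).
Local Notation scell := (scell str).

Definition proj n (U : set (set 'rV[M]_n.+1)) : set (set 'rV[M]_n) :=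
  fun A => U (fun x => A (col' ord_max x)).

Fixpoint usig n (s : seq bool) : set (set 'rV[M]_n) -> Prop :=
  match n with
  | 0 => fun U => s = [::]
  | n'.+1 => fun U => exists b s', [/\ s = b :: s', usig s' (proj U) &
      if b then forall f, dmap f -> ~ U (graph setT f)
      else exists f, dmap f /\ U (graph setT f)]
  end.

Lemma usig_ex n (U : set (set 'rV[M]_n)) : exists s, usig s U.
Proof.
elim: n U => [|n IH] U; first by exists [::].
have [s Hs] := IH (proj U).
have [H|H] := pselect (exists f, dmap f /\ U (graph setT f)).
  by exists (false :: s), false, s.
by exists (true :: s), true, s; split=> // f df Uf; apply: H; exists f.
Qed.

Lemma ultra_proj n (U : set (set 'rV[M]_n.+1)) : UltraFilter U -> UltraFilter (proj U).
Proof. exact: ultra_push. Qed.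

Lemma itv_avoid (q : seq M) c e : c < e -> exists t, [/\ c < t, t < e & t \notin q].
Proof.
elim: q c e => [|v q IH] c e ce; first by have [t [? ?]] := dlo_dense dlo ce; exists t.
have [cv|vc] := ltP c v; last first.
  by have [t [ct te tq]] := IH c e ce; exists t; split=> //; rewrite inE negb_or tq andbT gt_eqF //; ord.
have [f [cf fv fe]] := above_lt dlo cv ce; have [t [ct tf tq]] := IH c f cf.
by exists t; split=> //; [ord|rewrite inE negb_or tq andbT lt_eqF //; ord].
Qed.

(** Supplies ultrafilters that are generic in a given cell and concentrated near a given point, to
    which cell decomposition in a lower dimension can then be applied. A graph coordinate is pushed
    forward along its function; a band coordinate has to avoid every definable graph. *)
Lemma gen_ultra n s (C : set 'rV[M]_n) x P : scell s C -> C x -> near x P ->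
  exists U, [/\ UltraFilter U, usig s U, U C & U P].
Proof.
elim: n s C x P => [|n IH] s C x P.
  move=> [-> ->] _ /near_self Px.
  have [||U [FU /(_ tt) Ux]] := @ultra_base _ unit (fun=> [set x]) (inhabits tt).
  - by move=> _; exists x.
  - by move=> _ _; exists tt.
  exists U; split=> //; first by apply: (ultra_mono FU _ Ux).
  by apply: (ultra_mono FU _ Ux) => y ->.
move=> [b [s' [D [-> sD H]]]]; have [w [t ->]] := snocP x.
case: b H => [[l [u [bl bu ne ->]]]|[f [df cf ->]]]; last first.
  move=> /graph_snoc[Dw ->] /near_snocE[c [e [cfw fwe N]]].
  have [/(_ cfw) N1 _] := cf w Dw c; have [_ /(_ fwe) N2] := cf w Dw e.
  have [V [FV sV VD VN]] := IH _ _ _ _ sD Dw (near_and (near_and N1 N2) N).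
  exists (fun A => V (fun w => A (snoc w (f w)))); split.
  - exact: ultra_push.
  - exists false, s'; split=> //; last first.
      exists f; split=> //; apply: (ultra_mono FV _ VD) => w' _.
      exact/graph_snoc.
    suff -> : proj (fun A => V (fun w => A (snoc w (f w)))) = V by [].
    apply/funext => A; rewrite /proj; congr (V _); apply/funext => v.
    by rewrite col'_snoc.
  - by apply: (ultra_mono FV _ VD) => v Dv; apply/graph_snoc.
  - apply: (ultra_mono FV _ (ultra_and FV VD VN)) => v [Dv [[H1 H2] H3]].
    by apply: H3; [apply: H1|apply: H2].
move=> /band_snoc[Dw lt ut] /near_snocE[c1 [e1 [c1t te1 N]]].
have [c2 [c2t N1]] := near_lo dlo bl Dw lt; have [e2 [te2 N2]] := near_hi dlo bu Dw ut.
have [c [ct c1c c2c]] := below_gt dlo c1t c2t.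
have [e [te ee1 ee2]] := above_lt dlo te1 te2.
have [V [FV sV VD VN]] := IH _ _ _ _ sD Dw (near_and (near_and N1 N2) N).
(* A basic set lies over a member of [V], between [c] and [e], with a relation [Y] with finite
   fibres removed. Such relations are closed under union and include all graphs, and density leaves
   points outside them. *)
pose I := ({A : set 'rV[M]_n | V A} *
  {Y : 'rV[M]_n -> M -> Prop | forall w, exists q : seq M, forall t, Y w t -> t \in q})%type.
pose E (i : I) : set 'rV[M]_n.+1 := fun x => [/\ sval i.1 (col' ord_max x),
  c < x ord0 ord_max, x ord0 ord_max < e & ~ sval i.2 (col' ord_max x) (x ord0 ord_max)].
have noY (v : 'rV[M]_n) : exists q : seq M, forall t, False -> t \in q by exists [::].
have [|||U [FU UE]] := @ultra_base _ I E.
- by split; split; [exists D|exists (fun _ _ => False)].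
- move=> [[A VA] [Y fY]]; have [v Av] := ultra_ex FV VA; have [q Hq] := fY v.
  have [a [ca ae aq]] := itv_avoid q (lt_trans ct te).
  exists (snoc v a); rewrite /E /= col'_snoc snoc_max; split=> // /Hq.
  exact/negP.
- move=> [[A VA] [Y fY]] [[A' VA'] [Y' fY']].
  have fYY w' : exists q : seq M, forall t, Y w' t \/ Y' w' t -> t \in q.
    have [q Hq] := fY w'; have [q' Hq'] := fY' w'; exists (q ++ q') => a.
    by rewrite mem_cat => -[/Hq|/Hq'] ->; rewrite ?orbT.
  exists (exist _ _ (ultra_and FV VA VA'), exist _ _ fYY) => y [/= [? ?] ? ? nY].
  by split; split=> //= ?; apply: nY; [left|right].
have UA0 A (VA : V A) : U (fun x => [/\ A (col' ord_max x), c < x ord0 ord_max & x ord0 ord_max < e]).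
  apply: (ultra_mono FU _ (UE (exist _ A VA, exist _ _ noY))).
  by move=> y [].
have UA := UA0 _ (ultra_and FV VD VN).
(* The projection contains [V], and an ultrafilter is a maximal filter. *)
have projU : proj U = V.
  by apply: max_filter => A VA; apply: (ultra_mono FU _ (UA0 A VA)) => y [].
exists U; split=> //.
- exists true, s'; split=> //; first by rewrite projU.
  move=> f df Uf; have fY w' : exists q : seq M, forall t, t = f w' -> t \in q.
    by exists [:: f w'] => a ->; rewrite mem_head.
  have [y [[_ yf] [_ _ _]]] := ultra_ex FU (ultra_and FU Uf
    (UE (exist _ D VD, exist _ (fun w a => a = f w) fY))).
  exact.
- apply: (ultra_mono FU _ UA) => y; have [v [a ->]] := snocP y.
  rewrite col'_snoc snoc_max => -[[Dv [[H1 H2] _]] ca ae].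
  by apply/band_snoc; split=> //; [apply: H1|apply: H2] => //; ord.
- apply: (ultra_mono FU _ UA) => y; have [v [a ->]] := snocP y.
  rewrite col'_snoc snoc_max => -[[Dv [_ H3]] ca ae].
  by apply: H3; ord.
Qed.

End Signatures.

(** * Families of finite sets *)

Section Fibers.
Variables (d : Order.disp_t) (M : orderTopologicalType d) (L : signature).
Variables (str : expansion M L) (dlo : dense_without_endpoints M) (omin : o_minimal str).
Variable x0 : M.
Local Notation dmap := (dmap str).
Local Notation drel := (drel str).
Local Notation dset := (dset str).
Local Notation dpred := (dpred str).
Local Notation definable := (definable str).
Local Notation scell := (scell str).
Local Notation usig := (usig str).

(** Strict sorting makes the list unique. It also lets the least element be split off, which shows
    by recursion on [k] that the condition is first-order. *)
Definition card_is (S : M -> Prop) k :=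
  exists q : seq M, [/\ sorted <%O q, size q = k & forall t, S t <-> t \in q].

Lemma card_is0 S : card_is S 0 <-> forall t, ~ S t.
Proof.
split=> [[q [_ /size0nil -> H]] t /H //|nS].
by exists [::]; split=> // t; split=> // /nS.
Qed.

Lemma card_isS S k : card_is S k.+1 <->
  exists m, [/\ S m, forall t, S t -> m <= t & card_is (fun t => S t /\ m < t) k].
Proof.
split=> [[[|m q] [/= Hq szq H]]|[m [Sm Hm [q [sq szq H]]]]] //; first case: szq => szq.
  move: Hq; rewrite (path_sortedE lt_trans) => /andP[/allP mq sq].
  exists m; split; first by apply/H; rewrite mem_head.
    by move=> t /H; rewrite inE => /predU1P[->//|/mq/ltW].
  exists q; split=> // t; split=> [[/H]|tq].
    by rewrite inE => /predU1P[->|//]; rewrite ltxx.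
  by split; [apply/H; rewrite inE tq orbT|exact: mq].
exists (m :: q); split; rewrite /= ?szq //.
  by rewrite (path_sortedE lt_trans) sq andbT; apply/allP => t /H[].
move=> t; rewrite inE; split=> [St|/predU1P[->//|/H[]//]].
have := Hm t St; rewrite le_eqVlt => /predU1P[->|mt]; first by rewrite eqxx.
by apply/orP; right; apply/H.
Qed.

Lemma dpred_card (S : (nat -> M) -> M -> Prop) k :
  dpred (fun e => S (fun i => e i.+1) (e 0%N)) -> dpred (fun e => card_is (S e) k).
Proof.
elim: k S => [|k IH] S dS.
  apply: (dpred_ext (fun e => iff_sym (card_is0 (S e)))).
  exact: (@dpred_all _ _ _ _ (fun e t => ~ S e t) (dpred_not dS)).
apply: (dpred_ext (fun e => iff_sym (card_isS (S e) k))).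
have dS2 : dpred (fun e => S (fun i => e i.+2) (e 0%N)).
  exact: (dpred_rename (fun i => if i is j.+1 then j.+2 else 0%N) dS).
apply: dpred_ex; apply: dpred_and3 => //; first by apply: dpred_all; apply: dpred_imp => //; dsolve.
by apply: (IH (fun e t => S (fun i => e i.+1) t /\ e 0%N < t)); apply: dpred_and => //; dsolve.
Qed.

Section Normal.
Variables (n : nat) (D : set 'rV[M]_n) (Y : 'rV[M]_n -> M -> Prop).

Definition empty_near z r := exists c e, [/\ c < r, r < e &
  near z (fun z' => D z' -> forall t, c < t -> t < e -> ~ Y z' t)].

(** As arbitrarily small windows are required, the unique nearby point tends to [r]: the fibres
    form, locally, the graph of a function that is continuous at [z]. These are the normal points of
    the classical proof of uniform finiteness. *)
Definition graph_near z r := Y z r /\ forall c e, c < r -> r < e ->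
  exists c' e', (c <= c' /\ c' < r /\ r < e' /\ e' <= e) /\
  near z (fun z' => D z' -> exists t, [/\ c' < t, t < e', Y z' t &
    forall u, c' < u -> u < e' -> Y z' u -> u = t]).

Definition normal z r := empty_near z r \/ graph_near z r.

Definition bounded_below z := exists c, near z (fun z' => D z' -> forall t, t < c -> ~ Y z' t).

Definition bounded_above z := exists c, near z (fun z' => D z' -> forall t, c < t -> ~ Y z' t).

(** At [t < r] within the window, a smaller window around [r], lying above some [v] between [t] and
    [r], already captures the unique point, so nothing is left below [v]. The case [r < t] is
    symmetric. *)
Lemma normal_open z r : D z -> normal z r ->
  exists c e, [/\ c < r, r < e & forall t, c < t -> t < e -> normal z t].
Proof.
move=> Dz [[c [e [cr re N]]]|/[dup] Nr [Yr H]].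
  by exists c, e; split=> // t ct te; left; exists c, e.
have [a ar] := dlo_no_min dlo r; have [b rb] := dlo_no_max dlo r.
have [c [e [[ac [cr [re eb]]] N]]] := H a b ar rb.
exists c, e; split=> // t ct te.
have [tr|rt|->] := ltgtP t r; last by right.
  have [v [tv vr]] := dlo_dense dlo tr.
  have [c' [e' [[vc' [c'r [re' e'e]]] N']]] := H v e vr re.
  left; exists c, v; split=> //; apply: near_mono (near_and N N') => z' [H1 H2] Dz' w cw wv Yw.
  have [t1 [_ _ _ U1]] := H1 Dz'; have [t2 [ct2 t2e Y2 _]] := H2 Dz'.
  have wt : w = t1 by apply: U1 => //; ord.
  have tt : t2 = t1 by apply: U1 => //; ord.
  by subst; ord.
have [v [rv vt]] := dlo_dense dlo rt.
have [c' [e' [[cc' [c'r [re' e'v]]] N']]] := H c v cr rv.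
left; exists v, e; split=> //; apply: near_mono (near_and N N') => z' [H1 H2] Dz' w vw we Yw.
have [t1 [_ _ _ U1]] := H1 Dz'; have [t2 [ct2 t2e Y2 _]] := H2 Dz'.
have wt : w = t1 by apply: U1 => //; ord.
have tt : t2 = t1 by apply: U1 => //; ord.
by subst; ord.
Qed.

Hypotheses (dD : definable D) (dY : drel Y).

(** A compactness argument, by [itv_induction] on the upper end of the interval: at each step
    finitely many boxes are intersected. *)
Lemma near_gap z e c : (forall r, normal z r) -> e <= c ->
  (forall r, e <= r -> r <= c -> ~ Y z r) ->
  near z (fun z' => D z' -> forall t, e <= t -> t <= c -> ~ Y z' t).
Proof.
move=> nz ec nY.
pose S v := near z (fun z' => D z' -> forall t, e <= t -> t <= v -> ~ Y z' t).
have em r : e <= r -> r <= c -> empty_near z r.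
  by move=> er rc; have [//|[]] := nz r => Yr; case: (nY r).
have dS : dset S by rewrite /dset /S; dsolve.
apply: (@itv_induction _ _ _ _ dlo omin S e c) => //.
- have [c1 [e1 [? ? N]]] := em e (lexx _) ec.
  by apply: near_mono N => z' H Dz' t et te; apply: H => //; ord.
- move=> v ev vc Sv; have [c1 [e1 [c1v ve1 N]]] := em v ev (ltW vc).
  exists e1; split=> // w vw we1; apply: near_mono (near_and Sv N) => z' [H1 H2] Dz' t et tw.
  by have [tv|vt] := leP t v; [apply: H1|apply: H2 => //; ord].
- move=> v ev vc Sv; have [c1 [e1 [c1v ve1 N]]] := em v (ltW ev) vc.
  have [w [wv c1w ew]] := below_gt dlo c1v ev.
  apply: near_mono (near_and (Sv w (ltW ew) wv) N) => z' [H1 H2] Dz' t et tv.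
  by have [tw|wt] := leP t w; [apply: H1|apply: H2 => //; ord].
Qed.

(** A sweep upwards from [e]: [near_gap] keeps the gap before the next point [v] empty, normality
    gives exactly one point in a window around [v], and the induction resumes at the upper end [e']
    of this window. [bounded_above] handles the unbounded part after the last point. *)
Lemma near_card_above z (q : seq M) e : D z -> (forall r, normal z r) -> bounded_above z ->
  sorted <%O q -> (forall t, e <= t /\ Y z t <-> t \in q) -> ~ Y z e ->
  near z (fun z' => D z' -> card_is (fun t => e <= t /\ Y z' t) (size q)).
Proof.
move=> Dz nz bz; elim: q e => [|v q IH] e sq Eq nYe.
  have [c Nc] := bz; have [a [ca ea]] := above2 dlo c e.
  have G : near z (fun z' => D z' -> forall t, e <= t -> t <= a -> ~ Y z' t).
    apply: near_gap => //; first exact: ltW.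
    by move=> r er _ Yr; have : r \in [::] by apply/Eq.
  apply: near_mono (near_and Nc G) => z' [H1 H2] Dz'; apply/card_is0 => t [et Yt].
  by have [ta|at_] := leP t a; [apply: (H2 _ t)|apply: (H1 _ t) => //; ord].
move: sq; rewrite /= (path_sortedE lt_trans) => /andP[/allP vq sq].
have [ev Yv] : e <= v /\ Y z v by apply/Eq; rewrite mem_head.
have {}ev : e < v.
  by move: ev; rewrite le_eqVlt => /predU1P[ev|//]; case: nYe; rewrite ev.
have [b [vb bq]] : exists b, v < b /\ forall t, t \in q -> b < t.
  case: (q) vq sq => [|w q'] vq sq; first by have [b ?] := dlo_no_max dlo v; exists b.
  have [b [vb bw]] := dlo_dense dlo (vq w (mem_head _ _)).
  exists b; split=> // t; move: sq; rewrite /= (path_sortedE lt_trans) => /andP[/allP wq _].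
  by rewrite inE => /predU1P[->//|/wq ?]; ord.
have [[c1 [e1 [c1v ve1 /near_self N]]]|[_ H]] := nz v.
  by case: (N Dz v).
have [c' [e' [[ec' [c'v [ve' e'b]]] N]]] := H e b ev vb.
have G : near z (fun z' => D z' -> forall t, e <= t -> t <= c' -> ~ Y z' t).
  apply: near_gap => // r er rc' Yr.
  have : r \in v :: q by apply/Eq.
  by rewrite inE => /predU1P[rv|/vq ?]; subst; ord.
have Eq' t : e' <= t /\ Y z t <-> t \in q.
  split=> [[e't Yt]|tq].
    have : t \in v :: q by apply/Eq; split=> //; ord.
    by rewrite inE => /predU1P[?|//]; subst; ord.
  have /Eq[_ Yt] : t \in v :: q by rewrite inE tq orbT.
  by split=> //; have := bq t tq => ?; ord.
have nYe' : ~ Y z e'.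
  by move=> Ye'; have /bq ? : e' \in q by [apply/Eq'; split]; ord.
apply: near_mono (near_and (near_and N G) (IH e' sq Eq' nYe')) => z' [[H1 H2] H3] Dz'.
have [t [c't te' Yt Ut]] := H1 Dz'; apply/card_isS; exists t; split.
- by split=> //; ord.
- move=> u [eu Yu]; rewrite leNgt; apply/negP => ut.
  have [uc|cu] := leP u c'; first by case: (H2 Dz' u).
  by have := Ut u cu ltac:(ord) Yu => ?; subst; ord.
have [q' [sq' szq' E']] := H3 Dz'; exists q'; split=> // u; rewrite -E'.
split=> [[[eu Yu] tu]|[e'u Yu]].
  by split=> //; rewrite leNgt; apply/negP => ue'; have := Ut u ltac:(ord) ue' Yu => ?; subst; ord.
by split; first split=> //; ord.
Qed.

Lemma near_card z k : D z -> (forall r, normal z r) -> bounded_below z -> bounded_above z ->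
  card_is (Y z) k -> near z (fun z' => D z' -> card_is (Y z') k).
Proof.
move=> Dz nz [c Nc] bz [q [sq <- Eq]].
have [e ec] := dlo_no_min dlo c.
have nYe t : t < c -> ~ Y z t by move/near_self: Nc; apply.
have eY t : Y z t -> e <= t.
  by move=> Yt; rewrite leNgt; apply/negP => te; apply: (nYe t) => //; ord.
have := @near_card_above z q e Dz nz bz sq _ (nYe e ec).
case; first by move=> t; rewrite -Eq; split=> [[]|Yt] //; split=> //; exact: eY.
move=> a [b [abz H]]; have {H}N : near z (fun z' => D z' -> card_is (fun t => e <= t /\ Y z' t) (size q)).
  by exists a, b.
apply: near_mono (near_and N Nc) => z' [H1 H2] Dz'.
have [q' [sq' szq' E']] := H1 Dz'; exists q'; split=> // t; rewrite -E'.
split=> [Yt|[]//]; split=> //; rewrite leNgt; apply/negP => te.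
by apply: (H2 Dz' t) => //; ord.
Qed.

End Normal.

(** The quantifier over [U] matters: in the inductive step this is applied to [proj U] and, in
    [ultra_slice], to another ultrafilter of the same signature. Decomposing a set and making a
    function continuous are proved together. *)
Definition cell_decomp n := forall s (U : set (set 'rV[M]_n)) (A : set 'rV[M]_n) f,
  UltraFilter U -> usig s U -> definable A -> U A -> dmap f ->
  exists C, [/\ scell s C, C `<=` A, U C & contin C f].

Lemma ultra_decide n (U : set (set 'rV[M]_n)) (A P : set 'rV[M]_n) :
  UltraFilter U -> definable A -> U A -> definable P ->
  exists A', [/\ definable A', A' `<=` A, U A' & (forall z, A' z -> P z) \/ (forall z, A' z -> ~ P z)].
Proof.
move=> FU dA UA dP; have [UP|/(ultra_not _ FU) UP] := pselect (U P).
  exists (fun z => A z /\ P z); split; [|by move=> z []|exact: ultra_and|by left=> z []].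
  by apply/(definableP _ x0); dsolve.
exists (fun z => A z /\ ~ P z); split; [|by move=> z []|exact: ultra_and|by right=> z []].
by apply/(definableP _ x0); dsolve.
Qed.

Lemma sup_is_max S (q : seq M) t : (forall u, S u <-> u \in q) -> S t ->
  S (sup_ x0 S) /\ forall u, S u -> u <= sup_ x0 S.
Proof.
move=> E St; have [m [Sm Hm]] := seq_max E St.
suff -> : sup_ x0 S = m by [].
apply: inf_E; split=> [u|u mu]; first exact.
by exists m.
Qed.

Lemma inf_is_min S (q : seq M) t : (forall u, S u <-> u \in q) -> S t ->
  S (inf_ x0 S) /\ forall u, S u -> inf_ x0 S <= u.
Proof.
move=> E St; have [m [Sm Hm]] := seq_min E St.
suff -> : inf_ x0 S = m by [].
by apply: inf_E; split=> // u mu; exists m.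
Qed.

Lemma finite_sub S S' (q : seq M) : (forall u, S u <-> u \in q) -> (forall u, S' u -> S u) ->
  exists q' : seq M, forall u, S' u <-> u \in q'.
Proof.
move=> E SS; exists [seq u <- q | `[<S' u>]] => u; rewrite mem_filter; split.
  by move=> S'u; apply/andP; split; [apply/asboolP|apply/E/SS].
by move=> /andP[/asboolP].
Qed.

(** * Uniform finiteness for almost all fibres *)

Section Uniform.
Variables (n : nat) (s : seq bool) (U : set (set 'rV[M]_n)) (D : set 'rV[M]_n).
Variable Y : 'rV[M]_n -> M -> Prop.
Hypotheses (cdn : cell_decomp n) (FU : UltraFilter U) (sU : usig s U).
Hypotheses (sD : scell s D) (UD : U D) (dY : drel Y).
Hypothesis finY : forall z, D z -> exists q : seq M, forall t, Y z t <-> t \in q.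

Let dD : definable D. Proof. exact: scell_definable sD. Qed.

(** On a cell of [U] the largest point of the fibre is a continuous function, hence locally bounded.
    For an empty fibre [sup_] only returns a default value, but there is nothing to bound. *)
Lemma ultra_bounded_above : U (fun z => D z /\ bounded_above D Y z).
Proof.
apply: (ultra_and FU UD); apply: contrapT => /(ultra_not _ FU) UN.
have [|||C [sC CA UC cC]] := @cdn s U (fun z => D z /\ ~ bounded_above D Y z)
    (fun z => sup_ x0 (Y z)) FU sU.
- by apply/(definableP _ x0); rewrite /bounded_above; dsolve.
- exact: ultra_and.
- by rewrite /dmap; dsolve.
have [z Cz] := scell_nonempty x0 sC; have [Dz []] := CA z Cz.
have CD : C `<=` D by move=> ? /CA[].
have [c sc] := dlo_no_max dlo (sup_ x0 (Y z)); exists c.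
have [_ /(_ sc) N1] := cC z Cz c.
apply: near_mono (near_and N1 (scell_open dlo sC sD CD Cz)) => z' [H1 H2] Dz' t ct Yt.
have [q Eq] := finY Dz'; have [_ /(_ t Yt)] := sup_is_max Eq Yt.
by have := H1 (H2 Dz') => ? ?; ord.
Qed.

Lemma ultra_bounded_below : U (fun z => D z /\ bounded_below D Y z).
Proof.
apply: (ultra_and FU UD); apply: contrapT => /(ultra_not _ FU) UN.
have [|||C [sC CA UC cC]] := @cdn s U (fun z => D z /\ ~ bounded_below D Y z)
    (fun z => inf_ x0 (Y z)) FU sU.
- by apply/(definableP _ x0); rewrite /bounded_below; dsolve.
- exact: ultra_and.
- by rewrite /dmap; dsolve.
have [z Cz] := scell_nonempty x0 sC; have [Dz []] := CA z Cz.
have CD : C `<=` D by move=> ? /CA[].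
have [c sc] := dlo_no_min dlo (inf_ x0 (Y z)); exists c.
have [/(_ sc) N1 _] := cC z Cz c.
apply: near_mono (near_and N1 (scell_open dlo sC sD CD Cz)) => z' [H1 H2] Dz' t ct Yt.
have [q Eq] := finY Dz'; have [_ /(_ t Yt)] := inf_is_min Eq Yt.
by have := H1 (H2 Dz') => ? ?; ord.
Qed.

(* Otherwise the least non-normal [r] and its two neighbours in the fibre of
   [Y] would be continuous functions on a cell of [U], which makes this [r]
   normal. *)
Lemma ultra_normal : U (fun z => D z /\ forall r, normal D Y z r).
Proof.
apply: (ultra_and FU UD); apply: contrapT => /(ultra_not _ FU) UN.
pose N z r := ~ normal D Y z r.
have dN : drel N by rewrite /drel /N /normal /empty_near /graph_near; dsolve.
pose beta z := inf_ x0 (N z).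
have dbeta : dmap beta by rewrite /dmap /beta; dsolve.
pose B z := [/\ D z, bounded_below D Y z & exists r, N z r].
have dB : definable B by apply/(definableP _ x0); rewrite /B /bounded_below; dsolve.
have UB : U B.
  apply: (ultra_mono FU _ (ultra_and FU ultra_bounded_below UN)) => z [[Dz bz] nN].
  by split=> //; apply: contrapT => none; apply: nN => r; apply: contrapT => ?; apply: none; exists r.
(* The infimum exists since far below the fibres of [Y] every [r] is normal; it is attained since
   normality is open along the fibre. *)
have Nbeta z : B z -> N z (beta z).
  move=> [Dz [c Nc] [r Nr]]; have [||b gb] := @glb_ex _ _ _ _ dlo omin (N z) c r _ _ Nr.
  - by rewrite /dset; dsolve.
  - move=> u Nu; rewrite leNgt; apply/negP => uc; apply: Nu; left.
    have [a au] := dlo_no_min dlo u; exists a, c; split=> //.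
    by apply: near_mono Nc => z' H Dz' t _ tc; apply: H.
  rewrite /beta (inf_E x0 gb) => /(normal_open Dz)[a [e [ab be H]]].
  have [lb gg] := gb; have [t [Nt te]] := gg e be.
  by have bt := lb t Nt; apply: Nt; apply: H => //; ord.
pose bm z := sup_ x0 (fun t => Y z t /\ t < beta z).
pose bp z := inf_ x0 (fun t => Y z t /\ beta z < t).
(* Whether [beta z] has a neighbour below, has one above, and belongs to [Y z] itself: each question
   gets one answer on a whole set of [U]. *)
have [|A1 [dA1 A1B UA1 H1]] := @ultra_decide n U B (fun z => exists t, Y z t /\ t < beta z) FU dB UB.
  by apply/(definableP _ x0); dsolve.
have [|A2 [dA2 A2A UA2 H2]] := @ultra_decide n U A1 (fun z => exists t, Y z t /\ beta z < t) FU dA1 UA1.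
  by apply/(definableP _ x0); dsolve.
have [|A3 [dA3 A3A UA3 H3]] := @ultra_decide n U A2 (fun z => Y z (beta z)) FU dA2 UA2.
  by apply/(definableP _ x0); dsolve.
have [C1 [sC1 C1A UC1 cC1]] := cdn FU sU dA3 UA3 dbeta.
have [|C2 [sC2 C2C UC2 cC2]] := @cdn s U C1 bm FU sU (scell_definable x0 sC1) UC1.
  by rewrite /dmap /bm; dsolve.
have [|C [sC CC UC cC]] := @cdn s U C2 bp FU sU (scell_definable x0 sC2) UC2.
  by rewrite /dmap /bp; dsolve.
have cb : contin C beta by apply: contin_sub cC1 => z /CC/C2C.
have cm : contin C bm by apply: contin_sub cC2.
have CA3 : C `<=` A3 by move=> z /CC/C2C/C1A.
have CA1 : C `<=` A1 by move=> z /CA3/A3A/A2A.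
have CD : C `<=` D by move=> z /CA1/A1B[].
have [z Cz] := scell_nonempty x0 sC; have Dz := CD z Cz.
(* A level strictly between [bm z] and [beta z] stays there nearby by continuity, so that no point
   of [Y] lies between it and [beta]. Without a neighbour below, any [c] below [beta z] will do. *)
have [c [cz Nc]] : exists c, c < beta z /\ near z (fun z' => C z' ->
    c < beta z' /\ forall t, c < t -> t < beta z' -> ~ Y z' t).
  case: H1 => H1; last first.
    have [c cz] := dlo_no_min dlo (beta z); exists c; split=> //.
    have [/(_ cz) N1 _] := cb z Cz c; apply: near_mono N1 => z' H Cz'; split; first exact: H.
    by move=> t _ tb Yt; apply: (H1 z' (CA1 _ Cz')); exists t.
  have maxbm z' : C z' -> bm z' < beta z' /\ forall t, Y z' t -> t < beta z' -> t <= bm z'.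
    move=> Cz'; have [q Eq] := finY (CD _ Cz'); have [t tb] := H1 z' (CA1 _ Cz').
    have [|q' Eq'] := @finite_sub _ (fun t => Y z' t /\ t < beta z') q Eq; first by move=> u [].
    have [[_ ?] H] := sup_is_max Eq' tb; split=> // u Yu ub; exact: H.
  have [mb _] := maxbm z Cz; have [c [mc cz]] := dlo_dense dlo mb.
  exists c; split=> //; have [/(_ cz) N1 _] := cb z Cz c; have [_ /(_ mc) N2] := cm z Cz c.
  apply: near_mono (near_and N1 N2) => z' [H H'] Cz'; split; first exact: H.
  by move=> t ct tb Yt; have := proj2 (maxbm z' Cz') t Yt tb; have := H' Cz' => ? ?; ord.
have [e [ze Ne]] : exists e, beta z < e /\ near z (fun z' => C z' ->
    beta z' < e /\ forall t, beta z' < t -> t < e -> ~ Y z' t).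
  case: H2 => H2; last first.
    have [e ze] := dlo_no_max dlo (beta z); exists e; split=> //.
    have [_ /(_ ze) N1] := cb z Cz e; apply: near_mono N1 => z' H Cz'; split; first exact: H.
    by move=> t tb _ Yt; apply: (H2 z' (A3A _ (CA3 _ Cz'))); exists t.
  have minbp z' : C z' -> beta z' < bp z' /\ forall t, Y z' t -> beta z' < t -> bp z' <= t.
    move=> Cz'; have [q Eq] := finY (CD _ Cz'); have [t tb] := H2 z' (A3A _ (CA3 _ Cz')).
    have [|q' Eq'] := @finite_sub _ (fun t => Y z' t /\ beta z' < t) q Eq; first by move=> u [].
    have [[_ ?] H] := inf_is_min Eq' tb; split=> // u Yu ub; exact: H.
  have [bz _] := minbp z Cz; have [e [ze ep]] := dlo_dense dlo bz.
  exists e; split=> //; have [_ /(_ ze) N1] := cb z Cz e; have [/(_ ep) N2 _] := cC z Cz e.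
  apply: near_mono (near_and N1 N2) => z' [H H'] Cz'; split; first exact: H.
  by move=> t bt te Yt; have := proj2 (minbp z' Cz') t Yt bt; have := H' Cz' => ? ?; ord.
have NC := scell_open dlo sC sD CD Cz.
apply: (Nbeta z (A1B _ (CA1 _ Cz))).
case: H3 => H3; last first.
  left; exists c, e; split=> //; apply: near_mono (near_and (near_and Nc Ne) NC).
  move=> z' [[Hc He] HC] Dz' t ct te Yt; have Cz' := HC Dz'.
  have [_ {}Hc] := Hc Cz'; have [_ {}He] := He Cz'.
  have [tb|bt|tb] := ltgtP t (beta z'); [exact: (Hc t)|exact: (He t)|].
  by apply: (H3 z' (CA3 _ Cz')); rewrite -tb.
right; split=> [|c0 e0 c0b be0]; first exact: (H3 z (CA3 _ Cz)).
have [c' [c'b c0c' cc']] := below_gt dlo c0b cz.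
have [e' [be' e'e0 e'e]] := above_lt dlo be0 ze.
exists c', e'; split; first by split; [exact: ltW|split=> //; split=> //; exact: ltW].
have [/(_ c'b) N1 _] := cb z Cz c'; have [_ /(_ be') N2] := cb z Cz e'.
apply: near_mono (near_and (near_and (near_and Nc Ne) NC) (near_and N1 N2)).
move=> z' [[[Hc He] HC] [Hc' He']] Dz'; have Cz' := HC Dz'.
have [_ {}Hc] := Hc Cz'; have [_ {}He] := He Cz'.
exists (beta z'); split; [exact: Hc'|exact: He'|exact: (H3 z' (CA3 _ Cz'))|].
move=> u c'u ue' Yu; have [ub|bu|//] := ltgtP u (beta z').
  by case: (Hc u) => //; ord.
by case: (He u) => //; ord.
Qed.

(** Where all points are normal and the fibres are locally bounded, the cardinality is locally
    constant, hence constant on a cell by [scell_connected]. *)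
Lemma uniform_card : exists C k, [/\ scell s C, C `<=` D, U C & forall z, C z -> card_is (Y z) k].
Proof.
have UG : U (fun z => [/\ bounded_above D Y z, bounded_below D Y z & forall r, normal D Y z r]).
  apply: (ultra_mono FU _ (ultra_and FU ultra_bounded_above (ultra_and FU ultra_bounded_below ultra_normal))).
  by move=> z [[? ?] [[? ?] [? ?]]].
have [|||C [sC CA UC _]] := @cdn s U (fun z => D z /\
    [/\ bounded_above D Y z, bounded_below D Y z & forall r, normal D Y z r]) (fun=> x0) FU sU.
- apply/(definableP _ x0); rewrite /bounded_above /bounded_below /normal /empty_near /graph_near.
  by dsolve.
- exact: ultra_and.
- exact: dfun_const.
have CD : C `<=` D by move=> z /CA[].
have [z Cz] := scell_nonempty x0 sC.
have [q Eq] := finY (CD z Cz).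
pose k := size (sort <=%O (undup q)).
have Hk : card_is (Y z) k.
  exists (sort <=%O (undup q)); split=> //.
    by rewrite lt_sorted_uniq_le sort_uniq undup_uniq sort_le_sorted.
  by move=> t; rewrite mem_sort mem_undup.
exists C, k; split=> // z' Cz'.
apply: (@scell_connected _ _ _ _ dlo omin x0 n s C (fun z => card_is (Y z) k)) Hk => //.
  by apply/(definableP _ x0); apply: dpred_card; dsolve.
move=> y Cy; have [Dy [ay by_ ny]] := CA y Cy.
have [q' Eq'] := finY Dy.
pose k' := size (sort <=%O (undup q')).
have Hk' : card_is (Y y) k'.
  exists (sort <=%O (undup q')); split=> //.
    by rewrite lt_sorted_uniq_le sort_uniq undup_uniq sort_le_sorted.
  by move=> t; rewrite mem_sort mem_undup.
have := near_card dD dY Dy ny by_ ay Hk'; apply: near_mono => y' H /CD Dy'.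
have {}H := H Dy'.
have card_uniq S a b : card_is S a -> card_is S b -> a = b.
  move=> [qa [sa <- Ea]] [qb [sb <- Eb]].
  rewrite (lt_sorted_eq sa sb) // => t; apply/idP/idP => ?; first by apply/Eb/Ea.
  by apply/Ea/Eb.
by split=> Hy; [rewrite (card_uniq _ _ _ Hy H)|rewrite (card_uniq _ _ _ Hy Hk')].
Qed.

End Uniform.

Fixpoint curves n (C : set 'rV[M]_n) (Y : 'rV[M]_n -> M -> Prop) (fs : seq ('rV[M]_n -> M)) :=
  match fs with
  | [::] => forall x, C x -> forall t, ~ Y x t
  | f :: fs' => [/\ dmap f, contin C f,
      forall x, C x -> Y x (f x) /\ forall t, Y x t -> f x <= t &
      curves C (fun x t => Y x t /\ f x < t) fs']
  end.

Lemma uniform_curves n s (U : set (set 'rV[M]_n)) D (Y : 'rV[M]_n -> M -> Prop) :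
  cell_decomp n -> UltraFilter U -> usig s U -> scell s D -> U D -> drel Y ->
  (forall z, D z -> exists q : seq M, forall t, Y z t <-> t \in q) ->
  exists C fs, [/\ scell s C, C `<=` D, U C & curves C Y fs].
Proof.
move=> cdn FU sU sD UD dY finY.
have [C [k [sC CD UC Hk]]] := uniform_card cdn FU sU sD UD dY finY.
suff [C' [fs [sC' CC' UC' H]]] : exists C' fs, [/\ scell s C', C' `<=` C, U C' & curves C' Y fs].
  by exists C', fs; split=> // x /CC'/CD.
elim: k C Y dY sC UC Hk {D sD UD finY CD} => [|k IH] C Y dY sC UC Hk.
  by exists C, [::]; split=> // x /Hk/card_is0.
pose f z := inf_ x0 (Y z).
have minf z : C z -> [/\ Y z (f z), forall t, Y z t -> f z <= t & card_is (fun t => Y z t /\ f z < t) k].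
  move=> /Hk/card_isS[m [Ym Hm cm]]; suff -> : f z = m by [].
  by apply: inf_E; split=> // b mb; exists m.
have df : dmap f by rewrite /dmap /f; dsolve.
have [C1 [sC1 C1C UC1 cf]] := cdn s U C f FU sU (scell_definable x0 sC) UC df.
have [||C2 [fs [sC2 C2C UC2 H]]] := IH C1 (fun z t => Y z t /\ f z < t) _ sC1 UC1.
- by rewrite /drel; dsolve.
- by move=> z /C1C/minf[].
exists C2, (f :: fs); split=> //; first by move=> z /C2C/C1C.
split=> //; first by apply: contin_sub cf.
by move=> z /C2C/C1C/minf[].
Qed.

End Fibers.

(** * Cell decomposition *)

Section CellDecomposition.
Variables (d : Order.disp_t) (M : orderTopologicalType d) (L : signature).
Variables (str : expansion M L) (dlo : dense_without_endpoints M) (omin : o_minimal str).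
Variable x0 : M.
Local Notation dmap := (dmap str).
Local Notation drel := (drel str).
Local Notation dset := (dset str).
Local Notation definable := (definable str).
Local Notation scell := (scell str).
Local Notation usig := (usig str).
Local Notation cell_decomp := (cell_decomp str).
Local Notation cbound := (cbound str).

Lemma cell_decomp0 : cell_decomp 0.
Proof.
move=> s U A f FU -> dA UA df; exists setT; split=> //.
- have [x Ax] := ultra_ex FU UA => y _.
  by rewrite (_ : y = x) //; apply/rowP => -[].
- exact: (ultra_mono FU _ UA).
have E (x y : 'rV[M]_0) : x = y by apply/rowP => -[].
move=> x _ c; split=> H; apply: (near_all dlo) => y _; by rewrite (E y x).
Qed.

Lemma fiber_itv n (C : set 'rV[M]_n) l u w t : cbound C l -> cbound C u -> C w ->
  lo l w t -> hi u w t -> exists c e, [/\ c < t, t < e &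
    forall t', c < t' -> t' < e -> lo l w t' /\ hi u w t'].
Proof.
move=> bl bu Cw lt ut; have [c [ct /near_self Hc]] := near_lo dlo bl Cw lt.
have [e [te /near_self He]] := near_hi dlo bu Cw ut.
by exists c, e; split=> // t' ? ?; split; [exact: Hc|exact: He].
Qed.

Definition frontier_at (S : M -> Prop) t := forall c e, c < t -> t < e ->
  (exists u, [/\ c < u, u < e & S u]) /\ exists u, [/\ c < u, u < e & ~ S u].

(** If the frontier contained an interval, the germ of [S] at its left end would decide [S] on a
    smaller interval, which then has no frontier points. *)
Lemma frontier_finite S : dset S -> exists q : seq M, forall t, frontier_at S t <-> t \in q.
Proof.
move=> dS; have [|[a [b [ab H]]]|//] := @dset_finite _ _ _ _ omin (frontier_at S).
  by rewrite /dset /frontier_at; dsolve.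
have [e [ae He]] := dset_germ dlo omin a dS.
have [f [af fe fb]] := above_lt dlo ae ab.
have [t [at_ tf]] := dlo_dense dlo af.
have [[u [au uf Su]] [v [av vf nSv]]] := H t at_ ltac:(ord) a f at_ tf.
by case: He => He; [case: nSv|case: (He u _ _ Su)]; try apply: He; ord.
Qed.

Lemma frontier_const S I : dset S -> convex I ->
  (forall t, I t -> exists c e, [/\ c < t, t < e & forall u, c < u -> u < e -> I u]) ->
  (forall t, I t -> ~ frontier_at S t) -> forall t u, I t -> I u -> S t -> S u.
Proof.
move=> dS cI oI nf; apply: (loc_const_convex dlo omin dS cI) => t It.
have [c [e [ct te all_or]]] : exists c e, [/\ c < t, t < e &
    (forall u, c < u -> u < e -> S u) \/ (forall u, c < u -> u < e -> ~ S u)].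
  apply: contrapT => H; apply: (nf t It) => c e ct te.
  split; apply: contrapT => N; apply: H; exists c, e; split=> //.
    by right=> u cu ue Su; apply: N; exists u.
  by left=> u cu ue; apply: contrapT => Su; apply: N; exists u.
exists c, e; split=> // u cu ue _.
by case: all_or => H; split=> // ?; [exact: H|exact: H|case: (H u)|case: (H t)].
Qed.

(** * The inductive step of cell decomposition *)

Section Step.
Variables (n : nat) (cdn : cell_decomp n).
Variables (s : seq bool) (U : set (set 'rV[M]_n.+1)).
Hypotheses (FU : UltraFilter U) (sU : usig s (proj U)).

Let FP : UltraFilter (proj U). Proof. exact: ultra_proj. Qed.

(** As [U] is carried by the graph of [g], both [A] and [f] are pulled back to the base along
    [snoc w (g w)]. *)
Lemma cell_graph A f g : definable A -> U A -> dmap f -> dmap g -> U (graph setT g) ->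
  exists C, [/\ scell (false :: s) C, C `<=` A, U C & contin C f].
Proof.
move=> dA UA df dg Ug.
have UA' : proj U (fun w => A (snoc w (g w))).
  apply: (ultra_mono FU _ (ultra_and FU UA Ug)) => x [+ [_]].
  have [w [t ->]] := snocP x; rewrite col'_snoc snoc_max => Awt tE.
  by rewrite -tE.
have [|C1 [sC1 C1A UC1 cg]] := cdn FP sU _ UA' dg.
  by apply/(definableP _ x0); dsolve.
have [|C2 [sC2 C2C UC2 cf]] := @cdn s (proj U) C1 (fun w => f (snoc w (g w))) FP sU
    (scell_definable x0 sC1) UC1.
  by rewrite /dmap; dsolve.
exists (graph C2 g); split.
- exists false, s, C2; split=> //; exists g; split=> //; exact: contin_sub cg.
- move=> x; have [w [t ->]] := snocP x => /graph_snoc[/C2C/C1A ? ->] //.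
- by apply: (ultra_mono FU _ (ultra_and FU UC2 Ug)) => x [? [_ ?]].
move=> x; have [w [t ->]] := snocP x => /graph_snoc[C2w ->] c.
have [a ag] := dlo_no_min dlo (g w); have [b gb] := dlo_no_max dlo (g w).
have [N1 N2] := cf w C2w c.
split=> [/N1|/N2] N; apply: near_mono (near_snoc N ag gb) => y;
  have [w' [t' ->]] := snocP y; rewrite col'_snoc => -[H _ _] /graph_snoc[? ->]; exact: H.
Qed.

Hypothesis nograph : forall f, dmap f -> ~ U (graph setT f).

Lemma ultra_side f : dmap f -> U (fun x => x ord0 ord_max < f (col' ord_max x)) \/
  U (fun x => f (col' ord_max x) < x ord0 ord_max).
Proof.
move=> df; have /(ultra_not _ FU) UN := nograph df.
apply: (ultra_or FU); apply: (ultra_mono FU _ UN) => x nx.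
have [?|?|xf] := ltgtP (x ord0 ord_max) (f (col' ord_max x)); [by left|by right|].
by case: nx.
Qed.

(** Since [U] contains no graph, it lies strictly on one side of each curve. Climbing the curves,
    the last one below [U] and the first one above it bound the desired band. *)
Lemma band_between (C : set 'rV[M]_n) Y fs l : cbound C l -> curves str C Y fs ->
  (forall w, C w -> forall t, Y w t -> lo l w t) -> (forall w, C w -> exists t, lo l w t) ->
  U (fun x => lo l (col' ord_max x) (x ord0 ord_max)) ->
  exists l' u', [/\ cbound C l', cbound C u',
    U (fun x => lo l' (col' ord_max x) (x ord0 ord_max) /\ hi u' (col' ord_max x) (x ord0 ord_max)),
    forall w, C w -> exists t, lo l' w t /\ hi u' w t &
    forall w, C w -> forall t, lo l' w t -> lo l w t /\ (hi u' w t -> ~ Y w t)].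
Proof.
elim: fs l Y => [|f fs IH] l Y bl /=.
  move=> noY Yl lne Ul; exists l, None; split=> //.
  - by apply: (ultra_mono FU _ Ul).
  - by move=> w /lne[t lt]; exists t.
  - by move=> w Cw t lt; split=> // _; apply: noY.
move=> [df cf fY cfs] Yl lne Ul.
have [Ult|Ugt] := ultra_side df.
  exists l, (Some f); split=> //.
  - exact: ultra_and.
  - move=> w Cw; have [/(Yl w Cw) + _] := fY w Cw.
    case: (l) => [g /= gf|_]; first by have [t [? ?]] := dlo_dense dlo gf; exists t.
    by have [t ?] := dlo_no_min dlo (f w); exists t.
  - move=> w Cw t lt; split=> //= tf Yt; have [_ /(_ t Yt) ?] := fY w Cw; ord.
have [|||||l' [u' [bl' bu' U' ne' H']]] := IH (Some f) (fun w t => Y w t /\ f w < t) => //.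
- by move=> w Cw t [].
- by move=> w Cw; have [t ?] := dlo_no_max dlo (f w); exists t.
exists l', u'; split=> // w Cw t lt; have [/= ft nY] := H' w Cw t lt.
have [Yf _] := fY w Cw; have := Yl w Cw _ Yf.
split=> [|ut Yt]; last by apply: (nY ut).
by case: (l) H => //= g ?; ord.
Qed.

(** The frontier points of the fibres of [A] form finitely many curves over a cell. Between the two
    curves that enclose [U], each fibre lies entirely inside or entirely outside [A]. *)
Lemma cell_band A : definable A -> U A ->
  exists C, [/\ scell (true :: s) C, C `<=` A & U C].
Proof.
move=> dA UA; pose S w t := A (snoc w t); pose Y w := frontier_at (S w).
have [|||D [sD _ UD _]] := @cdn s (proj U) setT (fun=> x0) FP sU.
- by apply/(definableP _ x0); apply: dpred_const.
- exact: (ultra_mono FU _ UA).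
- exact: dfun_const.
have [|w _|C [fs [sC CD UC cY]]] := @uniform_curves _ _ _ _ dlo omin x0 n s (proj U) D Y cdn FP sU sD UD.
- by rewrite /drel /Y /frontier_at /S; dsolve.
- by apply: frontier_finite; rewrite /dset /S; dsolve.
have [|||||l [u [bl bu Ulu ne H]]] := @band_between C Y fs None => //.
- by move=> w _; exists x0.
- exact: (ultra_mono FU _ UA).
have fib w t t' : C w -> lo l w t -> hi u w t -> lo l w t' -> hi u w t' -> S w t -> S w t'.
  move=> Cw lt ut lt' ut'; apply: (@frontier_const _ (fun t => lo l w t /\ hi u w t)) => //.
  - by rewrite /dset /S; dsolve.
  - exact: convex_lohi.
  - by move=> a [la ua]; apply: (fiber_itv bl bu).
  - by move=> a [la ua]; have [_] := H w Cw a la; apply.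
(* By [fib], one point of [A] in the fibre of the band puts the whole fibre into [A], and [U]
   provides such a point for almost all [w]. *)
pose C' w := C w /\ forall t, lo l w t -> hi u w t -> S w t.
have dC := scell_definable x0 sC.
have dC' : definable C'.
  apply/(definableP _ x0); rewrite /C' /S.
  case: (l) bl => [l' [dl _]|_]; case: (u) bu => [u' [du _]|_] /=; dsolve.
have UC' : proj U C'.
  apply: (ultra_mono FU _ (ultra_and FU UA (ultra_and FU UC Ulu))) => x [+ [+ +]].
  have [w [t ->]] := snocP x; rewrite col'_snoc snoc_max => Swt Cw [lt ut].
  by split=> // t' lt' ut'; apply: fib Swt.
have [|C2 [sC2 C2C UC2 _]] := @cdn s (proj U) C' (fun=> x0) FP sU dC' UC'.
  exact: dfun_const.
have C2C0 : C2 `<=` C by move=> w /C2C[].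
have sub b : cbound C b -> cbound C2 b by case: b => //= f [? ?]; split=> //; apply: contin_sub C2C0 _.
exists (band C2 l u); split.
- exists true, s, C2; split=> //; exists l, u; split; try exact: sub; last by [].
  by move=> w /C2C0/ne.
- by move=> x; have [w [t ->]] := snocP x => /band_snoc[/C2C[_ H'] ? ?]; apply: H'.
- apply: (ultra_mono FU _ (ultra_and FU UC2 Ulu)) => x [+ +].
  by have [w [t ->]] := snocP x; rewrite col'_snoc snoc_max => ? [? ?]; apply/band_snoc.
Qed.

Definition btw (a b c : M) := a <= b /\ b <= c \/ c <= b /\ b <= a.

(** If [U] avoided the points where [f] is locally monotone and continuous in the last variable, a
    band cell would do so too, against [monotone_point] on one of its fibres. Stating the result by
    [btw] merges the increasing and the decreasing case. *)
Lemma cell_monotone A f : definable A -> U A -> dmap f ->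
  exists C, [/\ scell (true :: s) C, C `<=` A, U C &
    forall w t, C (snoc w t) -> cont_at (fun t => f (snoc w t)) t /\
      forall t1 t2, C (snoc w t1) -> C (snoc w t2) -> t1 <= t -> t <= t2 ->
        btw (f (snoc w t1)) (f (snoc w t)) (f (snoc w t2))].
Proof.
move=> dA UA df; pose h w t := f (snoc w t).
have dh w : dfun1 str (h w) by rewrite /dfun1 /h; dsolve.
pose K (P : (M -> M) -> M -> Prop) x :=
  A x /\ P (h (col' ord_max x)) (x ord0 ord_max) /\ cont_at (h (col' ord_max x)) (x ord0 ord_max).
have dK1 : definable (K (@incr_at _ _)).
  by apply/(definableP _ x0); rewrite /K /incr_at /cont_at /h; dsolve.
have dK2 : definable (K (@decr_at _ _)).
  by apply/(definableP _ x0); rewrite /K /decr_at /cont_at /h; dsolve.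
have [UK|UK] : U (K (@incr_at _ _)) \/ U (K (@decr_at _ _)).
  apply: contrapT => /not_orP[/(ultra_not _ FU) n1 /(ultra_not _ FU) n2].
  have [||D [sD DA UD]] := @cell_band (fun x => A x /\ ~ K (@incr_at _ _) x /\ ~ K (@decr_at _ _) x).
  - by apply/(definableP _ x0); dsolve.
  - exact: (ultra_and FU UA (ultra_and FU n1 n2)).
  have [x Dx] := ultra_ex FU UD; move: Dx; have [w [t ->]] := snocP x => Dx.
  have [_ [_ [C [[<- <-] sC [l [u [bl bu ne ED]]]]]]] := sD.
  move: Dx; rewrite ED => /band_snoc[Cw lt ut].
  have [c [e [ct te H]]] := fiber_itv bl bu Cw lt ut.
  have [t' [ct' te' mt' ht']] := monotone_point dlo omin (dh w) (lt_trans ct te).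
  have /DA[At' [k1 k2]] : D (snoc w t').
    by rewrite ED; apply/band_snoc; have [? ?] := H t' ct' te'.
  by case: mt' => mt'; [apply: k1|apply: k2]; rewrite /K col'_snoc snoc_max.
- have [C [sC CK UC]] := cell_band dK1 UK.
  exists C; split=> //; first by move=> x /CK[].
  have [_ [_ [B [[<- <-] sB [l [u [bl bu ne EC]]]]]]] := sC.
  have inc w : B w -> forall t t', lo l w t /\ hi u w t -> lo l w t' /\ hi u w t' -> t <= t' -> h w t <= h w t'.
    move=> Bw; suff H t : lo l w t /\ hi u w t -> incr_at (h w) t.
      by move=> t t'; apply: (incr_convex dlo omin (dh w) (@convex_lohi _ _ _ l u w) H).
    move=> [lt ut]; have /CK[_] : C (snoc w t) by rewrite EC; apply/band_snoc.
    by rewrite col'_snoc snoc_max => -[].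
  move=> w t Ct; have [_ [_]] := CK _ Ct; rewrite col'_snoc snoc_max => ht; split=> // t1 t2.
  move: Ct; rewrite EC => /band_snoc[Bw ? ?] /band_snoc[_ ? ?] /band_snoc[_ ? ?] ? ?.
  by left; split; apply: inc.
- have [C [sC CK UC]] := cell_band dK2 UK.
  exists C; split=> //; first by move=> x /CK[].
  have [_ [_ [B [[<- <-] sB [l [u [bl bu ne EC]]]]]]] := sC.
  have dec w : B w -> forall t t', lo l w t /\ hi u w t -> lo l w t' /\ hi u w t' -> t <= t' -> h w t' <= h w t.
    move=> Bw; suff H t : lo l w t /\ hi u w t -> decr_at (h w) t.
      by move=> t t'; apply: (decr_convex dlo omin (dh w) (@convex_lohi _ _ _ l u w) H).
    move=> [lt ut]; have /CK[_] : C (snoc w t) by rewrite EC; apply/band_snoc.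
    by rewrite col'_snoc snoc_max => -[].
  move=> w t Ct; have [_ [_]] := CK _ Ct; rewrite col'_snoc snoc_max => ht; split=> // t1 t2.
  move: Ct; rewrite EC => /band_snoc[Bw ? ?] /band_snoc[_ ? ?] /band_snoc[_ ? ?] ? ?.
  by right; split; apply: dec.
Qed.

Definition slice_cont (D : set 'rV[M]_n.+1) (f : 'rV[M]_n.+1 -> M) x := forall c,
  (c < f x -> near (col' ord_max x) (fun w => D (snoc w (x ord0 ord_max)) -> c < f (snoc w (x ord0 ord_max)))) /\
  (f x < c -> near (col' ord_max x) (fun w => D (snoc w (x ord0 ord_max)) -> f (snoc w (x ord0 ord_max)) < c)).

(* A cell of [U] on which no slice is continuous would have, at any of its
   points, a generic ultrafilter on the base of the same signature; induction
   makes the slice continuous on a relatively open subset of the base. *)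
Lemma ultra_slice D f : scell (true :: s) D -> U D -> dmap f ->
  U (fun x => D x /\ slice_cont D f x).
Proof.
move=> sD UD df; have dD := scell_definable x0 sD.
apply: (ultra_and FU UD); apply: contrapT => /(ultra_not _ FU) UN.
have [||D1 [sD1 D1D UD1]] := @cell_band (fun x => D x /\ ~ slice_cont D f x).
- by apply/(definableP _ x0); rewrite /slice_cont; dsolve.
- exact: ultra_and.
have [_ [_ [C [[<- <-] sC [l [u [bl bu ne ED]]]]]]] := sD.
have [_ [_ [C1 [[<- <-] sC1 [l1 [u1 [bl1 bu1 ne1 ED1]]]]]]] := sD1.
have [x Dx] := ultra_ex FU UD1; move: Dx; have [w [t ->]] := snocP x.
rewrite ED1 => /band_snoc[C1w lt ut].
(* The height [t] is fixed, and [V] concentrates so close to [w] that almost every [snoc w' t] is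
   still in [D1]. *)
have [V [FV sV VC VN]] := gen_ultra dlo sC1 C1w (near_lohi dlo bl1 bu1 C1w lt ut).
have dD1 := scell_definable x0 sD1.
have [|||C' [sC' C'A VC' cf]] := @cdn s V (fun w' => D1 (snoc w' t)) (fun w' => f (snoc w' t)) FV sV.
- by apply/(definableP _ x0); dsolve.
- apply: (ultra_mono FV _ (ultra_and FV VC VN)) => w' [C1w' /(_ C1w')[? ?]].
  by rewrite ED1; apply/band_snoc.
- by rewrite /dmap; dsolve.
have C'C : C' `<=` C.
  by move=> w' /C'A/D1D[+ _]; rewrite ED => /band_snoc[].
have [v C'v] := scell_nonempty x0 sC'.
have [_] := D1D _ (C'A v C'v); apply=> c; rewrite col'_snoc snoc_max.
have N := scell_open dlo sC' sC C'C C'v.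
have [H1 H2] := cf v C'v c; split=> [/H1|/H2] N';
  by apply: near_mono (near_and N N') => w' [Hw Hc]; rewrite ED => /band_snoc[/Hw/Hc].
Qed.

(** Monotonicity and continuity in the last variable plus continuity of the slices give joint
    continuity: the bound is secured at [t1 < t < t2], spread along the two slices to nearby [w'],
    and holds in between by [btw]. *)
Lemma cell_contin A f : definable A -> U A -> dmap f ->
  exists C, [/\ scell (true :: s) C, C `<=` A, U C & contin C f].
Proof.
move=> dA UA df; have [D [sD DA UD HD]] := cell_monotone dA UA df.
have dD := scell_definable x0 sD.
have [||C [sC CD UC]] := @cell_band (fun x => D x /\ slice_cont D f x).
- by apply/(definableP _ x0); rewrite /slice_cont; dsolve.
- exact: ultra_slice.
exists C; split=> //; first by move=> x /CD[/DA].
have [_ [_ [B [[<- <-] sB [l [u [bl bu ne EC]]]]]]] := sC.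
move=> x; have [w [t ->]] := snocP x => Cx c.
have [Dx _] := CD _ Cx; have [ct_f _] := HD w t Dx; have [hlo hhi] := ct_f c.
move: (Cx); rewrite {1}EC => /band_snoc[Bw lt ut].
have [a2 [a2t N1]] := near_lo dlo bl Bw lt; have [b2 [tb2 N2]] := near_hi dlo bu Bw ut.
have inC t1 : a2 < t1 -> t1 < b2 -> C (snoc w t1).
  move=> ? ?; rewrite EC; apply/band_snoc; split=> //.
    exact: (near_self N1).
  exact: (near_self N2).
have inD w' t1 : C (snoc w' t1) -> D (snoc w' t1) by move=> /CD[].
have slice t1 : a2 < t1 -> t1 < b2 ->
    (c < f (snoc w t1) -> near w (fun w' => D (snoc w' t1) -> c < f (snoc w' t1))) /\
    (f (snoc w t1) < c -> near w (fun w' => D (snoc w' t1) -> f (snoc w' t1) < c)).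
  by move=> ? ?; have [_ /(_ c)] := CD _ (inC t1 ltac:(ord) ltac:(ord)); rewrite col'_snoc snoc_max.
split=> fc.
- have [a [b [at_ tb H]]] := hlo fc.
  have [t1 [t1t at1 a2t1]] := below_gt dlo at_ a2t.
  have [t2 [tt2 t2b t2b2]] := above_lt dlo tb tb2.
  have [/(_ (H t1 at1 ltac:(ord))) M1 _] := slice t1 a2t1 ltac:(ord).
  have [/(_ (H t2 ltac:(ord) t2b)) M2 _] := slice t2 ltac:(ord) t2b2.
  apply: near_mono (near_snoc (near_and (near_and N1 N2) (near_and M1 M2)) t1t tt2) => y.
  have [w' [t' ->]] := snocP y; rewrite col'_snoc snoc_max => -[[[Hl Hu] [F1 F2]] t1t' t't2] Cy.
  move: (Cy); rewrite {1}EC => /band_snoc[Bw' _ _].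
  have C1 : C (snoc w' t1) by rewrite EC; apply/band_snoc; split=> //; [apply: Hl|apply: Hu] => //; ord.
  have C2 : C (snoc w' t2) by rewrite EC; apply/band_snoc; split=> //; [apply: Hl|apply: Hu] => //; ord.
  have [_ /(_ t1 t2 (inD _ _ C1) (inD _ _ C2) (ltW t1t') (ltW t't2))] := HD w' t' (inD _ _ Cy).
  by have := F1 (inD _ _ C1); have := F2 (inD _ _ C2) => ? ? [[? ?]|[? ?]]; ord.
- have [a [b [at_ tb H]]] := hhi fc.
  have [t1 [t1t at1 a2t1]] := below_gt dlo at_ a2t.
  have [t2 [tt2 t2b t2b2]] := above_lt dlo tb tb2.
  have [_ /(_ (H t1 at1 ltac:(ord))) M1] := slice t1 a2t1 ltac:(ord).
  have [_ /(_ (H t2 ltac:(ord) t2b)) M2] := slice t2 ltac:(ord) t2b2.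
  apply: near_mono (near_snoc (near_and (near_and N1 N2) (near_and M1 M2)) t1t tt2) => y.
  have [w' [t' ->]] := snocP y; rewrite col'_snoc snoc_max => -[[[Hl Hu] [F1 F2]] t1t' t't2] Cy.
  move: (Cy); rewrite {1}EC => /band_snoc[Bw' _ _].
  have C1 : C (snoc w' t1) by rewrite EC; apply/band_snoc; split=> //; [apply: Hl|apply: Hu] => //; ord.
  have C2 : C (snoc w' t2) by rewrite EC; apply/band_snoc; split=> //; [apply: Hl|apply: Hu] => //; ord.
  have [_ /(_ t1 t2 (inD _ _ C1) (inD _ _ C2) (ltW t1t') (ltW t't2))] := HD w' t' (inD _ _ Cy).
  by have := F1 (inD _ _ C1); have := F2 (inD _ _ C2) => ? ? [[? ?]|[? ?]]; ord.
Qed.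

End Step.

Lemma cell_decompP n : cell_decomp n.
Proof.
elim: n => [|n IH]; first exact: cell_decomp0.
move=> _ U A f FU [b [s [-> sU H]]] dA UA df.
case: b H => [ng|[g [dg Ug]]].
  exact: (cell_contin IH FU sU ng dA UA df).
exact: (cell_graph IH FU sU dA UA df dg Ug).
Qed.

End CellDecomposition.

(** * Types generated by cells *)

Section Types.
Variables (d : Order.disp_t) (M : orderTopologicalType d) (L : signature).
Variables (str : expansion M L) (dlo : dense_without_endpoints M) (omin : o_minimal str).
Variable x0 : M.
Implicit Types P Q : M -> Prop.
Local Notation dmap := (dmap str).
Local Notation drel := (drel str).
Local Notation dfam := (dfam str).
Local Notation dset := (dset str).
Local Notation definable := (definable str).

Definition above P t := exists s, s < t /\ P s.

Definition from P t := exists s, s <= t /\ P s.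

(** Applied to fibres [P] of [S b] and [Q] of [S b']. The cut is no point of the line; [above Q],
    which starts at the infimum of [Q], approximates its right-hand side. *)
Definition initial P Q t := above Q t /\ forall s, above Q s -> s <= t -> P s.

(* Without a last point, so that [cut_cell] is a band. *)
Definition segment P Q t := above Q t /\ exists t', t < t' /\ initial P Q t'.

Lemma above_le P s t : above P s -> s <= t -> above P t.
Proof. by move=> [r [rs Pr]] st; exists r; split=> //; ord. Qed.

Lemma above_glb P a t : is_glb P a -> (above P t <-> a < t).
Proof.
move=> [la ga]; split=> [[s [st /la ?]]|/ga[s [Ps st]]]; first ord.
by exists s.
Qed.

Lemma above_inf P s : dset P -> P s -> ~ (forall t, above P t) -> is_glb P (inf_ x0 P).
Proof.
move=> dP Ps /existsNP[t nt].
have [|b gb] := @glb_ex _ _ _ _ dlo omin P t s dP _ Ps; last by rewrite (inf_E x0 gb).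
by move=> u Pu; rewrite leNgt; apply/negP => ut; apply: nt; exists u.
Qed.

Lemma segment_sub P Q t : segment P Q t -> P t.
Proof. by move=> [Qt [t' [tt' [_]]]]; apply => //; exact: ltW. Qed.

(** Identifies the upper end of the segment with an infimum, so that it is a definable function of
    the base point. When there is no such infimum, [segment_all] takes over with the bound at
    infinity. *)
Lemma segment_glb P Q a t : is_glb (fun t => above Q t /\ ~ initial P Q t) a ->
  (segment P Q t <-> above Q t /\ t < a).
Proof.
move=> [la ga]; split=> [[Qt [t' [tt' [Qt' It']]]]|[Qt ta]].
  split=> //; rewrite ltNge; apply/negP => at_.
  have [v [[Qv Iv] vt']] := ga t' ltac:(ord); apply: Iv; split=> // r Qr rv.
  by apply: It' => //; ord.
split=> //; have [t' [tt' t'a]] := dlo_dense dlo ta; exists t'; split=> //.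
apply: contrapT => It'; have : a <= t' by apply: la; split=> //; apply: above_le Qt _; exact: ltW.
by move=> ?; ord.
Qed.

Lemma segment_all P Q t : (forall t, above Q t -> initial P Q t) -> (segment P Q t <-> above Q t).
Proof.
move=> H; split=> [[]//|Qt]; split=> //; have [t' tt'] := dlo_no_max dlo t.
by exists t'; split=> //; apply: H; apply: above_le Qt _; exact: ltW.
Qed.

Lemma segment_inf P Q t : dset P -> dset Q -> segment P Q t ->
  ~ (forall t, above Q t -> initial P Q t) ->
  is_glb (fun t => above Q t /\ ~ initial P Q t) (inf_ x0 (fun t => above Q t /\ ~ initial P Q t)).
Proof.
move=> dP dQ [Qt [t' [tt' [_ It']]]] /existsNP[v /not_implyP[Qv Iv]].
have [|||b gb] := @glb_ex _ _ _ _ dlo omin (fun t => above Q t /\ ~ initial P Q t) t v.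
- by rewrite /dset /initial /above; dsolve.
- move=> u [Qu Iu]; rewrite leNgt; apply/negP => ut; apply: Iu; split=> // r Qr ru.
  by apply: It' => //; ord.
- by [].
by rewrite (inf_E x0 gb).
Qed.

Lemma dfam_definable m n (S : 'rV[M]_m -> set 'rV[M]_n) c : dfam S -> definable (S c).
Proof. by move=> dS; apply/(definableP _ x0); dsolve. Qed.

Definition generated_by n k (U : set (set 'rV[M]_n)) (Psi : 'rV[M]_k -> set 'rV[M]_n) :=
  [/\ UltraFilter U, dfam Psi, forall c, U (Psi c) -> cell str (Psi c) &
    forall A, definable A -> U A -> exists c, U (Psi c) /\ Psi c `<=` A].

Definition directed m n (S : 'rV[M]_m -> set 'rV[M]_n) (B : set 'rV[M]_m) :=
  [/\ exists b, B b, forall b, B b -> exists x, S b x &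
    forall b b', B b -> B b' -> exists b'', B b'' /\ forall x, S b'' x -> S b x /\ S b' x].

(** The last clause is what makes the type definable: a definable set belongs to [U] exactly if it
    contains some [Psi c] in [U]. *)
Definition extends_to_generated n := forall m (S : 'rV[M]_m -> set 'rV[M]_n) (B : set 'rV[M]_m),
  dfam S -> directed S B ->
  exists U k (Psi : 'rV[M]_k -> set 'rV[M]_n), [/\ generated_by U Psi,
    forall b, B b -> U (S b) & definable B -> definable (fun c => U (Psi c))].

Lemma extends0 : extends_to_generated 0.
Proof.
move=> m S B dS [[b0 Bb0] ne _].
have E (x y : 'rV[M]_0) : x = y by apply/rowP => -[].
pose pt : 'rV[M]_0 := (\row_i x0)%R.
have [||U [FU /(_ tt) Ux]] := @ultra_base _ unit (fun=> [set pt]) (inhabits tt).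
- by move=> _; exists pt.
- by move=> _ _; exists tt.
have UE (A : set 'rV[M]_0) x : A x -> U A by move=> Ax; apply: (ultra_mono FU _ Ux) => y _; rewrite (E y x).
exists U, 0, (fun=> setT); split.
- split=> //; first exact: dpred_const.
  move=> A _ /(ultra_ex FU)[x Ax]; exists pt; split; first exact: (UE _ pt).
  by move=> y _; rewrite (E y x).
- by move=> b /ne[x Sx]; apply: UE Sx.
- by move=> _; apply/(definableP _ x0); apply: dpred_const.
Qed.

Lemma generated_graph n k (U : set (set 'rV[M]_n)) (Psi : 'rV[M]_k -> set 'rV[M]_n) g :
  generated_by U Psi -> dmap g ->
  exists Psi' : 'rV[M]_k -> set 'rV[M]_n.+1,
    generated_by (fun A => U (fun w => A (snoc w (g w)))) Psi' /\
    (definable (fun c => U (Psi c)) -> definable (fun c => U (fun w => Psi' c (snoc w (g w))))).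
Proof.
move=> [FU dPsi cPsi gPsi] dg; have [s sU] := usig_ex str U.
have [||C [sC _ UC cg]] := @cell_decompP _ _ _ _ dlo omin x0 n s U setT g FU sU _ _ dg.
- by apply/(definableP _ x0); apply: dpred_const.
- exact: filterT.
have dC := scell_definable x0 sC.
(* The last conjunct empties every instance whose base is not inside [C], where [g] is continuous;
   the instances that remain in the ultrafilter are cells. *)
pose Psi' c x := [/\ Psi c (col' ord_max x), x ord0 ord_max = g (col' ord_max x) & forall w, Psi c w -> C w].
have PsiE c w : Psi' c (snoc w (g w)) <-> Psi c w /\ forall w, Psi c w -> C w.
  by rewrite /Psi' col'_snoc snoc_max; split=> [[]|[]].
have UE c : U (fun w => Psi' c (snoc w (g w))) <-> U (Psi c) /\ forall w, Psi c w -> C w.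
  split=> [UP|[UP PC]]; last by apply: (ultra_mono FU _ UP) => w Pw; apply/PsiE.
  split; first by apply: (ultra_mono FU _ UP) => w /PsiE[].
  by have [w /PsiE[]] := ultra_ex FU UP.
exists Psi'; split; last first.
  pose Z c := U (Psi c); move=> dZ; have {}dZ : definable Z by [].
  rewrite (_ : (fun c => _) = fun c => Z c /\ forall w, Psi c w -> C w).
    by apply/(definableP _ x0); dsolve.
  by apply/funext => c; apply/propext; rewrite UE.
split.
- exact: ultra_push.
- by rewrite /dfam /Psi'; dsolve.
- move=> c /UE[UPc PC]; exists (Psi c); split; first exact: cPsi.
  left; exists g; split.
    split; first by apply: (definable_graph x0) => //; apply: dfam_definable.
    by apply: (contin_continuous dlo); apply: contin_sub cg.
  by apply/seteqP; split=> x; [move=> [? ? _]|move=> [? ?]].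
- move=> A dA UA; have [|c [UPc PcA]] := gPsi (fun w => C w /\ A (snoc w (g w))) _ (ultra_and FU UC UA).
    by apply/(definableP _ x0); dsolve.
  exists c; split; first by apply/UE; split=> // w /PcA[].
  move=> x; have [w [t ->]] := snocP x; rewrite /Psi' col'_snoc snoc_max => -[Pw -> _].
  by have [] := PcA w Pw.
Qed.

End Types.

(** * The cut just above the infima of the fibres *)

Section Cut.
Variables (d : Order.disp_t) (M : orderTopologicalType d) (L : signature).
Variables (str : expansion M L) (dlo : dense_without_endpoints M) (omin : o_minimal str).
Variable x0 : M.
Local Notation dmap := (dmap str).
Local Notation drel := (drel str).
Local Notation dfam := (dfam str).
Local Notation dset := (dset str).
Local Notation definable := (definable str).
Local Notation dcont := (definable_continuous str).

Variables (n m k : nat) (S : 'rV[M]_m -> set 'rV[M]_n.+1) (B : set 'rV[M]_m).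
Variables (V : set (set 'rV[M]_n)) (Psi : 'rV[M]_k -> set 'rV[M]_n).
Hypotheses (dS : dfam S) (dirS : directed S B) (genV : generated_by str V Psi).
Hypothesis VS : forall b, B b -> V (fun w => exists t, S b (snoc w t)).
Hypothesis no_section : forall g, dmap g -> exists b, B b /\ ~ V (fun w => S b (snoc w (g w))).

Let FV : UltraFilter V. Proof. by case: genV. Qed.
Let dPsi : dfam Psi. Proof. by case: genV. Qed.

Definition fib b w t := S b (snoc w t).

Let dfib b : drel (fib b). Proof. by rewrite /drel /fib; dsolve. Qed.

Let dfib1 b w : dset (fib b w). Proof. by rewrite /dset /fib; dsolve. Qed.

Lemma dir2 b b' : B b -> B b' -> exists b'', B b'' /\
  forall w t, fib b'' w t -> fib b w t /\ fib b' w t.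
Proof.
by have [_ _ H] := dirS => Bb Bb'; have [b'' [? Hb]] := H b b' Bb Bb'; exists b''; split=> // w t /Hb.
Qed.

(** These [g] form the upper half of a cut in the definable functions; by [not_below_all] each other
    one lies strictly below almost all fibres of some [S b]. *)
Definition below_all g := dmap g /\ forall b, B b -> V (fun w => from (fib b w) (g w)).

(** Otherwise [g w] is itself the least point of the fibre, almost everywhere, and belongs to every
    smaller [S b2]. But some [S b1] omits [g]. *)
Lemma no_min g b : below_all g -> B b ->
  ~ V (fun w => forall t, fib b w t -> g w <= t).
Proof.
move=> [dg Hg] Bb Vb; have [b1 [Bb1]] := no_section dg; apply.
have [b2 [Bb2 H2]] := dir2 Bb Bb1.
apply: (ultra_mono FV _ (ultra_and FV (Hg b2 Bb2) Vb)) => w [[s [sg /H2[Sb Sb1]]] H].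
by rewrite (_ : g w = s) //; apply/le_anti/andP; split=> //; apply: H.
Qed.

Lemma below_all_min g g' : below_all g -> below_all g' -> exists h, below_all h /\
  forall w, h w <= g w /\ h w <= g' w.
Proof.
move=> [dg Hg] [dg' Hg']; pose h w := inf_ x0 (fun t => t = g w \/ t = g' w).
have hE w : (h w = g w \/ h w = g' w) /\ forall u, u = g w \/ u = g' w -> h w <= u.
  apply: (@inf_is_min _ _ x0 _ [:: g w; g' w] (g w)); last by left.
  by move=> u; rewrite !inE; split=> [[]->|/orP[]/eqP->]; rewrite ?eqxx ?orbT; [| |left|right].
exists h; split; last by move=> w; have [_ H] := hE w; split; apply: H; [left|right].
split; first by rewrite /dmap /h; dsolve.
move=> b Bb; apply: (ultra_mono FV _ (ultra_and FV (Hg b Bb) (Hg' b Bb))) => w [? ?].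
by have [[]-> _] := hE w.
Qed.

Lemma cut_ex : exists U, [/\ UltraFilter U, proj U = V,
  forall b, B b -> U (fun x => from (fib b (col' ord_max x)) (x ord0 ord_max)) &
  forall g, below_all g -> U (fun x => x ord0 ord_max < g (col' ord_max x))].
Proof.
have [[b0 Bb0] _ _] := dirS.
pose I := ({A | V A} * {b | B b} * option {g | below_all g})%type.
pose E (i : I) : set 'rV[M]_n.+1 := fun x => [/\ sval i.1.1 (col' ord_max x),
  from (fib (sval i.1.2) (col' ord_max x)) (x ord0 ord_max) &
  hi (omap sval i.2) (col' ord_max x) (x ord0 ord_max)].
have VT := ultra_T FV.
have [|||U [FU UE]] := @ultra_base _ I E.
- by split; split; [split; [exists setT|exists b0]|exact: None].
- move=> [[[A VA] [b Bb]] [[g bg]|]]; rewrite /E /=; last first.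
    have [w [Aw [t St]]] := ultra_ex FV (ultra_and FV VA (VS Bb)).
    by exists (snoc w t); rewrite col'_snoc snoc_max; split=> //; exists t.
  (* If the basic set were empty, [g] would bound the fibres of [S b] from below over [A]. *)
  apply: contrapT => none; apply: (no_min bg Bb).
  apply: (ultra_mono FV _ VA) => w Aw t St; rewrite leNgt; apply/negP => tg.
  apply: none; exists (snoc w t); rewrite col'_snoc snoc_max; split=> //.
  by exists t.
- move=> [[[A VA] [b Bb]] og] [[[A' VA'] [b' Bb']] og'].
  have [b2 [Bb2 H2]] := dir2 Bb Bb'.
  have [oh Hh] : exists oh : option {g | below_all g}, forall w t,
      hi (omap sval oh) w t -> hi (omap sval og) w t /\ hi (omap sval og') w t.
    case: og og' => [[g bg]|] [[g' bg']|] /=; last by exists None.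
    - have [h [bh hg]] := below_all_min bg bg'; exists (Some (exist _ h bh)) => w t /= th.
      by have [? ?] := hg w; split; ord.
    - by exists (Some (exist _ g bg)).
    - by exists (Some (exist _ g' bg')).
  exists (exist _ _ (ultra_and FV VA VA'), exist _ b2 Bb2, oh) => x [/= [? ?] [s [st /H2[? ?]]] /Hh[? ?]].
  by split; split=> //=; exists s.
exists U; split=> //.
- have FP := ultra_proj FU; apply: (@max_filter _ _ FV) => A VA.
  by apply: (ultra_mono FU _ (UE (exist _ A VA, exist _ b0 Bb0, None))) => x [].
- by move=> b Bb; apply: (ultra_mono FU _ (UE (exist _ setT VT, exist _ b Bb, None))) => x [].
- move=> g bg.
  by apply: (ultra_mono FU _ (UE (exist _ setT VT, exist _ b0 Bb0, Some (exist _ g bg)))) => x [].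
Qed.

Section WithCut.
Variable U : set (set 'rV[M]_n.+1).
Hypotheses (FU : UltraFilter U) (projU : proj U = V).
Hypothesis Ufrom : forall b, B b -> U (fun x => from (fib b (col' ord_max x)) (x ord0 ord_max)).
Hypothesis Ubelow : forall g, below_all g -> U (fun x => x ord0 ord_max < g (col' ord_max x)).

Lemma ultra_base_set (A : set 'rV[M]_n) : V A -> U (fun x => A (col' ord_max x)).
Proof. by rewrite -projU. Qed.

Lemma not_below_all g : dmap g -> ~ below_all g ->
  exists b, B b /\ V (fun w => forall t, fib b w t -> g w < t).
Proof.
move=> dg ng; apply: contrapT => H; apply: ng; split=> // b Bb.
apply: contrapT => /(ultra_not _ FV) Vb; apply: H; exists b; split=> //.
apply: (ultra_mono FV _ Vb) => w nf t St; rewrite ltNge; apply/negP => tg; apply: nf.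
by exists t.
Qed.

Lemma cut_nograph f : dmap f -> ~ U (graph setT f).
Proof.
move=> df Uf; have [bf|nbf] := pselect (below_all f).
  have [x [[_ xf]]] := ultra_ex FU (ultra_and FU Uf (Ubelow bf)).
  by rewrite xf ltxx.
have [b [Bb Vb]] := not_below_all df nbf.
have [x [[[_ xf] [s [st Ss]]] H]] :=
  ultra_ex FU (ultra_and FU (ultra_and FU Uf (Ufrom Bb)) (ultra_base_set Vb)).
by have := H s Ss; rewrite -xf => ?; ord.
Qed.

Lemma cut_lower l : (if l is Some f then dmap f else True) ->
  U (fun x => lo l (col' ord_max x) (x ord0 ord_max)) ->
  exists b, B b /\ V (fun w => forall t, fib b w t -> lo l w t).
Proof.
case: l => [f|] /= df Uf; last first.
  by have [[b Bb] _ _] := dirS; exists b; split=> //; apply: (ultra_mono FV _ (ultra_T FV)).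
have [bf|] := pselect (below_all f); last exact: not_below_all.
have [x [xf fx]] := ultra_ex FU (ultra_and FU Uf (Ubelow bf)).
by exfalso; ord.
Qed.

Lemma cut_upper f : dmap f -> U (fun x => x ord0 ord_max < f (col' ord_max x)) -> below_all f.
Proof.
move=> df Uf; apply: contrapT => /(not_below_all df)[b [Bb Vb]].
have [x [[xf [s [sx Ss]]] H]] :=
  ultra_ex FU (ultra_and FU (ultra_and FU Uf (Ufrom Bb)) (ultra_base_set Vb)).
by have := H s Ss => ?; ord.
Qed.

Let cell_of A : definable A -> U A -> exists C l u, [/\ definable C, V C,
  cbound str C l, cbound str C u & band C l u `<=` A /\ U (band C l u)].
Proof.
move=> dA UA; have [s sV] := usig_ex str V.
have sU : usig str s (proj U) by rewrite projU.
have [D [sD DA UD]] := cell_band dlo omin x0 (@cell_decompP _ _ _ _ dlo omin x0 n) FU sU cut_nograph dA UA.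
have [_ [_ [C [[<- <-] sC [l [u [bl bu _ ED]]]]]]] := sD.
exists C, l, u; rewrite -ED; split=> //; first exact: scell_definable sC.
rewrite -projU; apply: (ultra_mono FU _ UD) => x.
by have [w [t ->]] := snocP x; rewrite ED col'_snoc => /band_snoc[].
Qed.

Let bound_dmap (C : set 'rV[M]_n) l : cbound str C l -> if l is Some f then dmap f else True.
Proof. by case: l => // f []. Qed.

Let ultra_band (C : set 'rV[M]_n) l u : U (band C l u) -> [/\ V C,
  U (fun x => lo l (col' ord_max x) (x ord0 ord_max)) &
  U (fun x => hi u (col' ord_max x) (x ord0 ord_max))].
Proof.
move=> UD; split; rewrite -?projU; apply: (ultra_mono FU _ UD) => x;
  by have [w [t ->]] := snocP x; rewrite ?col'_snoc ?snoc_max => /band_snoc[].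
Qed.

(** A band of [U] outside [S b] has its lower bound under the fibres of some [S b2] inside [S b].
    These fibres must then lie beyond its upper bound, which is in the upper half of the cut,
    against [no_min]. *)
Lemma cut_family b : B b -> U (S b).
Proof.
move=> Bb; apply: contrapT => /(ultra_not _ FU) nS.
have [|C [l [u [dC VC bl bu [CN UC]]]]] := @cell_of (fun x => ~ S b x) _ nS.
  by apply/(definableP _ x0); dsolve.
have [_ Ul Uu] := ultra_band UC.
have [b1 [Bb1 V1]] := cut_lower (bound_dmap bl) Ul.
have [b2 [Bb2 H2]] := dir2 Bb Bb1.
have V2 : V (fun w => forall t, fib b2 w t -> ~ hi u w t).
  apply: (ultra_mono FV _ (ultra_and FV V1 VC)) => w [H Cw] t /H2[St S1t] ut.
  by apply: (CN (snoc w t)) => //; apply/band_snoc; split=> //; apply: H.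
case: u bu Uu V2 {UC CN} => [f [df _] /= Uf V2|_ _ V2].
  apply: (no_min (cut_upper df Uf) Bb2); apply: (ultra_mono FV _ V2) => w H t /H.
  by rewrite leNgt => /negP.
by have [w [H [t St]]] := ultra_ex FV (ultra_and FV V2 (VS Bb2)); case: (H t St).
Qed.

(** If not, the last coordinate is the least point of the fibre, so that [U] contains the graph of
    an infimum. *)
Lemma cut_above b : B b -> U (fun x => above (fib b (col' ord_max x)) (x ord0 ord_max)).
Proof.
move=> Bb; apply: contrapT => /(ultra_not _ FU) nU.
apply: (@cut_nograph (fun w => inf_ x0 (fib b w))); first by rewrite /dmap /fib; dsolve.
apply: (ultra_mono FU _ (ultra_and FU nU (Ufrom Bb))) => x [na [s [sx Ss]]]; split=> //=.
have bnd t : fib b (col' ord_max x) t -> x ord0 ord_max <= t.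
  by move=> St; rewrite leNgt; apply/negP => ?; apply: na; exists t.
have sE : s = x ord0 ord_max by apply/le_anti/andP; split=> //; apply: bnd.
by apply/esym/inf_E; split=> // c xc; exists s; rewrite sE in Ss *.
Qed.

Lemma above_lo l b w : (forall t, fib b w t -> lo l w t) -> forall t, above (fib b w) t -> lo l w t.
Proof. by case: l => //= f H t [s [st /H ?]]; ord. Qed.

(* Membership in [U] expressed by [B] and [V], hence definable when these are. *)
Definition crit (A : set 'rV[M]_n.+1) := exists b0, B b0 /\ forall b, B b ->
  exists z, V (Psi z) /\ forall w, Psi z w ->
  exists t, from (fib b w) t /\ forall s, above (fib b0 w) s -> s <= t -> A (snoc w s).

Lemma cut_crit A : definable A -> U A -> crit A.
Proof.
move=> dA UA; have [C [l [u [dC VC bl bu [CA UC]]]]] := cell_of dA UA.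
have [_ Ul Uu] := ultra_band UC.
have [b0 [Bb0 V0]] := cut_lower (bound_dmap bl) Ul; exists b0; split=> // b Bb.
have [_ _ _ gen] := genV.
have [||z [Vz Hz]] := gen (fun w => C w /\ exists t, from (fib b w) t /\
    forall s, above (fib b0 w) s -> s <= t -> A (snoc w s)); last first.
- by exists z; split=> // w /Hz[].
- apply: (ultra_and FV VC); rewrite -projU.
  apply: (ultra_mono FU _ (ultra_and FU (ultra_and FU UC (Ufrom Bb)) (ultra_base_set V0))) => x.
  have [w [t ->]] := snocP x; rewrite col'_snoc snoc_max => -[[/band_snoc[Cw lt ut] ft] H].
  exists t; split=> // s /(above_lo H) ls st; apply: CA; apply/band_snoc; split=> //.
  by case: (u) ut => //= f ?; ord.
- by apply/(definableP _ x0); rewrite /from /above /fib; dsolve.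
Qed.

(** If [A] is not in [U], its complement passes the test too. The witnesses for both meet at a point
    [a] which no point of [fib b2] precedes, so [a] is the infimum of that fibre and lies in [S b];
    but [b] was chosen to omit this infimum. *)
Lemma crit_cut A : definable A -> crit A -> U A.
Proof.
move=> dA [b0 [Bb0 H0]]; apply: contrapT => /(ultra_not _ FU) nA.
have [|b1 [Bb1 H1]] := @cut_crit (fun x => ~ A x) _ nA.
  by apply/(definableP _ x0); dsolve.
have [b2 [Bb2 H2]] := dir2 Bb0 Bb1.
have [b [Bb]] := @no_section (fun w => inf_ x0 (fib b2 w)) ltac:(by rewrite /dmap /fib; dsolve).
apply; have [b3 [Bb3 H3]] := dir2 Bb Bb2.
have [z [Vz Hz]] := H0 b3 Bb3; have [z' [Vz' Hz']] := H1 b3 Bb3.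
apply: (ultra_mono FV _ (ultra_and FV Vz Vz')) => w [/Hz[t [ft At]] /Hz'[t' [ft' At']]].
have ab2 s : above (fib b2 w) s -> above (fib b0 w) s /\ above (fib b1 w) s.
  by move=> [r [rs /H2[? ?]]]; split; exists r.
have [a [fa at_ at']] : exists a, [/\ from (fib b3 w) a, a <= t & a <= t'].
  by have [?|/ltW ?] := leP t t'; [exists t|exists t'].
have na : ~ above (fib b2 w) a by move=> /ab2[/At Aa /At' nAa]; apply: nAa => //; exact: Aa.
have bnd r : fib b2 w r -> a <= r.
  by move=> Sr; rewrite leNgt; apply/negP => ?; apply: na; exists r.
have [s [sa Ss]] := fa; have [Sbs S2s] := H3 _ _ Ss.
have sE : s = a by apply/le_anti/andP; split=> //; apply: bnd.
suff -> : inf_ x0 (fib b2 w) = s by [].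
by apply: inf_E; split=> [r /bnd|c sc]; [rewrite sE|exists s].
Qed.

Let pz (c : 'rV[M]_(k + (m + m))) : 'rV[M]_k := lsubmx c.
Let pb (c : 'rV[M]_(k + (m + m))) : 'rV[M]_m := lsubmx (rsubmx c).
Let pq (c : 'rV[M]_(k + (m + m))) : 'rV[M]_m := rsubmx (rsubmx c).

Definition rest b b' w t := above (fib b' w) t /\ ~ initial (fib b w) (fib b' w) t.

(** A conjunct of [cut_cell] that does not mention the point: if an end is discontinuous or of mixed
    kind over the base, or if some fibre is empty, the entire instance becomes empty and drops out
    of [U]. *)
Definition good_ends (C : set 'rV[M]_n) b b' :=
  [/\ (forall w, C w -> forall t, above (fib b' w) t) \/
      (forall w, C w -> is_glb (fib b' w) (inf_ x0 (fib b' w))) /\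
        contin C (fun w => inf_ x0 (fib b' w)),
      (forall w, C w -> forall t, above (fib b' w) t -> initial (fib b w) (fib b' w) t) \/
      (forall w, C w -> is_glb (rest b b' w) (inf_ x0 (rest b b' w))) /\
        contin C (fun w => inf_ x0 (rest b b' w)) &
      forall w, C w -> exists t, segment (fib b w) (fib b' w) t].

Definition cut_cell c : set 'rV[M]_n.+1 := fun x =>
  [/\ Psi (pz c) (col' ord_max x),
      segment (fib (pb c) (col' ord_max x)) (fib (pq c) (col' ord_max x)) (x ord0 ord_max) &
      good_ends (Psi (pz c)) (pb c) (pq c)].

Lemma dfam_cut_cell : dfam cut_cell.
Proof.
rewrite /dfam /cut_cell /good_ends /segment /contin /rest /initial /above /fib /pz /pb /pq.
dsolve.
Qed.

Lemma cell_cut_cell c : U (cut_cell c) -> cell str (cut_cell c).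
Proof.
move=> Uc; have VC : V (Psi (pz c)).
  by rewrite -projU; apply: (ultra_mono FU _ Uc) => x [].
have [_ _ cP _] := genV; have dC := dfam_definable x0 (pz c) dPsi.
have [x [_ _ [lowE highE ne]]] := ultra_ex FU Uc.
have dc f : dmap f -> contin (Psi (pz c)) f -> dcont (Psi (pz c)) f.
  by move=> df cf; split; [exact: definable_graph|exact: (contin_continuous dlo)].
have [l [bl lE]] : exists l, (if l is Some f then dcont (Psi (pz c)) f else True) /\
    forall w, Psi (pz c) w -> forall t, above (fib (pq c) w) t <-> lo l w t.
  case: lowE => [H|[H cf]].
    by exists None; split=> // w Cw t; split=> // _; apply: H.
  exists (Some (fun w => inf_ x0 (fib (pq c) w))); split.
    by apply: dc => //; rewrite /dmap /fib; dsolve.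
  by move=> w Cw t; apply: above_glb; apply: H.
have [u [bu uE]] : exists u, (if u is Some f then dcont (Psi (pz c)) f else True) /\
    forall w, Psi (pz c) w -> forall t,
      segment (fib (pb c) w) (fib (pq c) w) t <-> above (fib (pq c) w) t /\ hi u w t.
  case: highE => [H|[H cf]].
    exists None; split=> // w Cw t; have E := @segment_all _ _ dlo _ _ t (H w Cw).
    by rewrite E; split=> [|[]].
  exists (Some (fun w => inf_ x0 (rest (pb c) (pq c) w))); split.
    by apply: dc => //; rewrite /dmap /rest /initial /above /fib; dsolve.
  by move=> w Cw t; apply: (segment_glb dlo); apply: H.
exists (Psi (pz c)); split; first exact: cP.
right; exists l, u; split.
  split=> //; case: l u {bl bu} lE uE => [f|] [g|] // lE uE w Cw.
  have [t /(uE w Cw)[/(lE w Cw)/= ft /= tg]] := ne w Cw; ord.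
apply/predeqP => y; have [w [t ->]] := snocP y.
rewrite /cut_cell col'_snoc snoc_max; split=> [[Cw /(uE w Cw)[/(lE w Cw) ? ?] _]|].
  by apply/band_snoc.
by move=> /band_snoc[Cw ? ?]; split=> //; apply/(uE w Cw); split=> //; apply/(lE w Cw).
Qed.

Lemma cut_generates A : definable A -> U A -> exists c, U (cut_cell c) /\ cut_cell c `<=` A.
Proof.
move=> dA UA; have [C1 [l [u [dC1 VC1 bl bu [C1A UC1]]]]] := cell_of dA UA.
have [_ Ul Uu] := ultra_band UC1.
have [b1 [Bb1 V1]] := cut_lower (bound_dmap bl) Ul.
(* The fibres of [S b1] stay above the lower bound of the band, those of [S b2] omit the upper
   bound; [S b] will do both. *)
have [b2 [Bb2 V2]] : exists b2, B b2 /\ V (fun w => if u is Some f then ~ fib b2 w (f w) else True).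
  case: (u) bu => [f [df _]|_]; last by exists b1; split=> //; apply: (ultra_mono FV _ (ultra_T FV)).
  by have [b2 [Bb2 /(ultra_not _ FV) V2]] := no_section df; exists b2.
have [b [Bb Hb]] := dir2 Bb1 Bb2.
(* A second band, inside [S b], determines [b']: the fibres of [S b'] start above its lower bound,
   so that just above their infima everything belongs to [S b]. *)
have [|C2 [l2 [u2 [dC2 VC2 bl2 bu2 [C2A UC2]]]]] :=
    @cell_of (fun x => A x /\ S b x) _ (ultra_and FU UA (cut_family Bb)).
  by apply/(definableP _ x0); dsolve.
have [_ Ul2 Uu2] := ultra_band UC2.
have [b' [Bb' V']] := cut_lower (bound_dmap bl2) Ul2.
have Useg : U (fun x => segment (fib b (col' ord_max x)) (fib b' (col' ord_max x)) (x ord0 ord_max)).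
  apply: (ultra_mono FU _ (ultra_and FU (ultra_and FU UC2 (cut_above Bb')) (ultra_base_set V'))) => x.
  have [w [t ->]] := snocP x; rewrite col'_snoc snoc_max => -[[/band_snoc[Cw lt ut] at_] H].
  have [c [e [ct te Hce]]] := fiber_itv dlo bl2 bu2 Cw lt ut.
  have [t' [tt' t'e]] := dlo_dense dlo te.
  split=> //; exists t'; split=> //; split; first by apply: above_le at_ _; exact: ltW.
  move=> s /(above_lo H) ls st'; apply: (proj2 (C2A (snoc w s) _)); apply/band_snoc; split=> //.
  have [_ ut'] : lo l2 w t' /\ hi u2 w t'.
    by apply: Hce; ord.
  by case: (u2) ut' => //= f ?; ord.
pose seg w t := segment (fib b w) (fib b' w) t.
pose G w := [/\ C1 w, forall t, fib b1 w t -> lo l w t,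
  (if u is Some f then ~ fib b2 w (f w) else True) & exists t, seg w t /\ hi u w t].
have dG : definable G.
  apply/(definableP _ x0); rewrite /G /seg /segment /initial /above /fib.
  by case: (l) bl => [? [? _]|_]; case: (u) bu => [? [? _]|_] /=; dsolve.
have VG : V G.
  have : U (fun x => exists t, seg (col' ord_max x) t /\ hi u (col' ord_max x) t).
    by apply: (ultra_mono FU _ (ultra_and FU Useg Uu)) => x ?; exists (x ord0 ord_max).
  move=> U3; have V3 : V (fun w => exists t, seg w t /\ hi u w t) by rewrite -projU.
  by apply: (ultra_mono FV _ (ultra_and FV (ultra_and FV VC1 V1) (ultra_and FV V2 V3))) => w [[? ?] []].
(* Each end must be of one kind over the whole base, infinite or a continuous function; [V] decides
   which. *)
have [|A1 [dA1 A1G VA1 H1]] := @ultra_decide _ _ _ str x0 n V G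
    (fun w => forall t, above (fib b' w) t) FV dG VG.
  by apply/(definableP _ x0); rewrite /above /fib; dsolve.
have [|A2 [dA2 A2A VA2 H2]] := @ultra_decide _ _ _ str x0 n V A1
    (fun w => forall t, above (fib b' w) t -> initial (fib b w) (fib b' w) t) FV dA1 VA1.
  by apply/(definableP _ x0); rewrite /initial /above /fib; dsolve.
have [s sV] := usig_ex str V.
have [|C3 [sC3 C3A VC3 c3]] := @cell_decompP _ _ _ _ dlo omin x0 n s V A2
    (fun w => inf_ x0 (fib b' w)) FV sV dA2 VA2.
  by rewrite /dmap /fib; dsolve.
have [|C4 [sC4 C4C VC4 c4]] := @cell_decompP _ _ _ _ dlo omin x0 n s V C3
    (fun w => inf_ x0 (rest b b' w)) FV sV (scell_definable x0 sC3) VC3.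
  by rewrite /dmap /rest /initial /above /fib; dsolve.
have [_ _ _ gen] := genV; have [z [Vz zC4]] := gen C4 (scell_definable x0 sC4) VC4.
have zA1 w : Psi z w -> A1 w by move=> /zC4/C4C/C3A/A2A.
have good : good_ends (Psi z) b b'.
  split.
  - case: H1 => H1; [left|right]; first by move=> w /zA1; apply: H1.
    split=> [w /zA1 Aw|]; last by apply: contin_sub c3 => w /zC4/C4C.
    have [_ _ _ [t [[[s' [_ Ss']] _] _]]] := A1G w Aw.
    exact: (above_inf dlo omin x0 (dfib1 b' w) Ss' (H1 w Aw)).
  - case: H2 => H2; [left|right]; first by move=> w /zC4/C4C/C3A; apply: H2.
    split=> [w Pw|]; last exact: contin_sub c4.
    have [_ _ _ [t [Gt _]]] := A1G w (zA1 w Pw).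
    exact: (segment_inf dlo omin x0 (dfib1 b w) (dfib1 b' w) Gt (H2 w (C3A _ (C4C _ (zC4 w Pw))))).
  - by move=> w /zA1/A1G[_ _ _ [t [? _]]]; exists t.
exists (row_mx z (row_mx b b')); rewrite /cut_cell /pz /pb /pq !row_mxKr !row_mxKl; split.
  by apply: (ultra_mono FU _ (ultra_and FU Useg (ultra_base_set Vz))) => x [].
move=> x; have [w [t ->]] := snocP x; rewrite col'_snoc snoc_max => -[Pw St _].
have [C1w G1 G2 [t1 [St1 ut1]]] := A1G w (zA1 w Pw).
apply: C1A; apply/band_snoc; split=> //.
  by apply: G1; have [] := Hb w t (segment_sub St).
(* A segment reaching [f w] from [t1 < f w] would contain [f w], which [S b] omits. *)
case: (u) G2 ut1 => //= f nf t1f; rewrite ltNge; apply/negP => ft; apply: nf.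
have [_ [t' [tt' [_ It']]]] := St; have [at1 _] := St1.
suff /Hb[] : fib b w (f w) by [].
by apply: It'; [apply: above_le at1 _; exact: ltW|ord].
Qed.

Lemma cut_definable : definable B -> definable (fun z => V (Psi z)) ->
  definable (fun c => U (cut_cell c)).
Proof.
move=> dB dV; pose Z z := V (Psi z); have dZ : definable Z by [].
have dc := dfam_cut_cell.
rewrite (_ : (fun c => _) = fun c => crit (cut_cell c)).
  apply/(definableP _ x0); rewrite /crit -/Z /from /above /fib.
  rewrite (_ : (fun e => _) = fun e => exists b0, B b0 /\ forall b, B b ->
    exists z, Z z /\ forall w, Psi z w -> exists t, (exists s, s <= t /\ S b (snoc w s)) /\
    forall s, (exists s', s' < s /\ S b0 (snoc w s')) -> s <= t -> cut_cell (erow _ e) (snoc w s)) //.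
  by dsolve.
apply/funext => c; apply/propext.
have dcc := dfam_definable x0 c dc.
by split; [exact: cut_crit|exact: crit_cut].
Qed.

End WithCut.
End Cut.

Section Existence.
Variables (d : Order.disp_t) (M : orderTopologicalType d) (L : signature).
Variables (str : expansion M L) (dlo : dense_without_endpoints M) (omin : o_minimal str).
Variable x0 : M.

Lemma generated_ex n : extends_to_generated str n.
Proof.
elim: n => [|n IH]; first by move=> m S B; apply: (extends0 x0).
move=> m S B dS dirS; pose T b w := exists t, S b (snoc w t).
have dT : dfam str T by rewrite /dfam /T; dsolve.
have [|V [k [Psi [genV VT dV]]]] := IH m T B dT.
  have [Bne ne dir] := dirS; split=> // [b /ne[x]|b b' Bb Bb'].
    by have [w [t ->]] := snocP x => Sx; exists w, t.
  have [b'' [Bb'' H]] := dir b b' Bb Bb'; exists b''; split=> // w [t /H[? ?]].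
  by split; exists t.
have [FV dPsi _ _] := genV.
have [[g [dg Hg]]|ng] := pselect (exists g, dmap str g /\
    forall b, B b -> V (fun w => S b (snoc w (g w)))).
  have [Psi' [gen' dd]] := generated_graph dlo omin x0 genV dg.
  by exists (fun A => V (fun w => A (snoc w (g w)))), k, Psi'; split=> // /dV/dd.
have no_section g : dmap str g -> exists b, B b /\ ~ V (fun w => S b (snoc w (g w))).
  move=> dg; apply: contrapT => H; apply: ng; exists g; split=> // b Bb.
  by apply: contrapT => nV; apply: H; exists b.
have [U [FU projU Uf Ub]] := cut_ex x0 dirS genV VT no_section.
exists U, (k + (m + m))%N, (cut_cell x0 S Psi); split.
- split=> //.
  + exact: (dfam_cut_cell x0 dS genV).
  + by move=> c; apply: (cell_cut_cell dlo dS genV FU projU).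
  + by move=> A; apply: (cut_generates dlo omin x0 dS dirS genV VT no_section FU projU Uf Ub).
- by move=> b; apply: (cut_family dlo omin x0 dS dirS genV VT no_section FU projU Uf Ub).
- move=> dB; apply: (cut_definable dlo omin x0 dS dirS genV no_section FU projU Uf Ub) => //.
  exact: dV.
Qed.

End Existence.

(** * From ultrafilters back to types and formulas *)

Section Formulas.
Variables (d : Order.disp_t) (M : orderTopologicalType d) (L : signature).
Variables (str : expansion M L) (dlo : dense_without_endpoints M) (omin : o_minimal str).
Variable x0 : M.
Local Notation definable := (definable str).

Lemma directed_type n m (phi : formula L M (n + m)) (B : set 'rV[M]_m) :
  consistent (sets_of str (inst phi @` B)) ->
  downward_directed (sets_of str (inst phi @` B)) ->
  exists (p : set (formula L M n)) k (psi : formula L M (n + k)),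
    [/\ complete_type str p, inst phi @` B `<=` p,
        (forall C, sets_of str (restr1 p psi) C -> cell str C) /\
        downward_directed (sets_of str (restr1 p psi)),
        forall chi, p chi -> exists c, p (inst psi c) /\
          defset str (inst psi c) `<=` defset str chi &
        definable B -> definable_type str p].
Proof.
move=> cons dir.
have [m' [S [B' [dS dirS BS dB']]]] : exists m' (S : 'rV[M]_m' -> set 'rV[M]_n) (B' : set 'rV[M]_m'),
    [/\ dfam str S, directed S B',
      forall b, B b -> exists b', B' b' /\ S b' `<=` defset str (inst phi b) &
      definable B -> definable B'].
  have [[b0 Bb0]|noB] := pselect (exists b, B b); last first.
    (* For empty [B] the family is replaced by the whole space, as a directed family needs a
       member. *)
    exists 0%N, (fun=> setT), setT; split.
    - exact: dpred_const.
    - split=> [|b _|b b' _ _]; [exists (\row_i x0)%R|exists (\row_i x0)%R|exists b] => //.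
    - by move=> b Bb; case: noB; exists b.
    - by move=> _; apply/(definableP _ x0); apply: dpred_const.
  pose S b : set 'rV[M]_n := fun a => sat str phi (row_mx a b).
  have SE b : defset str (inst phi b) = S b by rewrite defset_inst.
  have inB b : B b -> sets_of str (inst phi @` B) (S b).
    by move=> Bb; exists (inst phi b) => //; exists b.
  exists m, S, B; split=> //; last by move=> b Bb; exists b; rewrite SE; split=> // x.
    have dphi : definable (defset str phi) by exists phi.
    by rewrite /dfam /S -/(defset str phi _); apply: (dpred_mem dphi); dsolve.
  split; first by exists b0.
    move=> b Bb; have [||x Hx] := cons [set S b]; last by exists x; apply: Hx.
      by move=> _ ->; apply: inB.
    exact: finite_set1.
  move=> b b' Bb Bb'; have [_ [[_ [b'' Bb'' <-] <-] sub]] := dir _ _ (inB b Bb) (inB b' Bb').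
  by exists b''; split=> // x Sx; apply: sub; rewrite SE.
have [U [k [Psi [[FU dPsi cPsi gPsi] US dU]]]] := generated_ex dlo omin x0 dS dirS.
have [psi psiE] : exists psi : formula L M (n + k), forall c, defset str (inst psi c) = Psi c.
  have : definable (fun z : 'rV[M]_(n + k) => Psi (rsubmx z) (lsubmx z)).
    by apply/(definableP _ x0); dsolve.
  move=> [psi /predeqP H]; exists psi => c; rewrite defset_inst.
  apply/predeqP => a; have := H (row_mx a c); rewrite row_mxKl row_mxKr => E.
  exact: iff_sym E.
pose p : set (formula L M n) := fun chi => U (defset str chi).
have rE C : sets_of str (restr1 p psi) C <-> exists c, U (Psi c) /\ C = Psi c.
  split=> [[chi [Up [c _ Ec]] <-]|[c [Uc ->]]].
    by subst; exists c; move: Up; rewrite /p psiE.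
  by exists (inst psi c); rewrite ?psiE //; split; [rewrite /p psiE|exists c].
have dp C c : U (Psi c) -> definable C -> U C -> exists c', U (Psi c') /\ Psi c' `<=` Psi c `&` C.
  move=> Uc dC UC; apply: gPsi; last exact: ultra_and.
  have dPc := dfam_definable x0 c dPsi.
  by apply/(definableP _ x0); rewrite /setI /mkset; dsolve.
exists p, k, psi; split.
- split=> [G Gp /finite_seqP[q EG]|chi].
    suff : U (\bigcap_(A in G) A) by move=> /(ultra_ex FU)[x]; exists x.
    have {Gp} : forall A, A \in q -> U A.
      by move=> A Aq; have : G A by [rewrite EG]; move=> /Gp[chi Up <-].
    rewrite {G}EG; elim: q => [|A q IH] Uq.
      by apply: (ultra_mono FU _ (ultra_T FU)) => x _ A.
    have UA : U A by apply: Uq; rewrite mem_head.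
    have {}IH := IH (fun A Aq => Uq A (mem_behead (s := _ :: _) Aq)).
    apply: (ultra_mono FU _ (ultra_and FU UA IH)) => x [Ax Hx] A' /=.
    by rewrite inE => /predU1P[->//|]; apply: Hx.
  have [Uc|/(ultra_not _ FU) Uc] := pselect (U (defset str chi)); [by left|right].
  exact: (ultra_mono FU _ Uc).
- move=> _ [b Bb <-]; have [b' [Bb' sub]] := BS b Bb.
  by apply: (ultra_mono FU sub); apply: US.
- split=> [C /rE[c [Uc ->]]|A A' /rE[c [Uc ->]] /rE[c' [Uc' ->]]]; first exact: cPsi.
  have [c'' [Uc'' sub]] := dp _ c Uc (dfam_definable x0 c' dPsi) Uc'.
  by exists (Psi c''); split=> //; apply/rE; exists c''.
- move=> chi Up; have [|c [Uc sub]] := gPsi (defset str chi) _ Up; first by exists chi.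
  by exists c; rewrite /p psiE.
- move=> /dB'/dU dZ m1 theta; pose Z c := U (Psi c); have {}dZ : definable Z by [].
  have dth : definable (defset str theta) by exists theta.
  (* Generation turns membership in the type into a first-order condition on [b]. *)
  rewrite (_ : [set b | _] = fun b => exists c, Z c /\ forall x, Psi c x -> defset str theta (row_mx x b)).
    by apply/(definableP _ x0); dsolve.
  apply/predeqP => b; rewrite /mkset /p defset_inst; split=> [Ub|[c [Uc sub]]].
    have [|c [Uc sub]] := gPsi (fun a => defset str theta (row_mx a b)) _ Ub.
      by apply/(definableP _ x0); dsolve.
    by exists c.
  exact: (ultra_mono FU sub).
Qed.

Lemma directed_consistent n (S : set (set 'rV[M]_n)) :
  downward_directed S -> (forall A, S A -> A !=set0) -> consistent S.
Proof.
move=> dir ne G GS /finite_seqP[q EG].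
have {GS} : forall A, A \in q -> S A by move=> A Aq; apply: GS; rewrite EG.
(* The alternative [A = setT] serves the empty subfamily, as [S] may have no members. *)
rewrite {G}EG => qS; suff [A [SA HA]] : exists A, (S A \/ A = setT) /\ forall A', A' \in q -> A `<=` A'.
  have [x Ax] : A !=set0 by case: SA => [/ne//|->]; exists (\row_i x0)%R.
  by exists x => A' /HA; apply.
elim: q qS => [|A q IH] qS; first by exists setT; split=> //; right.
have SA : S A by apply: qS; rewrite mem_head.
have [|A1 [SA1 H1]] := IH; first by move=> A' A'q; apply: qS; rewrite inE A'q orbT.
case: SA1 => [SA1|E]; last first.
  exists A; split; first by left.
  move=> A'; rewrite inE => /predU1P[->//|/H1]; rewrite E => sub x _; exact: sub.
have [A2 [SA2 H2]] := dir _ _ SA SA1; exists A2; split; first by left.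
by move=> A'; rewrite inE => /predU1P[->|/H1 sub] x /H2[? ?] //; apply: sub.
Qed.

End Formulas.

Theorem proposition4p3 (d : Order.disp_t) (M : orderTopologicalType d)
    (L : signature) (str : expansion M L)
    (dlo : dense_without_endpoints M) (omin : o_minimal str) :
  (forall (n m : nat) (phi : formula L M (n + m)) (B : set 'rV[M]_m),
     consistent (sets_of str (inst phi @` B)) ->
     downward_directed (sets_of str (inst phi @` B)) ->
     exists (p : set (formula L M n)) (k : nat) (psi : formula L M (n + k)),
       [/\ complete_type str p,
           inst phi @` B `<=` p,
           (forall C, sets_of str (restr1 p psi) C -> cell str C) /\
           downward_directed (sets_of str (restr1 p psi)),
           entails str (restr1 p psi) p &
           definable str B -> definable_type str p])
  /\
  (forall (n : nat) (S : set (set 'rV[M]_n)),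
     definable_family str S ->
     downward_directed S ->
     (forall A, S A -> A !=set0) ->
     exists F : set (set 'rV[M]_n),
       [/\ definable_family str F /\ downward_directed F,
           forall C, F C -> cell str C,
           refines F S &
           exists p : set (formula L M n),
             [/\ complete_type str p, definable_type str p &
                 generates str F p]]).
Proof.
have [x0] := dlo_inhabited dlo.
split=> [n m phi B cons dir|n S [m [phi [B [dB SE]]]] dir ne].
  have [p [k [psi [cp pB cells gen dp]]]] := directed_type dlo omin x0 cons dir.
  exists p, k, psi; split=> // chi /gen[c [pc sub]].
  exists [set inst psi c]; split; last by rewrite bigcap_set1.
    by move=> _ ->; split=> //; exists c.
  exact: finite_set1.
have E : sets_of str (inst phi @` B) = S.
  rewrite SE; apply/seteqP; split=> [_ [_ [b Bb <-] <-]|_ [b Bb <-]].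
    by exists b; rewrite ?defset_inst.
  by exists (inst phi b); rewrite ?defset_inst //; exists b.
have cons := directed_consistent x0 dir ne; rewrite -E in cons dir.
have [p [k [psi [cp pB [cells dirp] gen dp]]]] := directed_type dlo omin x0 cons dir.
have inF c : p (inst psi c) -> sets_of str (restr1 p psi) (defset str (inst psi c)).
  by move=> pc; exists (inst psi c) => //; split=> //; exists c.
exists (sets_of str (restr1 p psi)); split=> //.
(* Definability of the type, applied to [psi] itself, makes the index set of the family
   definable. *)
- split=> //; exists k, psi, [set c | p (inst psi c)]; split; first exact: dp.
  apply/seteqP; split=> [_ [chi [pc [c _ Ec]] <-]|_ [c pc <-]].
    by subst; exists c; rewrite ?defset_inst.
  by rewrite -defset_inst; apply: inF.
- rewrite -E => _ [_ [b Bb <-] <-]; have [c [pc sub]] := gen _ (pB _ (imageP _ Bb)).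
  by exists (defset str (inst psi c)); split=> //; apply: inF.
exists p; split; [by []|exact: dp|split].
  by move=> _ [chi [pchi _] <-]; exists chi.
move=> chi /gen[c [pc sub]]; exists [set inst psi c]; split; last by rewrite bigcap_set1.
  by move=> _ ->; apply: inF.
exact: finite_set1.
Qed.
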